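(* Fix $\alpha \in (0,1)$. Then there exist constants $c, C > 0$ and $m_0 \in \mathbb{N}$, depending only on $\alpha$, such that for every $m \ge m_0$ that is a power of $2$ and every integer $n$ with $\frac{\alpha}{2} m^2 < n \le \alpha m^2$, the large connected component of the labeled configuration space $\widetilde{\mathrm{hex}}(n;m)$ has $L^\infty$ intrinsic diameter between $c\,m$ and $C\,m$, and its $L^\infty$ extrinsic diameter also lies between $c\,m$ and $C\,m$. (That is, the $L^\infty$ intrinsic diameter grows as $\Theta(m)$, matching the $L^\infty$ extrinsic diameter up to a constant factor depending only on $\alpha$.)
   Context: The $m \times m$ parallelogram board consists of $m$ rows of $m$ regular hexagons each, in the hexagonal tiling, with each row shifted half a step to the right of the previous row. Indexing the cells by (row, column) $=(i,j)$ with $1 \le i,j \le m$, the neighbors of $(i,j)$ are those of $(i,j\pm 1)$, $(i\pm 1, j)$, $(i+1,j-1)$, $(i-1,j+1)$ that lie on the board. $\widetilde{\mathrm{hex}}(n;m)$ is the set of all ways to place $n$ pieces, numbered $1,\dots,n$, in distinct cells of this board. A hole is an unoccupied cell. Moves: a piece that is adjacent to two holes which are adjacent to each other may move into either of these two holes. Several pieces may move simultaneously provided the pairs of holes that they use (holes of the initial configuration) are pairwise disjoint. Two configurations are adjacent (at $L^\infty$ intrinsic distance $1$) if one is obtained from the other by such a set of simultaneous moves. The $L^\infty$ intrinsic metric is the graph metric generated by this relation, and connected components are those of the corresponding graph. $L^\infty$ extrinsic metric: the distance between two configurations is the maximum over all pieces of the number of steps needed to move that piece, on an otherwise empty board, between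 its two positions. A hole is isolated if it is adjacent to no other hole. The large connected component of $\widetilde{\mathrm{hex}}(n;m)$ is the connected component containing every configuration in which not all holes are isolated (such a component exists and is unique whenever $m \ge 5$ and $n \le m^2-6$). The diameter with respect to a metric is the supremum of distances between pairs of configurations in the set considered. *)

(* Defs.v *)
From mathcomp Require Import all_boot all_order all_algebra.
From mathcomp Require Import reals.

Set Implicit Arguments.
Unset Strict Implicit.
Unset Printing Implicit Defensive.

Section GraphMetric.
Variables (T : finType) (e : rel T).

Definition walk (k : nat) (x y : T) : bool :=
  [exists p : k.-tuple T, path e x p && (last x p == y)].

(* Two vertices joined by a walk are joined by one of length less than #|T|,  *)
(* so this is the length of a shortest walk; it is #|T| when there is none.   *)
Definition gdist (x y : T) : nat :=
  find (fun k => walk k x y) (iota 0 #|T|).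

Definition is_component (S : {set T}) : Prop :=
  exists x : T, S = [set y | connect e x y].

End GraphMetric.

(* A supremum over a finite set, hence a maximum. *)
Definition diameter (T : finType) (d : T -> T -> nat) (S : {set T}) : nat :=
  \max_(x in S) \max_(y in S) d x y.

(* Rows and columns are numbered from 0. *)
Definition cell (m : nat) : Type := ('I_m * 'I_m)%type.

Definition hexadj (m : nat) (p q : cell m) : bool :=
  let: (i, j) := p in
  let: (i', j') := q in
  [|| (i == i' :> nat) && ((j' == j.+1 :> nat) || (j == j'.+1 :> nat)),
      (j == j' :> nat) && ((i' == i.+1 :> nat) || (i == i'.+1 :> nat)),
      (i' == i.+1 :> nat) && (j == j'.+1 :> nat)
    | (i == i'.+1 :> nat) && (j' == j.+1 :> nat)].

Definition config (n m : nat) : Type :=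
  {x : {ffun 'I_n -> cell m} | injectiveb x}.

Section Configurations.
Variables n m : nat.
Implicit Types (x y : config n m) (p : cell m).

Definition hole x p : bool := p \notin codom (val x).

Definition isolated x p : bool :=
  hole x p && [forall q, hole x q ==> ~~ hexadj p q].

Definition all_holes_isolated x : bool := [forall p, hole x p ==> isolated x p].

Definition usable_pair x (i : 'I_n) (h : cell m * cell m) : bool :=
  [&& hole x h.1, hole x h.2, hexadj h.1 h.2,
      hexadj (val x i) h.1 & hexadj (val x i) h.2].

Definition holes_of (h : cell m * cell m) : {set cell m} := [set h.1; h.2].

(* The pieces in A move simultaneously, piece i using the pair of holes h i. *)
Definition moves_to x y : bool :=
  [exists A : {set 'I_n}, exists h : {ffun 'I_n -> cell m * cell m},
    [&& [forall i in A, usable_pair x i (h i) && (val y i \in holes_of (h i))],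
        [forall i in ~: A, val y i == val x i]
      & [forall i in A, forall j in A,
          (i != j) ==> [disjoint holes_of (h i) & holes_of (h j)]]]].

Definition config_adj x y : bool := moves_to x y || moves_to y x.

Definition intrinsic_dist x y : nat := gdist config_adj x y.

Definition is_large_component (S : {set config n m}) : Prop :=
  is_component config_adj S /\ forall x, ~~ all_holes_isolated x -> x \in S.

End Configurations.

Lemma single_piece_subproof (m : nat) (p : cell m) :
  injectiveb [ffun _ : 'I_1 => p].
Proof. by apply/injectiveP => i j _; rewrite !ord1. Qed.

Definition single_piece (m : nat) (p : cell m) : config 1 m :=
  exist _ [ffun _ : 'I_1 => p] (single_piece_subproof p).

(* The steps of a piece on an otherwise empty board are the moves of the      *)
(* configuration space with a single piece.                                   *)
Definition extrinsic_dist (n m : nat) (x y : config n m) : nat :=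
  \max_(i < n) intrinsic_dist (single_piece (val x i)) (single_piece (val y i)).

(* Main.v *)
Require Import Defs.
From mathcomp Require Import all_boot all_order all_fingroup all_algebra.
From mathcomp Require Import boolp reals zify ring lra.

(* A walk is recorded by the set H of holes of its starting configuration and *)
(* the permutation of the cells that carries the pieces along.  It remains     *)
(* legal when pieces are removed, walks in disjoint regions can be performed   *)
(* simultaneously, and a walk inside a region R never needs more than #|R|`!   *)
(* moves.                                                                      *)
(* In a rectangle, a pair of adjacent holes can bring the holes to any         *)
(* prescribed places, and with five holes, not all isolated, the pieces can    *)
(* moreover be permuted arbitrarily: whether two pieces can be exchanged does  *)
(* not depend on the current position of the holes, is transitive, and follows *)
(* from an explicit exchange in a hexagon of seven cells.                      *)
(* Cut the board into blocks of B x B cells with B^2 (1 - alpha) >= 5.  From   *)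
(* one pair of adjacent holes all blocks with at least two holes are activated *)
(* in O(m) moves by recursion on quadrants, in the manner of the freeze-tag    *)
(* problem.  At least one block in B^2 then contains five holes; moving these  *)
(* holes in parcels, one gets five holes at standard places in every block of  *)
(* B^2 x B^2 cells, and finally the pieces are brought to their destinations   *)
(* with the standard holes kept in place.  Both transports are permutation     *)
(* routing on a mesh: by the marriage theorem a permutation of a product is a  *)
(* product of three permutations preserving rows, columns and rows, and lines  *)
(* are permuted by odd-even transposition sort, with exchanges of the contents *)
(* of neighbouring blocks as elementary steps.                                 *)
(* For the lower bounds, a piece changes its row by at most one per move.      *)

Set Implicit Arguments.
Unset Strict Implicit.
Unset Printing Implicit Defensive.

Import Order.TTheory GRing.Theory Num.Theory.

(** * Hole moves in a graph *)

(** A configuration may contain a single pair of adjacent holes, so a high density of holes does not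
    by itself make all pieces mobile. The upper bound makes mobility local. Fix a power of two [B],
    depending only on [alpha], with [B * B * (1 - alpha) >= 5]. Inside a bounded region every
    possible rearrangement costs boundedly many moves ([realize_bound]), and disjoint regions work
    at the same time ([realize_parallel]); only the number of parallel rounds matters, and O(m) of
    them must suffice.

    What is possible inside a rectangle is settled by two facts. A pair of adjacent holes carries
    the hole set to any other such set of the same size ([rect_hole_connected], by adding one cell
    at a time), and in a rectangle with sides at least 3, five holes with an adjacent pair realize
    every permutation of the pieces ([rect_labels_swap], glued from the 3 by 3 case).

    Globally, [wake_up] spreads activity from one block to all blocks with two holes, at a cost that
    is a geometric series. By pigeonhole ([count_rich]) there are at least as many blocks with five
    holes as superblocks of side [B * B], and [normalize] routes five holes into each superblock.
    With these standard holes in place, [realize_route] performs any permutation of the other cells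
    in O(m) rounds of mesh routing ([mesh_routing], from [perm_row_col_row] and [odd_even_sort]).
    Walks are reversible, so [connect_holes] normalizes both ends and routes in between.

    These walks connect all configurations with two adjacent holes, and [moves_to_not_isolated]
    shows that no walk leaves this set, so it is the large component. Forgetting all pieces but one
    projects walks to walks ([project_walk]), hence extrinsic distances are at most intrinsic ones;
    the configurations of [far_apart], with one piece in opposite extreme rows, bound both diameters
    from below. *)

Section HoleMoves.
Variables (T : finType) (adj : rel T).
Hypotheses (adj_sym : symmetric adj) (adj_irr : irreflexive adj).
Implicit Types (R H K L Q C : {set T}) (s t : {perm T}) (p q r u v : T).

Definition mv s H : {set T} := [set p | s^-1%g p \in H].

Lemma mem_mv s H p : (s p \in mv s H) = (p \in H).
Proof. by rewrite inE permK. Qed.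

Lemma mv1 H : mv 1 H = H.
Proof. by apply/setP => p; rewrite inE invg1 perm1. Qed.

Lemma mvM s t H : mv t (mv s H) = mv (s * t) H.
Proof. by apply/setP => p; rewrite !inE invMg permM. Qed.

Lemma mvK s H : mv s^-1 (mv s H) = H.
Proof. by rewrite mvM mulgV mv1. Qed.

Lemma mv_imset s H : mv s H = s @: H.
Proof.
apply/setP => p; apply/idP/imsetP; last by case=> q Hq ->; rewrite mem_mv.
by rewrite inE => sp; exists (s^-1%g p) => //; rewrite permKV.
Qed.

Lemma card_mv s H : #|mv s H| = #|H|.
Proof. by rewrite mv_imset card_imset //; apply: perm_inj. Qed.

Lemma mv_on R s H : perm_on R s -> mv s H :&: R = mv s (H :&: R).
Proof.
move=> sR; apply/setP => p; rewrite !inE.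
by rewrite (perm_closed _ (perm_onV sR)).
Qed.

Lemma mv_out R s H : perm_on R s -> mv s H :\: R = H :\: R.
Proof.
move=> sR; apply/setP => p; rewrite !inE; case: (boolP (p \in R)) => //= pR.
by rewrite (out_perm (perm_onV sR)).
Qed.

(* H is the set of holes and t moves the contents of the cells; since holes    *)
(* are indistinguishable, the values of t on H are irrelevant.                *)
Definition step R H t : Prop := perm_on R t /\ exists h : T -> T,
  (forall p, p \notin H -> t p != p ->
     [/\ t p \in H, h p \in H :&: R, adj p (t p), adj p (h p) & adj (t p) (h p)])
  /\ (forall p q, p \notin H -> q \notin H -> t p != p -> t q != q -> p != q ->
        h p != h q /\ h p != t q).

Lemma step1 R H : step R H 1.
Proof.
split; first exact: perm_on1.
by exists id; split=> [p _|p q _ _]; rewrite perm1 eqxx.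
Qed.

Lemma on_moved R t p : perm_on R t -> t p != p -> p \in R.
Proof. by move=> /subsetP tR tp; apply: tR; rewrite inE. Qed.

(** Legality only speaks of occupied cells that move and of holes inside [R], so it survives the
    removal of pieces and the enlargement of the region. This is what later allows surplus holes to
    be treated as pieces. *)
Lemma step_sub R R' H H' t :
  R \subset R' -> H :&: R \subset H' -> step R H t -> step R' H' t.
Proof.
move=> sRR' /subsetP sH [tR [h [h1 h2]]]; split.
  by apply: subset_trans sRR'.
have HH p : p \notin H' -> t p != p -> p \notin H.
  move=> pH' /(on_moved tR) pR; apply: contra pH' => pH.
  by apply: sH; rewrite inE pH.
exists h; split=> [p pH' tp|p q pH' qH' tp tq pq].
  have [tpH hp a1 a2 a3] := h1 p (HH _ pH' tp) tp.
  split=> //.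
    by apply: sH; rewrite inE tpH perm_closed // (on_moved tR tp).
  by rewrite inE (sH _ hp) (subsetP sRR') //; case/setIP: hp.
by apply: h2 => //; apply: HH.
Qed.

(** A piece goes back with the pair formed by the cell it left and the same spare hole: nobody can
    have entered the first, which was occupied, and the second is still empty by the disjointness of
    the pairs. *)
Lemma step_inv R H t : step R H t -> step R (mv t H) t^-1.
Proof.
move=> [tR [h [h1 h2]]]; split; first exact: perm_onV.
have moved p : p \notin mv t H -> t^-1%g p != p ->
   (t^-1%g p \notin H) /\ (t (t^-1%g p) != t^-1%g p).
  by rewrite inE permKV => pH tp; split=> //; rewrite eq_sym.
exists (fun p => h (t^-1%g p)); split.
  move=> p pm tp; have [qH tq] := moved p pm tp.
  move: (t^-1%g p) (permKV t p) qH tq {moved pm tp} => q <- qH tq.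
  have [tqH /setIP [hqH hqR] a1 a2 a3] := h1 q qH tq.
  rewrite !inE hqR andbT; split => //; last by rewrite adj_sym.
  - case: (boolP (t^-1%g q \in H)) => // rH.
    have [e|ne] := eqVneq (t^-1%g q) q.
      by rewrite -{1}e permKV eqxx in tq.
    have tr : t (t^-1%g q) != t^-1%g q by rewrite permKV eq_sym.
    by have [] := h1 _ rH tr; rewrite permKV (negPf qH).
  - case: (boolP (t^-1%g (h q) \in H)) => // rH.
    have tr : t (t^-1%g (h q)) != t^-1%g (h q).
      by rewrite permKV; apply: contra rH => /eqP <-.
    have [e|ne] := eqVneq q (t^-1%g (h q)).
      by move: a3; rewrite {1}e permKV adj_irr.
    by have [_] := h2 _ _ qH rH tq tr ne; rewrite permKV eqxx.
move=> p q pm qm tp tq pq.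
have [pH tp'] := moved p pm tp; have [qH tq'] := moved q qm tq.
have ne : t^-1%g p != t^-1%g q by rewrite (inj_eq perm_inj).
have [-> _] := h2 _ _ pH qH tp' tq' ne; split => //.
have [_ /setIP [hH _] _ _ _] := h1 _ pH tp'.
by apply: contra qH => /eqP <-.
Qed.

(** After the first move [t] the remaining task is [t^-1 * s], starting from the holes [mv t H]. The
    identity is a legal move, so [k] acts as an upper bound on the number of moves. *)
Fixpoint realize R k H s : Prop :=
  if k is k'.+1 then
    exists2 t, step R H t & realize R k' (mv t H) (t^-1 * s)
  else perm_on R s /\ (forall p, p \notin H -> s p = p).

Lemma realize_on R k H s : realize R k H s -> perm_on R s.
Proof.
elim: k H s => [|k IH] H s /=; first by case.
case=> t [tR _] /IH h; rewrite -[s](mulKVg t).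
exact: perm_onM.
Qed.

Lemma realize_sub R R' H H' k s :
  R \subset R' -> H :&: R \subset H' -> realize R k H s -> realize R' k H' s.
Proof.
move=> sRR'; elim: k H H' s => [|k IH] H H' s sH /=.
  case=> sR e; split; first by apply: subset_trans sRR'.
  move=> p pH'; case: (boolP (p \in R)) => pR; last exact: (out_perm sR).
  by apply: e; apply: contra pH' => pH; apply: (subsetP sH); rewrite inE pH.
case=> t st re; exists t; first exact: step_sub st.
apply: IH re; rewrite mv_on; last by case: st.
by apply/subsetP => p; rewrite !inE -in_setI => /(subsetP sH).
Qed.

Lemma realize_mono R H H' k s :
  H \subset H' -> realize R k H s -> realize R k H' s.
Proof. by move=> sH; apply: realize_sub => //; apply: subset_trans sH; apply: subsetIl. Qed.

Lemma realize_ext R k H s s' : perm_on R s' ->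
  (forall p, p \notin H -> s' p = s p) -> realize R k H s -> realize R k H s'.
Proof.
elim: k H s s' => [|k IH] H s s' sR e /=.
  by case=> _ f; split=> // p pH; rewrite e ?f.
case=> t st re; exists t => //; apply: IH re.
  by apply: perm_onM => //; apply: perm_onV; case: st.
by move=> p; rewrite inE => pH; rewrite !permM e.
Qed.

Lemma mv_fix H s : (forall p, p \notin H -> s p = p) -> mv s H = H.
Proof.
move=> e; apply/setP => p; rewrite inE.
case: (boolP (p \in H)) => pH.
  case: (boolP (s^-1%g p \in H)) => // sH; move: (e _ sH); rewrite permKV => pe.
  by rewrite -pe pH in sH.
by rewrite -{1}(e _ pH) permK (negPf pH).
Qed.

Lemma realize_cat R j k H s t :
  realize R j H s -> realize R k (mv s H) t -> realize R (j + k) H (s * t).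
Proof.
elim: j H s => [|j IH] H s /=.
  case=> sR e; rewrite mv_fix // => re; apply: realize_ext (re).
    by apply: perm_onM => //; apply: realize_on re.
  by move=> p pH; rewrite permM e.
case=> u st re re2; exists u => //.
rewrite mulgA; apply: IH => //.
by rewrite mvM mulKVg.
Qed.

Lemma realize1 R k H : realize R k H 1.
Proof.
elim: k H => [|k IH] H /=.
  by split=> [|p _]; [exact: perm_on1 | rewrite perm1].
by exists 1%g; [exact: step1 | rewrite invg1 mulg1 mv1].
Qed.

Lemma realize_leq R j k H s : j <= k -> realize R j H s -> realize R k H s.
Proof.
move=> /subnKC <- re; rewrite -[s]mulg1.
by apply: realize_cat re (realize1 _ _ _).
Qed.

Lemma step_realize R H t : step R H t -> realize R 1 H t.
Proof.
move=> st; exists t => //; rewrite mulVg; exact: (realize1 R 0).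
Qed.

Lemma realize_inv R k H s : realize R k H s -> realize R k (mv s H) s^-1.
Proof.
elim: k H s => [|k IH] H s /=.
  case=> sR e; split; first exact: perm_onV.
  by rewrite mv_fix // => p pH; rewrite -{1}(e _ pH) permK.
case=> t st /IH; rewrite mvM mulKVg => re.
have := realize_cat re (step_realize (R := R) (t := t^-1%g) _).
rewrite addn1 invMg invgK mulgK; apply.
rewrite mvM mulKVg; exact: step_inv.
Qed.

Definition feasible R H s := exists k, realize R k H s.

Lemma feasible_on R H s : feasible R H s -> perm_on R s.
Proof. by case=> k; apply: realize_on. Qed.

Lemma feasible_sub R R' H H' s :
  R \subset R' -> H :&: R \subset H' -> feasible R H s -> feasible R' H' s.
Proof. by move=> a b [k re]; exists k; apply: realize_sub re. Qed.

Lemma feasible_mono R H H' s : H \subset H' -> feasible R H s -> feasible R H' s.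
Proof. by move=> a [k re]; exists k; apply: realize_mono re. Qed.

Lemma feasible_ext R H s s' : perm_on R s' ->
  (forall p, p \notin H -> s' p = s p) -> feasible R H s -> feasible R H s'.
Proof. by move=> a b [k re]; exists k; apply: realize_ext re. Qed.

Lemma feasible_cat R H s t : feasible R H s -> feasible R (mv s H) t -> feasible R H (s * t).
Proof. by move=> [j r1] [k r2]; exists (j + k); apply: realize_cat. Qed.

Lemma feasible_inv R H s : feasible R H s -> feasible R (mv s H) s^-1.
Proof. by case=> k re; exists k; apply: realize_inv. Qed.

Lemma feasible1 R H : feasible R H 1.
Proof. by exists 0; apply: realize1. Qed.

Definition tri p q r := [&& adj p q, adj p r & adj q r].

Lemma feasible_move R H p q r : tri p q r -> p \in R -> q \in R -> r \in R ->
  q \in H -> r \in H -> feasible R H (tperm p q).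
Proof.
case/and3P=> apq apr aqr pR qR rR qH rH; exists 1; apply: step_realize.
split.
  apply/subsetP => z; rewrite inE; case: tpermP => [-> | -> |] //.
  by rewrite eqxx.
have only z : z \notin H -> tperm p q z != z -> z = p.
  move=> zH; case: tpermP => [//|e|]; last by rewrite eqxx.
  by rewrite e qH in zH.
exists (fun=> r); split=> [z zH zt|z z' zH z'H zt z't].
  have e := only z zH zt; rewrite e tpermL inE; split => //.
  by rewrite rH rR.
by rewrite (only z) // (only z') // eqxx.
Qed.

Lemma mv_tperm H u v : u \notin H -> v \notin H -> mv (tperm u v) H = H.
Proof.
move=> uH vH; apply/setP => p; rewrite inE tpermV.
by case: tpermP => [->|->|//]; rewrite (negPf uH) (negPf vH).
Qed.

(** Perform [s], exchange the two pieces where they now stand, and undo [s]; exchanging two pieces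
    does not change the hole set, so the reversed walk is still legal. *)
Lemma feasible_swap_conj R H s u v : u \notin H -> v \notin H ->
  feasible R H s -> feasible R (mv s H) (tperm (s u) (s v)) -> feasible R H (tperm u v).
Proof.
move=> uH vH rs rt.
have -> : tperm u v = (s * (tperm (s u) (s v) * s^-1))%g.
  by rewrite -tpermJ conjgE !mulgA mulgV mul1g mulgK.
apply: (feasible_cat rs); apply: (feasible_cat rt).
by rewrite mv_tperm ?mem_mv //; apply: feasible_inv rs.
Qed.

Lemma glue_perm (G : Type) (g : T -> G) (reg : G -> {set T}) (f : G -> {perm T}) :
  (forall c p, p \in reg c -> g p = c) -> (forall c, perm_on (reg c) (f c)) ->
  exists t : {perm T}, forall p, t p = f (g p) p.
Proof.
move=> gr fr.
have gf p : g (f (g p) p) = g p.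
  case: (boolP (p \in reg (g p))) => pr; last by rewrite (out_perm (fr _)).
  by apply: gr; rewrite perm_closed.
have inj : injective (fun p => f (g p) p).
  move=> p q e; have gpq : g p = g q by rewrite -(gf p) e gf.
  by move: e; rewrite gpq; apply: perm_inj.
by exists (perm inj) => p; rewrite permE.
Qed.

Lemma glue_perm_on (G : Type) (g : T -> G) (reg : G -> {set T})
    (f : G -> {perm T}) R t :
  (forall c, reg c \subset R) -> (forall c, perm_on (reg c) (f c)) ->
  (forall p, t p = f (g p) p) -> perm_on R t.
Proof.
move=> rR fr e; apply/subsetP => p; rewrite inE e => /(on_moved (fr _)).
exact: (subsetP (rR _)).
Qed.

(** The colouring [g] forces the regions to be disjoint, so pairs of holes used in different regions
    never meet, and the simultaneous moves of all regions form one legal move. The time is [k],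
    whatever the number of regions. *)
Lemma realize_parallel (G : finType) (g : T -> G) (reg : G -> {set T})
    (f : G -> {perm T}) R k H s :
  (forall c p, p \in reg c -> g p = c) -> (forall c, reg c \subset R) ->
  (forall c, realize (reg c) k H (f c)) ->
  (forall p, s p = f (g p) p) -> realize R k H s.
Proof.
move=> gr rR; elim: k H f s => [|k IH] H f s re e /=.
  split; last by move=> p pH; rewrite e; have [_ ->] := re (g p).
  by apply: (glue_perm_on rR _ e) => c; have [] := re c.
have /fin_all_exists [t Pt] : forall c, exists t,
    step (reg c) H t /\ realize (reg c) k (mv t H) (t^-1 * f c).
  by move=> c; have [t st ret] := re c; exists t.
have tr c : perm_on (reg c) (t c) by have [[]] := Pt c.
have [w we] := glue_perm gr tr.
have gw p : g (w p) = g p.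
  rewrite we; case: (boolP (p \in reg (g p))) => pr; last by rewrite (out_perm (tr _)).
  by apply: gr; rewrite perm_closed.
have wV p : w^-1%g p = (t (g p))^-1%g p.
  apply: (@perm_inj _ w); rewrite permKV we.
  have -> : g ((t (g p))^-1%g p) = g p; last by rewrite permKV.
  case: (boolP (p \in reg (g p))) => pr.
    by apply: gr; rewrite perm_closed // perm_onV.
  by rewrite (out_perm (perm_onV (tr _))).
exists w.
  split; first exact: (glue_perm_on rR tr we).
  have /fin_all_exists [h Ph] : forall c, exists h : T -> T,
    (forall p, p \notin H -> t c p != p ->
     [/\ t c p \in H, h p \in H :&: reg c, adj p (t c p), adj p (h p)
       & adj (t c p) (h p)])
    /\ (forall p q, p \notin H -> q \notin H -> t c p != p -> t c q != q ->
       p != q -> h p != h q /\ h p != t c q).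
    by move=> c; have [[_ [h [h1 h2]]] _] := Pt c; exists h.
  exists (fun p => h (g p) p); split.
    move=> p pH; rewrite we => tp; have [/(_ p pH tp) [a b c d x] _] := Ph (g p).
    by split => //; case/setIP: b => b1 b2; rewrite inE b1 (subsetP (rR _) _ b2).
  move=> p q pH qH; rewrite !we => tp tq pq.
  have [/(_ p pH tp) [_ /setIP [_ hp] _ _ _] h2] := Ph (g p).
  have [/(_ q qH tq) [_ /setIP [_ hq] _ _ _] _] := Ph (g q).
  have [E|ne] := eqVneq (g p) (g q); first by rewrite -E in tq *; apply: h2.
  have tqr : t (g q) q \in reg (g q) by rewrite perm_closed // (on_moved (tr _) tq).
  by split; apply: contra ne => /eqP E; rewrite -(gr _ _ hp) E ?(gr _ _ hq) ?(gr _ _ tqr).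
apply: (IH _ (fun c => (t c)^-1 * f c)%g).
  move=> c; have [_] := Pt c; apply: realize_sub => //.
  apply/subsetP => p; rewrite !inE => /andP [pH pr].
  by rewrite wV (gr _ _ pr).
by move=> p; rewrite !permM wV e -wV -gw permKV.
Qed.

Lemma realize_glue (G : finType) (g : T -> G) (reg : G -> {set T})
    (f : G -> {perm T}) R k H :
  (forall c p, p \in reg c -> g p = c) -> (forall c, reg c \subset R) ->
  (forall c, realize (reg c) k H (f c)) ->
  exists s, [/\ realize R k H s, forall p, s p = f (g p) p &
    forall c, mv s H :&: reg c = mv (f c) H :&: reg c].
Proof.
move=> gr rR re; have fr c := realize_on (re c).
have [s sE] := glue_perm gr fr; exists s; split => //.
  exact: realize_parallel gr rR re sE.
move=> c; apply/setP => p; rewrite !inE.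
case: (boolP (p \in reg c)) => pr; rewrite ?andbF // !andbT; congr (_ \in H).
apply: (@perm_inj _ s); rewrite permKV sE (gr c) ?permKV //.
by rewrite perm_closed // perm_onV.
Qed.

Lemma realize_bound R k H s : realize R k H s -> realize R #|R|`! H s.
Proof.
pose e : rel {perm T} := fun a b => `[< step R (mv a H) (a^-1 * b) >].
have to_path j a c : realize R j (mv a H) c ->
    exists2 p, path e a p & (forall x, x \notin H -> last a p x = (a * c)%g x).
  elim: j a c => [|j IH] a c /=.
    case=> _ f; exists [::] => // x xH.
    by rewrite permM f // mem_mv.
  case=> t st; rewrite mvM => /IH [p pp lp]; exists (a * t :: p)%g => /=.
    by rewrite pp andbT; apply/asboolP; rewrite mulKg.
  by move=> x xH; rewrite lp // mulgA mulgK.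
have of_path (p : seq {perm T}) a : path e a p -> realize R (size p) (mv a H) (a^-1 * last a p).
  elim: p a => [|b p IH] a /=; first by rewrite mulVg => _; apply: (realize1 _ 0).
  case/andP=> /asboolP st /IH re; exists (a^-1 * b)%g => //.
  by rewrite mvM mulKVg invMg invgK mulgA mulgK.
move=> re; have sR := realize_on re.
have [p pp lp] : exists2 p, path e 1%g p & (forall x, x \notin H -> last 1%g p x = s x).
  by have := to_path k 1%g s; rewrite mv1 mul1g; apply.
case/shortenP: pp lp => q pq uq _ lq.
have := of_path _ _ pq; rewrite mv1 invg1 mul1g => req.
have {}req : realize R (size q) H s by apply: realize_ext req => // x xH; rewrite lq.
apply: realize_leq req.
rewrite -card_perm; apply: ltnW.
have -> : (size q).+1 = #|(1%g : {perm T}) :: q| by rewrite (card_uniqP uq).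
apply/subset_leq_card/subsetP => x; rewrite inE => /orP [/eqP ->|xq].
  exact: perm_on1.
have on_path : forall a, perm_on R a -> path e a q -> x \in q -> perm_on R x.
  elim: q {pq uq xq lq} => [|b q IH] a aR //= /andP [/asboolP [bR _] pq].
  have bR' : perm_on R b by rewrite -[b](mulKVg a); apply: perm_onM.
  by rewrite inE => /orP [/eqP -> //|]; apply: IH pq.
exact: (on_path _ (perm_on1 R) pq xq).
Qed.

Lemma feasible_bound R H s k : #|R| <= k -> feasible R H s -> realize R k`! H s.
Proof.
move=> le [j /realize_bound re]; apply: realize_leq re.
exact: leq_fact.
Qed.


(** * Rearranging unlabelled holes *)

Lemma tri_sym12 p q r : tri p q r -> tri q p r.
Proof. by rewrite /tri adj_sym => /and3P [-> -> ->]. Qed.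

Lemma tri_sym23 p q r : tri p q r -> tri p r q.
Proof. by rewrite /tri (adj_sym q) => /and3P [-> -> ->]. Qed.

Lemma tri_rot p q r : tri p q r -> tri q r p.
Proof. by move=> t; apply: tri_sym23; apply: tri_sym12. Qed.

Lemma adj_neq p q : adj p q -> p != q.
Proof. by apply: contraTneq => ->; rewrite adj_irr. Qed.

Lemma tri_neq p q r : tri p q r -> [/\ p != q, p != r & q != r].
Proof. by case/and3P => *; split; apply: adj_neq. Qed.

(* The third cell r makes the pair of holes p, q able to move inside R.        *)
Definition active R H :=
  [exists p, exists q, exists r,
     [&& tri p q r, p \in H, q \in H, p \in R, q \in R & r \in R]].

Lemma activeP R H : reflect (exists p q r,
  [/\ tri p q r, p \in H, q \in H & [/\ p \in R, q \in R & r \in R]]) (active R H).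
Proof.
apply: (iffP existsP).
  by case=> p /existsP [q /existsP [r /and5P [a b c d /andP [e f]]]]; exists p, q, r.
case=> p [q [r [a b c [d e f]]]]; exists p; apply/existsP; exists q.
by apply/existsP; exists r; rewrite a b c d e f.
Qed.

Lemma active_sub R R' H H' : R \subset R' -> H :&: R \subset H' -> active R H -> active R' H'.
Proof.
move=> /subsetP sR /subsetP sH /activeP [p [q [r [a b c [d e f]]]]]; apply/activeP.
by exists p, q, r; split => //; [apply: sH; rewrite inE b | apply: sH; rewrite inE c | split; apply: sR].
Qed.

Lemma active_card R H : active R H -> 1 < #|H :&: R|.
Proof.
case/activeP=> p [q [r [/tri_neq [pq _ _] b c [d e f]]]].
have := cards2 p q; rewrite pq => <-; apply/subset_leq_card/subsetP => z.
by rewrite !inE => /orP [] /eqP ->; rewrite ?b ?c.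
Qed.

Definition reach R H K := exists2 s, feasible R H s & mv s H = K.

Lemma reach_refl R H : reach R H H.
Proof. by exists 1%g; [exact: feasible1 | exact: mv1]. Qed.

Lemma reach_trans R H K L : reach R H K -> reach R K L -> reach R H L.
Proof.
move=> [s rs <-] [t rt <-]; exists (s * t)%g; last by rewrite mvM.
exact: feasible_cat rs rt.
Qed.

Lemma reach_sym R H K : reach R H K -> reach R K H.
Proof.
move=> [s rs <-]; exists (s^-1)%g; last by rewrite mvK.
exact: feasible_inv.
Qed.

Lemma reach_card R H K : reach R H K -> #|H| = #|K|.
Proof. by case=> s _ <-; rewrite card_mv. Qed.

Lemma reach_sub R R' H H' K : R \subset R' -> H' :&: R = H :&: R -> K \subset R ->
  H \subset R ->
  reach R H K -> reach R' H' (K :|: (H' :\: R)).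
Proof.
move=> sR e KR HR [s rs eK]; exists s.
  apply: feasible_sub rs => //; rewrite -e; exact: subsetIl.
have sr := feasible_on rs.
rewrite -{1}(setID H' R) e; apply/setP => p; rewrite !inE -eK !inE.
rewrite -(perm_closed p (perm_onV sr)).
case: (boolP (s^-1%g p \in R)) => pR; rewrite ?andbT ?andbF ?orbF //=.
have pR' : p \notin R by rewrite -(perm_closed p (perm_onV sr)).
rewrite (out_perm (perm_onV sr) pR').
suff -> : p \in H = false by [].
by apply: contraNF pR' => /(subsetP HR).
Qed.

Lemma reach_move R H p q r : tri p q r -> p \in R -> q \in R -> r \in R ->
  p \notin H -> q \in H -> r \in H -> reach R H (p |: (H :\ q)).
Proof.
move=> t pR qR rR pH qH rH; exists (tperm p q); first exact: feasible_move t pR qR rR qH rH.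
have [pq _ _] := tri_neq t.
apply/setP => z; rewrite !inE tpermV; case: tpermP => [->|->|].
- by rewrite eqxx qH.
- by rewrite eqxx (negPf pH) eq_sym (negPf pq).
by move=> /eqP /negPf -> /eqP ->.
Qed.

Lemma subset_between (A B : {set T}) n : A \subset B -> #|A| <= n -> n <= #|B| ->
  exists C : {set T}, [/\ A \subset C, C \subset B & #|C| = n].
Proof.
move=> AB; elim: n => [|n IH].
  by rewrite leqn0 cards_eq0 => /eqP -> _; exists set0; rewrite !sub0set cards0.
rewrite leq_eqVlt => /orP [/eqP e _|An nB]; first by exists A; rewrite subxx e.
have [C [AC CB eC]] := IH An (ltnW nB).
have : 0 < #|B :\: C| by rewrite cardsDS // subn_gt0 eC.
case/card_gt0P => x; rewrite inE => /andP [xC xB]; exists (x |: C); split.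
- by apply: subset_trans AC _; apply: subsetUr.
- by rewrite subUset sub1set xB.
- by rewrite cardsU1 xC eC.
Qed.

Definition hole_connected R := forall H K, H \subset R -> K \subset R ->
  active R H -> active R K -> #|H| = #|K| -> reach R H K.

Section AddCell.
Variables (R : {set T}) (x a b c : T).
Hypotheses (Uc : hole_connected R) (xR : x \notin R).
Hypotheses (aR : a \in R) (bR : b \in R) (cR : c \in R).
Hypotheses (xab : tri x a b) (abc : tri a b c).
Hypothesis link : forall p q, p \in R -> q \in R -> tri x p q -> exists2 r, r \in R & tri p q r.

Let R' := x |: R.
Let RR' : R \subset R'. Proof. exact: subsetUr. Qed.
Let xR' : x \in R'. Proof. exact: setU11. Qed.

(** The hypothesis [link] guarantees that two holes of [R] made mobile by the third cell [x] are
    also mobile inside [R], so activity is not lost when [x] is filled. *)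
Lemma evacuate H : H \subset R' -> active R' H -> #|H| <= #|R| ->
  exists K, [/\ K \subset R, active R K & reach R' H K].
Proof.
move=> HR' aH cH.
have inR p : p \in R' -> p != x -> p \in R by rewrite !inE => /orP [/eqP ->|//]; rewrite eqxx.
have actR (L : {set T}) : active R' L -> x \notin L -> active R L.
  case/activeP=> p [q [r [t pL qL [pR qR rR]]]] xL.
  have px : p != x by apply: contra xL => /eqP <-.
  have qx : q != x by apply: contra xL => /eqP <-.
  have [{}pR {}qR] := (inR _ pR px, inR _ qR qx).
  have [rx|rx] := eqVneq r x.
    have [|r' r'R t'] := link pR qR; first by rewrite -rx; apply/tri_rot/tri_rot.
    by apply/activeP; exists p, q, r'.
  by apply/activeP; exists p, q, r; split=> //; split=> //; apply: inR.
case: (boolP (x \in H)) => xH; last first.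
  exists H; split; [|exact: actR|exact: reach_refl].
  apply/subsetP => p pH; apply: inR; first exact: (subsetP HR').
  by apply: contra xH => /eqP <-.
pose H0 := H :\ x.
have H0R : H0 \subset R.
  by apply/subsetP => p; rewrite !inE => /andP [px /(subsetP HR') pR]; apply: inR.
have cH0 : #|H0|.+1 = #|H| by rewrite /H0 [#|H|](cardsD1 x) xH.
(* If the other holes are active in [R], move them so that [b] and [c] are empty and [a] is
   occupied, for which [#|H| <= #|R|] leaves room; then the piece on [a] enters [x]. *)
case: (boolP (active R H0)) => aH0.
  have H02 : 1 < #|H0| by have := active_card aH0; rewrite (setIidPl H0R).
  have [ab ac bc] := tri_neq abc.
  have [||| C [bcC CR cC]] := @subset_between [set b; c] (R :\ a) #|H0|.
  - by apply/subsetP => p; rewrite !inE => /orP [] /eqP ->; rewrite eq_sym ?ab ?ac.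
  - by rewrite cards2 bc.
  - by move: cH; rewrite [#|R|](cardsD1 a) aR -cH0.
  have CR' : C \subset R by apply: subset_trans CR _; apply: subsetDl.
  have [bC cinC] : b \in C /\ c \in C by split; apply: (subsetP bcC); rewrite !inE eqxx ?orbT.
  have aC : a \notin C by apply/negP => /(subsetP CR); rewrite !inE eqxx.
  have r1 : reach R H0 C.
    apply: Uc => //; apply/activeP; exists b, c, a; split => //.
    exact: tri_rot.
  have r2 : reach R' H (x |: C).
    have := reach_sub (H' := H) RR' _ CR' H0R r1.
    have -> : H :\: R = [set x].
      apply/setP => p; rewrite !inE; apply/andP/eqP => [[pR pH]|-> //].
      by apply/eqP; apply: contraNT pR => px; apply: inR (subsetP HR' _ pH) px.
    rewrite setUC; apply; apply/setP => p; rewrite !inE.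
    by have [->|] := eqVneq p x; rewrite ?(negPf xR) ?andbF.
  exists (a |: C); split.
  - by rewrite subUset sub1set aR.
  - by apply/activeP; exists a, b, c; rewrite !inE eqxx bC orbT.
  have xa : x != a by have [] := tri_neq xab.
  have -> : a |: C = a |: ((x |: C) :\ x).
    rewrite setU1K //; apply/negP => /(subsetP CR'); exact/negP.
  apply: reach_trans r2 (reach_move (r := b) _ _ _ _ _ _ _).
  - exact: tri_sym12.
  - by rewrite inE aR orbT.
  - exact: xR'.
  - by rewrite inE bR orbT.
  - by rewrite !inE eq_sym (negPf xa).
  - by rewrite !inE eqxx.
  - by rewrite inE bC orbT.
(* Otherwise [x] belongs to every active triangle. Its third cell [r] is occupied, since [link]
   would make [p] and [r] active in [R], and the piece on [r] enters [x]. *)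
have [p [r [pR rR t pH]]] : exists p r, [/\ p \in R, r \in R, tri x p r & p \in H].
  case/activeP: aH => p [q [r [t pH qH [pR qR rR]]]].
  have [pq pr qr] := tri_neq t.
  have [e|px] := eqVneq p x.
    subst p; exists q, r; split => //; apply: inR => //; by rewrite eq_sym.
  have [e|qx] := eqVneq q x.
    subst q; exists p, r; split => //; [exact: inR | | exact: tri_sym12].
    by apply: inR => //; rewrite eq_sym.
  have [e|rx] := eqVneq r x.
    subst r; exists p, q; split=> //; [exact: inR|exact: inR|]. 
    by apply/tri_rot/tri_rot.
  case/negP: aH0; apply/activeP; exists p, q, r.
  by rewrite !inE px qx; split => //; split; apply: inR.
have [xp xr pr] := tri_neq t.
have [r' r'R t'] := link pR rR t.
have rH : r \notin H.
  apply: contra aH0 => rH; apply/activeP; exists p, r, r'.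
  by rewrite !inE pH rH (eq_sym p x) (eq_sym r x) xp xr.
exists (r |: (H :\ x)); split.
- by rewrite subUset sub1set rR.
- apply/activeP; by exists p, r, r'; rewrite !inE eqxx pH (eq_sym p x) xp orbT.
apply: (reach_move (r := p)) => //; last 2 first.
- by rewrite inE rR orbT.
- by rewrite inE pR orbT.
by apply/tri_rot/tri_rot.
Qed.

(** Evacuate [x] from both hole sets and join the results inside [R]; with more than [#|R|] holes
    everything is empty and nothing has to be done. *)
Lemma hole_connectedU1 : hole_connected R'.
Proof.
move=> H K HR KR aH aK e.
have cR' : #|R'| = #|R|.+1 by rewrite /R' cardsU1 xR.
have [le|gt] := leqP #|H| #|R|; last first.
  have full (L : {set T}) : L \subset R' -> #|R| < #|L| -> L = R'.
    move=> LR gtL; apply/setP/subset_cardP => //.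
    by apply/eqP; rewrite eqn_leq cR' gtL andbT -cR' subset_leq_card.
  by rewrite (full H) // (full K) -?e //; apply: reach_refl.
have [H1 [H1R a1 r1]] := evacuate HR aH le.
have [|K1 [K1R a2 r2]] := evacuate KR aK; first by rewrite -e.
apply: (reach_trans r1); apply: reach_trans (reach_sym r2).
have [|s rs es] := Uc H1R K1R a1 a2; last by exists s => //; apply: feasible_sub rs => //; apply: subsetIl.
by rewrite -(reach_card r1) -(reach_card r2).
Qed.

End AddCell.

(** The neighbours of [x] in [R] lie on a path [l], [u], [w], and [r1], [r2] complete its edges to
    triangles in [R], which is the condition [link]. A path with a single edge is expressed by
    [w = l]. *)
Lemma hole_connected_add R x l u w r1 r2 : hole_connected R -> x \notin R ->
  l \in R -> u \in R -> r1 \in R -> r2 \in R ->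
  tri x l u -> tri l u r1 -> tri u w r2 -> ~~ adj l w ->
  (forall p, p \in R -> adj x p -> [|| p == l, p == u | p == w]) ->
  hole_connected (x |: R).
Proof.
move=> Uc xR lR uR r1R r2R xlu lur uwr lw nb.
apply: (hole_connectedU1 Uc xR lR uR r1R xlu lur) => p q pR qR /and3P [xp xq pq].
have lur' := tri_sym12 lur; have uwr' := tri_sym12 uwr.
move: pq; case/or3P: (nb p pR xp) => /eqP ->; case/or3P: (nb q qR xq) => /eqP ->;
  rewrite ?adj_irr ?(adj_sym w l) ?(negPf lw) // => _; by [exists r1 | exists r2].
Qed.

Lemma hole_connected3 a b c : tri a b c -> hole_connected [set a; b; c].
Proof.
move=> t; have [ab ac bc] := tri_neq t; set R := [set a; b; c].
have cR : #|R| = 3.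
  by rewrite /R -setUA cardsU1 cards2 !inE negb_or ab ac bc.
have adjR p q : p \in R -> q \in R -> p != q -> adj p q.
  have /and3P [t1 t2 t3] := t.
  have [t4 t5 t6] : [/\ adj b a, adj c a & adj c b] by split; rewrite adj_sym.
  by rewrite !inE -!orbA => /or3P [] /eqP -> /or3P [] /eqP -> //; rewrite eqxx.
have missing (L : {set T}) : L \subset R -> #|L| = 2 ->
    exists2 p, p \in R & L = R :\ p.
  move=> LR cL.
  have /card_gt0P [x] : 0 < #|R :\: L| by rewrite cardsDS // cR cL.
  rewrite inE => /andP [xL xR]; exists x => //; apply/setP/subset_cardP.
    by apply: succn_inj; rewrite cL -cR (cardsD1 x) xR.
  apply/subsetP => z zL; rewrite in_setD1 (subsetP LR) // andbT.
  by apply: contra xL => /eqP <-.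
move=> H K HR KR aH _ e.
have : 1 < #|H| by have := active_card aH; rewrite (setIidPl HR).
have := subset_leq_card HR; rewrite cR leq_eqVlt => /orP [/eqP cH _|].
  have full (L : {set T}) : L \subset R -> #|L| = 3 -> L = R.
    by move=> LR cL; apply/setP/subset_cardP => //; rewrite cL cR.
  by rewrite (full H) // (full K) -?e //; apply: reach_refl.
move=> lt3 gt1; have cH : #|H| = 2 by apply/eqP; rewrite eqn_leq gt1 -ltnS lt3.
have [p pR eH] := missing H HR cH; have [q qR eK] := missing K KR (etrans (esym e) cH).
have [E|pq] := eqVneq p q; first by rewrite eH eK E; apply: reach_refl.
have : #|R :\ p| = 2 by rewrite -eH.
rewrite (cardsD1 q) in_setD1 (eq_sym q) pq qR add1n => -[cr].
have /card_gt0P [r] : 0 < #|R :\ p :\ q| by rewrite cr.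
rewrite !in_setD1 => /and3P [rq rp rR].
have -> : K = p |: (H :\ q).
  apply/setP => z; rewrite eK eH !in_setU1 !in_setD1.
  have [->|] := eqVneq z p; first by rewrite pq pR.
  by rewrite andTb.
apply: (reach_move (r := r)) => //.
- by rewrite /tri !adjR // eq_sym.
- by rewrite eH !in_setD1 eqxx.
- by rewrite eH in_setD1 eq_sym pq.
by rewrite eH in_setD1 rp.
Qed.

(** * Exchanging labelled pieces *)

Lemma feasible_swap_trans R H u v w : u \notin H -> v \notin H -> w \notin H ->
  feasible R H (tperm u v) -> feasible R H (tperm v w) -> feasible R H (tperm u w).
Proof.
move=> uH vH wH r1 r2.
have [->|uw] := eqVneq u w; first by rewrite tperm1; apply: feasible1.
have [<- //|vw] := eqVneq v w.
(* Conjugation by the exchange of [u] and [v] turns the exchange of [u] and [w] into that of [v] and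
   [w]. *)
apply: (feasible_swap_conj (s := tperm u v)) => //.
by rewrite tpermL tpermD // mv_tperm.
Qed.

Definition labels_swap k R := forall H, active R H -> k <= #|H :&: R| ->
  forall u v, u \in R :\: H -> v \in R :\: H -> feasible R H (tperm u v).

(** Any active hole set with at least [k] holes can be moved onto a superset of [Q], and exchanges
    are transported back by conjugation; so one hole set [Q] has to be examined. *)
Lemma labels_swap_of k R Q : hole_connected R -> Q \subset R -> active R Q -> #|Q| = k ->
  (forall u v, u \in R :\: Q -> v \in R :\: Q -> feasible R Q (tperm u v)) ->
  labels_swap k R.
Proof.
move=> Uc QR aQ cQ sw H aH kH u v; rewrite !inE => /andP [uH uR] /andP [vH vR].
have [||C [QC CR cC]] := @subset_between Q R #|H :&: R| QR.
- by rewrite cQ.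
- exact/subset_leq_card/subsetIr.
have [||||s rs es] := Uc (H :&: R) C _ CR _ _ _.
- exact: subsetIr.
- by apply: active_sub aH => //; apply/subsetP => p; rewrite !inE => /andP [-> ->].
- by apply: active_sub aQ => //; apply: subset_trans QC; apply: subsetIl.
- by rewrite cC.
have {}rs : feasible R H s by apply: feasible_sub rs => //; rewrite -setIA setIid; apply: subsetIl.
have sR := feasible_on rs.
have QsH : Q \subset mv s H.
  by apply: subset_trans QC _; rewrite -es -mv_on //; apply: subsetIl.
apply: (feasible_swap_conj uH vH rs); apply: (feasible_mono QsH).
have out w : w \notin H -> w \in R -> s w \in R :\: Q.
  move=> wH wR; rewrite !inE (perm_closed _ sR) wR andbT.
  by apply: contra wH => /(subsetP QsH); rewrite mem_mv.
by apply: sw; apply: out.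
Qed.

(** With the holes at [Q], usable in both regions, the piece on the common cell [z] is a hub: every
    piece can be exchanged with it inside its own region, and exchanges compose. *)
Lemma labels_swap_glue k R1 R2 Q z : labels_swap k R1 -> labels_swap k R2 ->
  hole_connected (R1 :|: R2) -> active R1 Q -> active R2 Q -> #|Q| = k ->
  Q \subset R1 :&: R2 -> z \in (R1 :&: R2) :\: Q -> labels_swap k (R1 :|: R2).
Proof.
move=> S1 S2 Uc a1 a2 cQ; rewrite subsetI => /andP [Q1 Q2].
rewrite !inE => /andP [zQ /andP [z1 z2]].
have Q12 : Q \subset R1 :|: R2 by apply: subset_trans Q1 _; apply: subsetUl.
apply: (labels_swap_of Uc Q12) => //.
  by apply: active_sub a1; [apply: subsetUl | apply: subsetIl].
have toz u : u \in (R1 :|: R2) :\: Q -> feasible (R1 :|: R2) Q (tperm u z).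
  rewrite !inE => /andP [uQ /orP [] uR].
    have := S1 Q a1; rewrite (setIidPl Q1) cQ => /(_ (leqnn _) u z).
    rewrite !inE uQ zQ uR z1 => /(_ isT isT); apply: feasible_sub; [exact: subsetUl|exact: subsetIl].
  have := S2 Q a2; rewrite (setIidPl Q2) cQ => /(_ (leqnn _) u z).
  rewrite !inE uQ zQ uR z2 => /(_ isT isT); apply: feasible_sub; [exact: subsetUr|exact: subsetIl].
move=> u v uR vR; have [uQ vQ] : u \notin Q /\ v \notin Q.
  by move: uR vR; rewrite !inE => /andP [? _] /andP [? _].
apply: (feasible_swap_trans uQ zQ vQ); first exact: toz.
by rewrite tpermC; apply: toz.
Qed.

Lemma labels_swap_perm k R H s : labels_swap k R -> active R H -> k <= #|H :&: R| ->
  perm_on (R :\: H) s -> feasible R H s.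
Proof.
move=> S aH kH; move: {2}_.+1 (ltnSn #|[set x | s x != x]|) => n.
elim: n s => // n IH s lt sR.
have [e|/set0Pn [x]] := eqVneq [set x | s x != x] set0.
  have -> : s = 1%g; last exact: feasible1.
  apply/permP => x; rewrite perm1; apply/eqP.
  by have : x \notin [set x | s x != x]; [rewrite e inE | rewrite inE negbK].
rewrite inE => sx; pose z := s^-1%g x.
have sz : s z = x by rewrite permKV.
have xR := on_moved sR sx.
have zR : z \in R :\: H by rewrite -(perm_closed _ sR) sz.
have [xH zH] : x \notin H /\ z \notin H.
  by move: xR zR; rewrite !inE => /andP [? _] /andP [? _].
(* Since [s z = x], the permutation [tperm x z * s] fixes [x] and moves no new cell, so its support
   is smaller. *)
have -> : s = (tperm x z * (tperm x z * s))%g by rewrite mulgA tperm2 mul1g.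
apply: feasible_cat; first exact: S.
rewrite mv_tperm //; apply: IH.
  rewrite -ltnS; apply: leq_trans lt; rewrite ltnS; apply: proper_card.
  apply/properP; split; last first.
    by exists x; rewrite !inE ?sx // permM tpermL sz eqxx.
  apply/subsetP => y; rewrite !inE permM; case: tpermP => [->|->|//].
    by rewrite sz eqxx.
  by move=> _; rewrite sz; apply: contra sx => /eqP e; rewrite {1}e sz.
apply: perm_onM => //; apply: subset_trans (tperm_on x z) _.
by apply/subsetP => y; rewrite !inE => /orP [] /eqP ->; rewrite -in_setD.
Qed.

Lemma mv_move H p q : p \notin H -> q \in H -> mv (tperm p q) H = p |: (H :\ q).
Proof.
move=> pH qH; apply/setP => z; rewrite !inE tpermV; case: tpermP => [->|->|].
- by rewrite eqxx qH.
- by rewrite eqxx (negPf pH) orbF; apply/esym; apply: contraNF pH => /eqP <-.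
by move=> /eqP /negPf -> /eqP ->.
Qed.

Lemma feasible_swap_after R H p q r u v : tri p q r ->
  p \in R -> q \in R -> r \in R -> p \notin H -> q \in H -> r \in H ->
  u \notin H -> v \notin H ->
  feasible R (p |: (H :\ q)) (tperm (tperm p q u) (tperm p q v)) -> feasible R H (tperm u v).
Proof.
move=> t pR qR rR pH qH rH uH vH sw; apply: (feasible_swap_conj uH vH).
  exact: feasible_move t pR qR rR qH rH.
by rewrite mv_move.
Qed.

(* The piece on r1 crosses the centre c to r4, then the piece on r3 slides    *)
(* over r2 to r1, and the first piece follows from r4 to r3.                  *)
Lemma feasible_gadget R H c r1 r2 r3 r4 r5 :
  uniq [:: c; r1; r2; r3; r4; r5] -> {subset [:: c; r1; r2; r3; r4; r5] <= R} ->
  tri c r1 r2 -> tri c r2 r3 -> tri c r3 r4 -> tri c r4 r5 ->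
  [set c; r2; r4; r5] \subset H -> r1 \notin H -> r3 \notin H ->
  feasible R H (tperm r1 r3).
Proof.
move=> u6 sR t1 t2 t3 t4 sH r1H r3H; apply: (feasible_mono sH).
have [cR r1R r2R [r3R r4R r5R]] :
    [/\ c \in R, r1 \in R, r2 \in R & [/\ r3 \in R, r4 \in R & r5 \in R]].
  by split; try split; apply: sR; rewrite !inE eqxx ?orbT.
move: u6; rewrite /= !inE !negb_or -!andbA.
move=> /and5P [n1 n2 n3 n4 /and5P [n5 n6 n7 n8 /and5P [n9 n10 n11 n12 /and4P [n13 n14 n15 _]]]].
pose N := (negPf n1, negPf n2, negPf n3, negPf n4, negPf n5, negPf n6, negPf n7,
  negPf n8, negPf n9, negPf n10, negPf n11, negPf n12, negPf n13, negPf n14, negPf n15).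
have S (a b : T) : (a == b) = false -> (b == a) = false by rewrite eq_sym.
pose M := (S _ _ (negPf n1), S _ _ (negPf n2), S _ _ (negPf n3), S _ _ (negPf n4),
  S _ _ (negPf n5), S _ _ (negPf n6), S _ _ (negPf n7), S _ _ (negPf n8),
  S _ _ (negPf n9), S _ _ (negPf n10), S _ _ (negPf n11), S _ _ (negPf n12),
  S _ _ (negPf n13), S _ _ (negPf n14), S _ _ (negPf n15)).
pose s := (tperm r1 c * (tperm c r4 * (tperm r3 r2 * (tperm r2 r1 * tperm r4 r3))))%g.
apply: (@feasible_ext _ _ s).
- apply: subset_trans (tperm_on _ _) _.
  by apply/subsetP => y; rewrite !inE => /orP [] /eqP ->.
- have tE a b d : tperm a b d = if d == a then b else if d == b then a else d.
    by case: tpermP => [->|->|/eqP/negPf -> /eqP/negPf -> //]; rewrite eqxx //; case: eqP.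
  move=> p; rewrite !inE !negb_or -!andbA => /and4P [p1 p2 p3 p4].
  rewrite !permM !tE.
  have [e|q1] := eqVneq p r1; first by rewrite !(N, M, eqxx).
  have [e|q3] := eqVneq p r3; first by rewrite e !(N, M, eqxx).
  by rewrite !((negPf p1), (negPf p2), (negPf p3), (negPf q1), (negPf q3)).
apply: feasible_cat.
  by apply: (feasible_move (r := r2)); rewrite // ?inE ?(N, M, eqxx) ?orbT //; exact: (tri_sym12 t1).
rewrite mv_move; try by rewrite !inE ?(N, M, eqxx) ?orbT.
apply: feasible_cat.
  by apply: (feasible_move (r := r5)); rewrite // ?inE ?(N, M, eqxx) ?orbT //; exact: t4.
rewrite mv_move; try by rewrite !inE ?(N, M, eqxx) ?orbT.
apply: feasible_cat.
  by apply: (feasible_move (r := c)); rewrite // ?inE ?(N, M, eqxx) ?orbT //; exact: (tri_sym12 (tri_rot t2)).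
rewrite mv_move; try by rewrite !inE ?(N, M, eqxx) ?orbT.
apply: feasible_cat.
  by apply: (feasible_move (r := c)); rewrite // ?inE ?(N, M, eqxx) ?orbT //; exact: (tri_sym12 (tri_rot t1)).
rewrite mv_move; try by rewrite !inE ?(N, M, eqxx) ?orbT.
by apply: (feasible_move (r := c)); rewrite // ?inE ?(N, M, eqxx) ?orbT //; exact: (tri_sym12 (tri_rot t3)).
Qed.

Lemma tperm_if (a b d : T) :
  tperm a b d = if d == a then b else if d == b then a else d.
Proof.
by case: tpermP => [->|->|/eqP/negPf -> /eqP/negPf -> //]; rewrite eqxx //; case: eqP.
Qed.

(* A flower with centre 0 and ring 1, ..., 6, and two cells 7 and 8 attached  *)
(* to the ring.  Cell 7 enters the ring, takes part in the swap of the        *)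
(* flower, and goes back; the same holds for cell 8 after half a turn.        *)
Lemma feasible_patch R (f : 'I_9 -> T) (o := fun k (k9 : k < 9) => f (Ordinal k9)) :
  injective f -> (forall i, f i \in R) ->
  tri (o 0 isT) (o 1 isT) (o 2 isT) -> tri (o 0 isT) (o 2 isT) (o 3 isT) ->
  tri (o 0 isT) (o 3 isT) (o 4 isT) -> tri (o 0 isT) (o 4 isT) (o 5 isT) ->
  tri (o 0 isT) (o 5 isT) (o 6 isT) -> tri (o 0 isT) (o 6 isT) (o 1 isT) ->
  tri (o 7 isT) (o 1 isT) (o 6 isT) -> tri (o 8 isT) (o 4 isT) (o 3 isT) ->
  let Q := [set o 0 isT; o 1 isT; o 2 isT; o 4 isT; o 6 isT] in
  [/\ feasible R Q (tperm (o 3 isT) (o 5 isT)), feasible R Q (tperm (o 7 isT) (o 3 isT))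
    & feasible R Q (tperm (o 8 isT) (o 5 isT))].
Proof.
move=> fI fR t1 t2 t3 t4 t5 t6 tx ty Q.
have oR k (k9 : k < 9) : o k k9 \in R by apply: fR.
have E j k (j9 : j < 9) (k9 : k < 9) : (o j j9 == o k k9) = (j == k).
  by rewrite (inj_eq fI).
have t2' := tri_sym12 (tri_rot t2); have t5' := tri_sym12 (tri_rot t5).
have in6 (j k l m n i : nat) j9 k9 l9 m9 n9 i9 :
    {subset [:: o j j9; o k k9; o l l9; o m m9; o n n9; o i i9] <= R}.
  by move=> z; rewrite !inE => /or4P [|||/or3P []] /eqP ->.
split.
- apply: (feasible_gadget _ (in6 _ _ _ _ _ _ _ _ _ _ _ _) t3 t4 t5 t6).
  + by rewrite /= !inE !E.
  + by apply/subsetP => z; rewrite !inE -!orbA => /or4P [] /eqP ->; rewrite ?E.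
  + by rewrite !inE !E.
  + by rewrite !inE !E.
- apply: (feasible_swap_after tx); rewrite ?inE ?E //.
  rewrite !tperm_if !E /=.
  apply: (feasible_swap_after (tri_rot t5)); rewrite ?inE ?E //.
  rewrite !tperm_if !E /=.
  apply: (feasible_gadget _ (in6 _ _ _ _ _ _ _ _ _ _ _ _) t1 t2 t3 t4).
  + by rewrite /= !inE !E.
  + by apply/subsetP => z; rewrite !inE -!orbA => /or4P [] /eqP ->; rewrite ?E.
  + by rewrite !inE !E.
  + by rewrite !inE !E.
apply: (feasible_swap_after (tri_rot t5)); rewrite ?inE ?E //.
rewrite !tperm_if !E /=.
apply: (feasible_swap_after t2'); rewrite ?inE ?E //.
rewrite !tperm_if !E /=.
apply: (feasible_swap_after ty); rewrite ?inE ?E //.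
rewrite !tperm_if !E /=.
apply: (feasible_swap_after (tri_rot t2)); rewrite ?inE ?E //.
rewrite !tperm_if !E /=.
apply: (feasible_gadget _ (in6 _ _ _ _ _ _ _ _ _ _ _ _) t4 t5 t6 t1).
+ by rewrite /= !inE !E.
+ by apply/subsetP => z; rewrite !inE -!orbA => /or4P [] /eqP ->; rewrite ?E.
+ by rewrite !inE !E.
+ by rewrite !inE !E.
Qed.

End HoleMoves.

(** * Rectangles of hexagons *)

Section HexRect.
Variable m : nat.
Implicit Types (p q r : cell m) (R H : {set cell m}).
Local Notation adj := (@hexadj m).

Lemma hexadjE p q : hexadj p q =
  [|| (p.1 == q.1 :> nat) && ((q.2 == p.2.+1 :> nat) || (p.2 == q.2.+1 :> nat)),
      (p.2 == q.2 :> nat) && ((q.1 == p.1.+1 :> nat) || (p.1 == q.1.+1 :> nat)),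
      (q.1 == p.1.+1 :> nat) && (p.2 == q.2.+1 :> nat)
    | (p.1 == q.1.+1 :> nat) && (q.2 == p.2.+1 :> nat)].
Proof. by case: p q => [? ?] [? ?]. Qed.

Lemma hexadj_sym : symmetric adj.
Proof. by move=> p q; rewrite !hexadjE; lia. Qed.

Lemma hexadj_irr : irreflexive adj.
Proof. by move=> p; rewrite !hexadjE; lia. Qed.

Lemma cell_at i j : i < m -> j < m ->
  exists p, p.1 = i :> nat /\ p.2 = j :> nat.
Proof. by move=> im jm; exists (Ordinal im, Ordinal jm). Qed.

Lemma cell_eq p q : (p == q) = (p.1 == q.1 :> nat) && (p.2 == q.2 :> nat).
Proof. by case: p q => [? ?] [? ?]. Qed.

Definition rect (a b c d : nat) : {set cell m} :=
  [set p : cell m | (a <= p.1 < b) && (c <= p.2 < d)].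


Let U := hole_connected adj.
Let addcell := hole_connected_add hexadj_sym hexadj_irr.

Lemma rect22 a c : a.+1 < m -> c.+1 < m -> U (rect a a.+2 c c.+2).
Proof.
move=> am cm.
have [p [p1 p2]] := @cell_at a c (ltnW am) (ltnW cm).
have [q [q1 q2]] := @cell_at a c.+1 (ltnW am) cm.
have [r [r1 r2]] := @cell_at a.+1 c am (ltnW cm).
have [x [x1 x2]] := @cell_at a.+1 c.+1 am cm.
have t : tri adj p q r by rewrite /tri !hexadjE; lia.
have -> : rect a a.+2 c c.+2 = x |: [set p; q; r].
  by apply/setP => z; rewrite !inE !cell_eq; lia.
apply: (@addcell _ _ q r q p p) => //; try by rewrite !inE !cell_eq; lia.
- exact: hole_connected3 hexadj_sym hexadj_irr _ _ _ t.
- by rewrite /tri !hexadjE; lia.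
- by rewrite /tri !hexadjE; lia.
- by rewrite /tri !hexadjE; lia.
- by rewrite hexadj_irr.
by move=> u; rewrite !inE !hexadjE !cell_eq; lia.
Qed.

Lemma rect2 a c d : a.+1 < m -> c.+1 < d -> d <= m -> U (rect a a.+2 c d).
Proof.
move=> am; elim: d => // d IH cd dm.
have [e|lt] : d = c.+1 \/ c.+1 < d by lia.
  by rewrite e; apply: rect22; lia.
have {}IH := IH lt (ltnW dm).
have [l [l1 l2]] := @cell_at a d.-1 ltac:(lia) ltac:(lia).
have [u [u1 u2]] := @cell_at a.+1 d.-1 ltac:(lia) ltac:(lia).
have [r [r1 r2]] := @cell_at a.+1 d.-2 ltac:(lia) ltac:(lia).
have [x [x1 x2]] := @cell_at a d ltac:(lia) ltac:(lia).
have [y [y1 y2]] := @cell_at a.+1 d ltac:(lia) ltac:(lia).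
have -> : rect a a.+2 c d.+1 = y |: (x |: rect a a.+2 c d).
  by apply/setP => z; rewrite !inE !cell_eq; lia.
apply: (@addcell _ _ x u x l l) => //; try by rewrite ?inE ?cell_eq; lia.
- apply: (@addcell _ _ l u l r r) => //; try by rewrite ?inE ?cell_eq; lia.
  + by rewrite /tri !hexadjE; lia.
  + by rewrite /tri !hexadjE; lia.
  + by rewrite /tri !hexadjE; lia.
  + by rewrite hexadj_irr.
  by move=> z; rewrite !inE !hexadjE !cell_eq; lia.
- by rewrite /tri !hexadjE; lia.
- by rewrite /tri !hexadjE; lia.
- by rewrite /tri !hexadjE; lia.
- by rewrite hexadj_irr.
by move=> z; rewrite !inE !hexadjE !cell_eq; lia.
Qed.

(** A new row is filled from left to right. The upper neighbours of a cell are in its own column and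
    one column to the right, so the first cell sees these two, the last one sees left and above, and
    an inner one sees the path left, above, above right. *)
Lemma rect_hole_connected a b c d : a.+1 < b -> b <= m -> c.+1 < d -> d <= m ->
  U (rect a b c d).
Proof.
move=> ab bm cd dm; elim: b ab bm => // b IH ab bm.
have [e|lt] : b = a.+1 \/ a.+1 < b by lia.
  by rewrite e; apply: rect2; lia.
have {}IH := IH lt (ltnW bm).
pose sh t : {set cell m} := rect a b c d :|: rect b b.+1 c (c + t).
have -> : rect a b.+1 c d = sh (d - c).
  by apply/setP => z; rewrite !inE; lia.
have : d - c <= d - c by [].
elim: {1 3}(d - c) => [_|t IHt le].
  have -> // : sh 0 = rect a b c d.
  by apply/setP => z; rewrite !inE; lia.
have {}IHt := IHt (ltnW le).
have [x [x1 x2]] := @cell_at b (c + t) ltac:(lia) ltac:(lia).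
have [u [u1 u2]] := @cell_at b.-1 (c + t) ltac:(lia) ltac:(lia).
have -> : sh t.+1 = x |: sh t.
  by apply/setP => z; rewrite !inE !cell_eq; lia.
have xR : x \notin sh t by rewrite !inE; lia.
have uR : u \in sh t by rewrite !inE; lia.
have [t0|tpos] := posnP t.
  have [w [w1 w2]] := @cell_at b.-1 (c + t).+1 ltac:(lia) ltac:(lia).
  have [r [r1 r2]] := @cell_at b.-2 (c + t).+1 ltac:(lia) ltac:(lia).
  apply: (@addcell _ _ w u w r r) => //; try by rewrite !inE; lia.
  + by rewrite /tri !hexadjE; lia.
  + by rewrite /tri !hexadjE; lia.
  + by rewrite /tri !hexadjE; lia.
  + by rewrite hexadj_irr.
  by move=> z; rewrite !inE !hexadjE !cell_eq; lia.
have [l [l1 l2]] := @cell_at b (c + t).-1 ltac:(lia) ltac:(lia).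
have [r [r1 r2]] := @cell_at b.-1 (c + t).-1 ltac:(lia) ltac:(lia).
have [last|notlast] := leqP d (c + t).+1.
  apply: (@addcell _ _ l u l r r) => //; try by rewrite !inE; lia.
  + by rewrite /tri !hexadjE; lia.
  + by rewrite /tri !hexadjE; lia.
  + by rewrite /tri !hexadjE; lia.
  + by rewrite hexadj_irr.
  by move=> z; rewrite !inE !hexadjE !cell_eq; lia.
have [w [w1 w2]] := @cell_at b.-1 (c + t).+1 ltac:(lia) ltac:(lia).
have [s [s1 s2]] := @cell_at b.-2 (c + t).+1 ltac:(lia) ltac:(lia).
apply: (@addcell _ _ l u w r s) => //; try by rewrite !inE; lia.
+ by rewrite /tri !hexadjE; lia.
+ by rewrite /tri !hexadjE; lia.
+ by rewrite /tri !hexadjE; lia.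
+ by rewrite !hexadjE; lia.
by move=> z; rewrite !inE !hexadjE !cell_eq; lia.
Qed.

End HexRect.

(** * Exchanging pieces in a rectangle with five holes *)

Section HexSwap.
Variable m : nat.
Implicit Types (p q r : cell m) (R H : {set cell m}).
Local Notation adj := (@hexadj m).

Lemma card_ord_interval a b : b <= m -> #|[set i : 'I_m | a <= i < b]| = b - a.
Proof.
elim: b => [_|b IH bm].
  by apply/eqP; rewrite cards_eq0; apply/eqP/setP => i; rewrite !inE; lia.
have [ba|ab] := ltnP b a.
  have -> : b.+1 - a = 0 by lia.
  by apply/eqP; rewrite cards_eq0; apply/eqP/setP => i; rewrite !inE; lia.
have -> : [set i : 'I_m | a <= i < b.+1] = Ordinal bm |: [set i : 'I_m | a <= i < b].
  by apply/setP => i; rewrite !inE -val_eqE /=; lia.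
by rewrite cardsU1 (IH (ltnW bm)) inE /=; lia.
Qed.

Lemma card_rect a b c d : b <= m -> d <= m -> #|rect m a b c d| = (b - a) * (d - c).
Proof.
move=> bm dm; rewrite -(card_ord_interval a bm) -(card_ord_interval c dm) -cardsX.
by congr #|pred_of_set _|; apply/setP => p; rewrite !inE.
Qed.

(* Four holes are used by the swap inside the flower around the centre, and   *)
(* the fifth one lets a piece from an acute corner enter the flower.          *)
Lemma rect33_labels_swap a c : a.+2 < m -> c.+2 < m ->
  labels_swap adj 5 (rect m a a.+3 c c.+3).
Proof.
move=> am cm; set R := rect _ _ _ _ _.
have [o [o1 o2]] := @cell_at m a.+1 c.+1 ltac:(lia) ltac:(lia).
have [r1 [r11 r12]] := @cell_at m a c.+1 ltac:(lia) ltac:(lia).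
have [r2 [r21 r22]] := @cell_at m a c.+2 ltac:(lia) ltac:(lia).
have [r3 [r31 r32]] := @cell_at m a.+1 c.+2 ltac:(lia) ltac:(lia).
have [r4 [r41 r42]] := @cell_at m a.+2 c.+1 ltac:(lia) ltac:(lia).
have [r5 [r51 r52]] := @cell_at m a.+2 c ltac:(lia) ltac:(lia).
have [r6 [r61 r62]] := @cell_at m a.+1 c ltac:(lia) ltac:(lia).
have [x [x1 x2]] := @cell_at m a c ltac:(lia) ltac:(lia).
have [y [y1 y2]] := @cell_at m a.+2 c.+2 ltac:(lia) ltac:(lia).
(* Row by row numbering of the window, which reduces distinctness of the nine cells to distinctness
   of numerals. *)
pose key (p : cell m) := (p.1 - a) * 3 + (p.2 - c).
pose cs := [:: o; r1; r2; r3; r4; r5; r6; x; y].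
pose Qs := [:: o; r1; r2; r4; r6]; pose Ps := [:: r3; r5; x; y].
have [ucs] : uniq cs /\ uniq (Qs ++ Ps).
  split; apply: (@map_uniq _ _ key).
    suff -> : map key cs = [:: 4; 1; 2; 5; 7; 6; 3; 0; 8] by [].
    rewrite /key /= o1 o2 r11 r12 r21 r22 r31 r32 r41 r42 r51 r52 r61 r62 x1 x2 y1 y2.
    by repeat congr cons; lia.
  suff -> : map key (Qs ++ Ps) = [:: 4; 1; 2; 7; 3; 5; 6; 0; 8] by [].
  rewrite /key /= o1 o2 r11 r12 r21 r22 r31 r32 r41 r42 r51 r52 r61 r62 x1 x2 y1 y2.
  by repeat congr cons; lia.
rewrite cat_uniq => /and3P [uQs /hasPn nQs _].
have allR : all (mem R) cs by rewrite /= !inE; lia.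
pose f (i : 'I_9) := nth o cs i.
have fI : injective f by move=> i j /eqP; rewrite nth_uniq // => /eqP /val_inj.
have fR i : f i \in R by apply: (allP allR); apply: mem_nth.
have [||||||||g1 g2 g3] := feasible_patch (@hexadj_sym m) (@hexadj_irr m) fI fR;
  try by rewrite /tri !hexadjE /f /=; lia.
pose Q := [set o; r1; r2; r4; r6].
rewrite /f /= -/Q in g1 g2 g3.
have QE : Q = [set:: Qs] by apply/setP => z; rewrite !inE !orbA.
have nQ z : z \in Ps -> z \notin Q by move=> /nQs; rewrite QE !inE.
have QR : Q \subset R.
  apply/subsetP => z; rewrite QE inE => zQ; apply: (allP allR).
  by move: zQ; rewrite !inE; do ![case/orP => [->|]] => [||||->]; rewrite ?orbT.
have cQ : #|Q| = 5 by rewrite QE cardsE; apply/card_uniqP.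
have aQ : active adj R Q.
  apply/activeP; exists o, r1, r2; rewrite !inE !eqxx ?orbT; split => //.
    by rewrite /tri !hexadjE; lia.
  by split; lia.
have U : hole_connected adj R by apply: rect_hole_connected; lia.
apply: (labels_swap_of (@hexadj_sym m) (@hexadj_irr m) U QR aQ cQ).
have [n3 n5 ny] : [/\ r3 \notin Q, r5 \notin Q & y \notin Q].
  by split; apply: nQ; rewrite !inE eqxx ?orbT.
have to3 u : u \in R :\: Q -> u \notin Q /\ feasible adj R Q (tperm u r3).
  rewrite inE => /andP [uQ uR]; split => //.
  have : u \in Ps.
    move: uQ; rewrite QE inE; apply: contraR => uP.
    have : u \in cs.
      have /subset_cardP sub : #|cs| = #|R|.
        rewrite (card_uniqP ucs) card_rect //.
        have [-> ->] // : a.+3 - a = 3 /\ c.+3 - c = 3 by lia.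
      by rewrite (sub _ u) //; apply/subsetP/allP.
    by move: uP; rewrite !inE => /norP [/negPf -> /norP [/negPf -> /norP [/negPf -> /negPf ->]]]; rewrite !orbF.
  rewrite !inE => /or4P [] /eqP -> //.
  - by rewrite tperm1; apply: feasible1.
  - by rewrite tpermC.
  apply: (feasible_swap_trans (@hexadj_sym m) (@hexadj_irr m) ny n5 n3 g3).
  by rewrite tpermC.
move=> u v /to3 [uQ ru] /to3 [vQ rv].
apply: (feasible_swap_trans (@hexadj_sym m) (@hexadj_irr m) uQ n3 vQ ru).
by rewrite tpermC.
Qed.

(** Rectangles are glued from copies shifted by one, first widening 3 by 3 windows and then stacking
    strips. Two such copies share at least six cells: five for the holes and one for the hub of
    [labels_swap_glue]. *)
Lemma rect_labels_swap a b c d : a.+2 < b -> b <= m -> c.+2 < d -> d <= m ->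
  labels_swap adj 5 (rect m a b c d).
Proof.
have overlap a1 b1 c1 d1 : a1.+1 < b1 -> b1 <= m -> c1.+1 < d1 -> d1 <= m ->
    5 < #|rect m a1 b1 c1 d1| -> exists (Q : {set cell m}) z, [/\ Q \subset rect m a1 b1 c1 d1,
      active adj (rect m a1 b1 c1 d1) Q, #|Q| = 5 & z \in rect m a1 b1 c1 d1 :\: Q].
  move=> ab bm cd dm gt; set R := rect _ _ _ _ _.
  have [p [p1 p2]] := @cell_at m a1 c1 ltac:(lia) ltac:(lia).
  have [q [q1 q2]] := @cell_at m a1 c1.+1 ltac:(lia) ltac:(lia).
  have [r [r1 r2]] := @cell_at m a1.+1 c1 ltac:(lia) ltac:(lia).
  have [pR qR rR] : [/\ p \in R, q \in R & r \in R] by split; rewrite inE; lia.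
  have [|||Q [pqQ QR cQ]] := @subset_between _ [set p; q] R 5.
  - by apply/subsetP => z; rewrite !in_set2 => /orP [] /eqP ->.
  - by rewrite cards2; case: (p != q).
  - exact: ltnW.
  have [z zQ] : exists z, z \in R :\: Q.
    by apply/card_gt0P; rewrite cardsDS // subn_gt0 cQ.
  exists Q, z; split => //; apply/activeP; exists p, q, r.
  have [pQ qQ] : p \in Q /\ q \in Q by split; apply: (subsetP pqQ); rewrite !inE eqxx ?orbT.
  by split => //; rewrite /tri !hexadjE; lia.
have glue R1 R2 a1 b1 c1 d1 : a1.+1 < b1 -> b1 <= m -> c1.+1 < d1 -> d1 <= m ->
    5 < #|rect m a1 b1 c1 d1| -> rect m a1 b1 c1 d1 = R1 :&: R2 ->
    labels_swap adj 5 R1 -> labels_swap adj 5 R2 ->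
    hole_connected adj (R1 :|: R2) -> labels_swap adj 5 (R1 :|: R2).
  move=> ab bm cd dm gt e S1 S2 U12.
  have [Q [z [QR aQ cQ zQ]]] := overlap _ _ _ _ ab bm cd dm gt.
  rewrite e in QR aQ zQ.
  apply: (labels_swap_glue (@hexadj_sym m) (@hexadj_irr m) S1 S2 U12 _ _ cQ QR zQ).
    by apply: active_sub aQ; [apply: subsetIl | apply: subsetIl].
  by apply: active_sub aQ; [apply: subsetIr | apply: subsetIl].
move=> ab bm cd dm.
have gt5 a1 b1 c1 d1 : a1.+1 < b1 -> b1 <= m -> c1.+1 < d1 -> d1 <= m ->
    (a1.+2 < b1) || (c1.+2 < d1) -> 5 < #|rect m a1 b1 c1 d1|.
  by move=> *; rewrite card_rect //; nia.
have wide a1 w : a1.+2 < m -> forall c', c' + w <= m -> 2 < w ->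
    labels_swap adj 5 (rect m a1 a1.+3 c' (c' + w)).
  move=> am; elim: w => // w IH c' le lt.
  have [->|{}lt] : w = 2 \/ 2 < w by lia.
    by rewrite addn3; apply: rect33_labels_swap; lia.
  have -> : rect m a1 a1.+3 c' (c' + w.+1) =
      rect m a1 a1.+3 c' (c' + w) :|: rect m a1 a1.+3 c'.+1 (c'.+1 + w).
    by apply/setP => z; rewrite !inE; lia.
  apply: (@glue _ _ a1 a1.+3 c'.+1 (c' + w)); try lia.
  - by apply: gt5; lia.
  - by apply/setP => z; rewrite !inE; lia.
  - by apply: IH; lia.
  - by apply: IH; lia.
  have -> : rect m a1 a1.+3 c' (c' + w) :|: rect m a1 a1.+3 c'.+1 (c'.+1 + w) =
      rect m a1 a1.+3 c' (c' + w.+1).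
    by apply/setP => z; rewrite !inE; lia.
  by apply: rect_hole_connected; lia.
have tall h : forall a', a' + h <= m -> 2 < h ->
    labels_swap adj 5 (rect m a' (a' + h) c d).
  elim: h => // h IH a' le lt.
  have [e|{}lt] : h = 2 \/ 2 < h by lia.
    have := @wide a' (d - c) ltac:(lia) c; rewrite e addn3 subnKC; last by lia.
    by apply; lia.
  have E : rect m a' (a' + h.+1) c d =
      rect m a' (a' + h) c d :|: rect m a'.+1 (a'.+1 + h) c d.
    by apply/setP => z; rewrite !inE; lia.
  rewrite E; apply: (@glue _ _ a'.+1 (a' + h) c d); try lia.
  - by apply: gt5; lia.
  - by apply/setP => z; rewrite !inE; lia.
  - by apply: IH; lia.
  - by apply: IH; lia.
  by rewrite -E; apply: rect_hole_connected; lia.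
have := tall (b - a) a; rewrite subnKC; last by lia.
by apply; lia.
Qed.
End HexSwap.

(** * Blocks and activation *)

Section Blocks.
Variables m l B : nat.
Hypotheses (mE : m = l * B) (B3 : 3 < B).
Local Notation adj := (@hexadj m).
Local Notation index := ('I_l * 'I_l)%type.
Implicit Types (p q : cell m) (R H K : {set cell m}) (v w : index) (A : {set index})
  (s t : {perm cell m}).

Let B0 : 0 < B. Proof. exact: leq_trans B3. Qed.

Lemma block_subproof (i : 'I_m) : i %/ B < l.
Proof. by rewrite ltn_divLR // -mE. Qed.

Definition block_of p : index :=
  (Ordinal (block_subproof p.1), Ordinal (block_subproof p.2)).

Definition block v : {set cell m} := [set p | block_of p == v].

Definition blocks A : {set cell m} := [set p | block_of p \in A].

Definition nholes H v := #|H :&: block v|.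

Lemma div_range n u u' : (u <= n %/ B < u') = (u * B <= n < u' * B).
Proof. by rewrite leq_divRL // ltn_divLR. Qed.

Lemma blocks_rect (u0 u1 v0 v1 : nat) :
  blocks [set v : index | (u0 <= v.1 < u1) && (v0 <= v.2 < v1)]
  = rect m (u0 * B) (u1 * B) (v0 * B) (v1 * B).
Proof. by apply/setP => p; rewrite !inE /= !div_range. Qed.

Lemma block1 v : block v = blocks [set v].
Proof. by apply/setP => p; rewrite !inE. Qed.

Lemma block_rect v : block v = rect m (v.1 * B) (v.1.+1 * B) (v.2 * B) (v.2.+1 * B).
Proof.
rewrite -blocks_rect block1; congr blocks; apply/setP => w; rewrite !inE !ltnS -!eqn_leq.
by case: v w => [? ?] [? ?]; rewrite xpair_eqE -!val_eqE /= eq_sym [X in _ && X]eq_sym.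
Qed.

Lemma block_bound (i : 'I_l) : i.+1 * B <= m.
Proof. by rewrite mE leq_mul2r ltn_ord orbT. Qed.

Lemma card_block v : #|block v| = B * B.
Proof.
rewrite block_rect card_rect ?block_bound //.
by rewrite !mulSn !addnK.
Qed.

Lemma block_sub A v : v \in A -> block v \subset blocks A.
Proof. by move=> vA; apply/subsetP => p; rewrite !inE => /eqP ->. Qed.

Lemma blocks_subset A A' : A \subset A' -> blocks A \subset blocks A'.
Proof. by move=> /subsetP s; apply/subsetP => p; rewrite !inE; apply: s. Qed.

Lemma sum_nholes A H : \sum_(v in A) nholes H v = #|H :&: blocks A|.
Proof.
rewrite -sum1_card (partition_big block_of (mem A)) /=; last first.
  by move=> p; rewrite !inE => /andP [].
apply: eq_bigr => v vA; rewrite /nholes -sum1_card; apply: eq_bigl => p.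
by rewrite !inE -andbA; have [->|] := eqVneq (block_of p) v; rewrite ?vA ?andbF.
Qed.

Lemma block_edge v : exists p q r, [/\ tri adj p q r, p \in block v, q \in block v & r \in block v].
Proof.
have b1 := block_bound v.1; have b2 := block_bound v.2; rewrite mulSn in b1 b2.
have [p [p1 p2]] := @cell_at m (v.1 * B) (v.2 * B) ltac:(lia) ltac:(lia).
have [q [q1 q2]] := @cell_at m (v.1 * B) (v.2 * B).+1 ltac:(lia) ltac:(lia).
have [r [r1 r2]] := @cell_at m (v.1 * B).+1 (v.2 * B) ltac:(lia) ltac:(lia).
exists p, q, r; rewrite !block_rect !inE !mulSn.
by split; rewrite ?/tri ?hexadjE; lia.
Qed.

Lemma active_block_nholes v H : active adj (block v) H -> 1 < nholes H v.
Proof. exact: active_card (@hexadj_irr m) _ _. Qed.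

Lemma active_ext R H K : H :&: R = K :&: R -> active adj R H -> active adj R K.
Proof. by move=> e; apply: active_sub => //; rewrite e; apply: subsetIl. Qed.

Lemma block_out A s H v : perm_on (blocks A) s -> v \notin A ->
  mv s H :&: block v = H :&: block v.
Proof.
move=> sA vA.
have e (L : {set cell m}) : L :&: block v = (L :\: blocks A) :&: block v.
  apply/setP => p; rewrite !inE.
  by have [->|] := eqVneq (block_of p) v; rewrite ?andbF // vA andbT.
by rewrite e (mv_out _ sA) -e.
Qed.

Lemma choose_holes v n : n <= B * B -> exists K, [/\ K \subset block v, #|K| = n &
  1 < n -> active adj (block v) K].
Proof.
move=> nB; have [p [q [r [t pv qv rv]]]] := block_edge v.
have [n1|n2] := leqP n 1.
  have [|||K [_ KB cK]] := @subset_between _ set0 (block v) n.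
  - exact: sub0set.
  - by rewrite cards0.
  - by rewrite card_block.
  by exists K; split => //; rewrite ltnNge n1.
have [pq _ _] := tri_neq (@hexadj_irr m) t.
have [|||K [pqK KB cK]] := @subset_between _ [set p; q] (block v) n.
- by apply/subsetP => z; rewrite in_set2 => /orP [] /eqP ->.
- by rewrite cards2 pq.
- by rewrite card_block.
exists K; split => // _; apply/activeP; exists p, q, r.
by split => //; apply: (subsetP pqK); rewrite !inE eqxx ?orbT.
Qed.

(** The target is assembled block by block from [choose_holes]; the block with at least two
    prescribed holes makes it active, so connectivity of the hole sets applies. *)
Lemma redistribute A H (t : index -> nat) : hole_connected adj (blocks A) ->
  active adj (blocks A) H -> (forall v, v \in A -> t v <= B * B) ->
  \sum_(v in A) t v = #|H :&: blocks A| -> (exists2 v, v \in A & 1 < t v) ->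
  exists s, feasible adj (blocks A) H s /\ forall v, v \in A ->
    nholes (mv s H) v = t v /\ (1 < t v -> active adj (block v) (mv s H)).
Proof.
move=> U aH tB sum_t [v0 v0A t0].
have /fin_all_exists [X PX] : forall v, exists K, v \in A ->
    [/\ K \subset block v, #|K| = t v & 1 < t v -> active adj (block v) K].
  move=> v; case: (boolP (v \in A)) => vA; last by exists set0.
  by have [K ?] := choose_holes v (tB v vA); exists K.
pose K : {set cell m} := [set p | (block_of p \in A) && (p \in X (block_of p))].
have KA : K \subset blocks A by apply/subsetP => p; rewrite !inE => /andP [].
have Kv v : v \in A -> K :&: block v = X v.
  move=> vA; have [Xv _ _] := PX v vA; apply/setP => p; rewrite !inE.
  have [e|ne] := eqVneq (block_of p) v; first by rewrite e vA andbT.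
  rewrite andbF; apply/esym/negbTE; apply: contra ne => /(subsetP Xv).
  by rewrite inE.
have aK v : v \in A -> 1 < t v -> active adj (block v) K.
  move=> vA tv; have [Xv _ /(_ tv)] := PX v vA; apply: active_sub => //.
  by rewrite -(Kv v vA) -setIA setIid subsetIl.
have cK : #|H :&: blocks A| = #|K|.
  rewrite -sum_t -[in RHS](setIidPl KA) -sum_nholes; apply: eq_bigr => v vA.
  by rewrite /nholes Kv //; have [_ ->] := PX v vA.
have [|||s fs sK] := U (H :&: blocks A) K _ KA _ _ cK.
- exact: subsetIr.
- by apply: active_ext aH; rewrite -setIA setIid.
- by apply: active_sub (aK v0 v0A t0); [apply: block_sub | apply: subsetIl].
exists s; split; first by apply: feasible_sub fs => //; rewrite -setIA setIid subsetIl.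
move=> v vA; have bv : mv s H :&: block v = X v.
  rewrite -(Kv v vA) -sK -(mv_on _ (feasible_on fs)) -setIA; congr (_ :&: _).
  by apply/esym/setIidPr; apply: block_sub.
have [_ <- aX] := PX v vA; split; first by rewrite /nholes bv.
move=> tv; apply: active_ext (aK v vA _) => //; first by rewrite bv Kv.
by have [_ <- _] := PX v vA.
Qed.

Lemma card_blocks A : #|blocks A| = #|A| * (B * B).
Proof.
rewrite -[blocks A]setTI -sum_nholes -sum_nat_const; apply: eq_bigr => v _.
by rewrite /nholes setTI card_block.
Qed.

Definition box (u0 u1 v0 v1 : nat) : {set index} :=
  [set v : index | (u0 <= v.1 < u1) && (v0 <= v.2 < v1)].

Lemma box_connected (u0 u1 v0 v1 : nat) : u0 < u1 -> u1 <= l -> v0 < v1 -> v1 <= l ->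
  hole_connected adj (blocks (box u0 u1 v0 v1)).
Proof.
move=> u01 ul v01 vl; rewrite blocks_rect.
by apply: rect_hole_connected; rewrite ?mE; nia.
Qed.

Definition next_to v w :=
  (v.1 == w.1 :> nat) && ((v.2.+1 == w.2 :> nat) || (w.2.+1 == v.2 :> nat)) ||
  (v.2 == w.2 :> nat) && ((v.1.+1 == w.1 :> nat) || (w.1.+1 == v.1 :> nat)).

Lemma index_eq v w : (v == w) = (v.1 == w.1 :> nat) && (v.2 == w.2 :> nat).
Proof. by case: v w => [? ?] [? ?]. Qed.

Lemma pair_connected v w : next_to v w -> hole_connected adj (blocks [set v; w]).
Proof.
rewrite /next_to => vw.
have -> : [set v; w] = box (minn v.1 w.1) (maxn v.1 w.1).+1 (minn v.2 w.2) (maxn v.2 w.2).+1.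
  by apply/setP => z; rewrite !inE !index_eq; lia.
have := (ltn_ord v.1, ltn_ord v.2, ltn_ord w.1, ltn_ord w.2).
by case=> [[[? ?] ?] ?]; apply: box_connected; lia.
Qed.

(** The bound of [feasible_bound] for a region of two blocks; it depends on [B] alone. *)
Definition pair_cost := (2 * (B * B))`!.

Lemma pair_realize v w H s A : v \in A -> w \in A ->
  feasible adj (blocks [set v; w]) H s -> realize adj (blocks A) pair_cost H s.
Proof.
move=> vA wA fs.
have sub : blocks [set v; w] \subset blocks A.
  by apply: blocks_subset; apply/subsetP => z; rewrite !inE => /orP [] /eqP ->.
have := feasible_bound (k := 2 * (B * B)) _ fs.
rewrite card_blocks leq_mul2r cards2 => /(_ _)/(realize_sub sub (subsetIl _ _)); apply.
by case: (v != w); rewrite orbT.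
Qed.

(** * Activating all blocks from a single one *)

Definition preserves A H K := forall v, v \in A ->
  nholes K v = nholes H v /\ (active adj (block v) H -> active adj (block v) K).

Lemma preserves_trans A H K L : preserves A H K -> preserves A K L -> preserves A H L.
Proof.
move=> h1 h2 v vA; have [e1 a1] := h1 v vA; have [e2 a2] := h2 v vA.
by rewrite e2 e1; split=> // /a1 /a2.
Qed.

Definition gdist_index v w :=
  (v.1 - w.1) + (w.1 - v.1) + ((v.2 - w.2) + (w.2 - v.2)).

Lemma step_towards (u0 u1 v0 v1 : nat) v w d : v \in box u0 u1 v0 v1 -> w \in box u0 u1 v0 v1 ->
  gdist_index v w = d.+1 ->
  exists v', [/\ v' \in box u0 u1 v0 v1, next_to v v' & gdist_index v' w = d].
Proof.
rewrite !inE /gdist_index /next_to => vS wS e.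
have [b1 b2 b3 b4] := And4 (ltn_ord v.1) (ltn_ord v.2) (ltn_ord w.1) (ltn_ord w.2).
have [i [j [il jl h]]] : exists i j, [/\ i < l, j < l &
   [/\ (u0 <= i < u1) && (v0 <= j < v1),
    (v.1 == i :> nat) && ((v.2.+1 == j :> nat) || (j.+1 == v.2 :> nat)) ||
    (v.2 == j :> nat) && ((v.1.+1 == i :> nat) || (i.+1 == v.1 :> nat)) &
    (i - w.1) + (w.1 - i) + ((j - w.2) + (w.2 - j)) = d]].
  have [lt|ge] := ltnP v.1 w.1; first by exists v.1.+1, v.2; split; [lia|lia|split; lia].
  have [lt|ge'] := ltnP w.1 v.1; first by exists v.1.-1, v.2; split; [lia|lia|split; lia].
  have [lt|ge2] := ltnP v.2 w.2; first by exists v.1, v.2.+1; split; [lia|lia|split; lia].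
  by exists v.1, v.2.-1; split; [lia|lia|split; lia].
by exists (Ordinal il, Ordinal jl); rewrite inE.
Qed.

Let move2 a b : 1 < a -> a - 2 + (b + 2) = a + b. Proof. lia. Qed.

(** The active pair travels along a path of blocks and returns, so that hole counts and earlier
    activations are restored. Each edge of the path is used at most twice, hence the factor
    [2 * d]. *)
Lemma tour (u0 u1 v0 v1 : nat) (S := box u0 u1 v0 v1) d v w H : v \in S -> w \in S ->
  gdist_index v w <= d -> active adj (block v) H ->
  exists s, [/\ realize adj (blocks S) (2 * d * pair_cost) H s, preserves S H (mv s H) &
    1 < nholes H w -> active adj (block w) (mv s H)].
Proof.
move=> vS wS le; suff main : forall d v H, v \in S -> gdist_index v w = d ->
    active adj (block v) H ->
    exists s, [/\ realize adj (blocks S) (2 * d * pair_cost) H s, preserves S H (mv s H) &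
      1 < nholes H w -> active adj (block w) (mv s H)].
  move=> av; have [s [rs ps as_]] := main _ v H vS (erefl _) av.
  exists s; split => //; apply: realize_leq rs.
  by rewrite leq_mul2r leq_mul2l le !orbT.
clear v vS H d le; elim => [|d IH] v H vS e av.
  have <- : v = w by apply/eqP; move: e; rewrite /gdist_index index_eq; lia.
  by exists 1%g; rewrite mv1; split => //; apply: realize1.
have [v' [v'S vv' e']] := step_towards vS wS e.
have U := pair_connected vv'.
have [vA v'A] : v \in [set v; v'] /\ v' \in [set v; v'] by rewrite !inE !eqxx orbT.
have ne : v != v' by move: vv'; rewrite index_eq /next_to; lia.
have hv := active_block_nholes av.
have aA K u : u \in [set v; v'] -> active adj (block u) K -> active adj (blocks [set v; v']) K.
  by move=> uA; apply: active_sub (subsetIl _ _); apply: block_sub.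
have small K u : nholes K u <= B * B.
  by rewrite -(card_block u); apply/subset_leq_card/subsetIr.
have off K s u : feasible adj (blocks [set v; v']) K s -> u \notin [set v; v'] ->
    nholes (mv s K) u = nholes K u /\
    (active adj (block u) K -> active adj (block u) (mv s K)).
  move=> fs uA; have eu := block_out (K) (feasible_on fs) uA.
  by split; [rewrite /nholes eu | apply: active_ext].
(* A next block with two holes of its own is merely activated and continues the tour. Otherwise two
   holes of [v] are lent to it, and [s3] brings them back afterwards. *)
have [rich|poor] := ltnP 1 (nholes H v').
  have [|||s [fs sA]] := redistribute U (aA _ _ vA av) (t := nholes H).
  - by move=> u _; apply: small.
  - exact: sum_nholes.
  - by exists v.
  have [_ av'] := sA _ v'A.
  have [t [rt pt tw]] := IH v' (mv s H) v'S e' (av' rich).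
  have ps : preserves S H (mv s H).
    move=> u uS; case: (boolP (u \in [set v; v'])) => uA; last exact: off.
    by have [-> h] := sA u uA; split => // /active_block_nholes /h.
  exists (s * t)%g; rewrite -mvM; split.
  - have := realize_cat (pair_realize vS v'S fs) rt; apply: realize_leq.
    by rewrite mulnS mulnDl (mul2n pair_cost) -addnn -addnA leq_add2l leq_addl.
  - exact: preserves_trans ps pt.
  by have [<- _] := ps w wS; apply: tw.
pose t1 u := if u == v then nholes H v - 2 else nholes H v' + 2.
have [t1v t1v'] : t1 v = nholes H v - 2 /\ t1 v' = nholes H v' + 2.
  by rewrite /t1 eqxx eq_sym (negPf ne).
have sum2 (f : index -> nat) : \sum_(u in [set v; v']) f u = f v + f v'.
  by rewrite big_setU1 ?inE //= big_set1.
have [|||s1 [f1 s1A]] := redistribute U (aA _ _ vA av) (t := t1).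
- move=> u; rewrite !inE => /orP [] /eqP ->; rewrite ?t1v ?t1v'.
    by apply: leq_trans (small H v); apply: leq_subr.
  by nia.
- by rewrite -sum_nholes !sum2 t1v t1v' move2.
- by exists v'; rewrite // t1v' leq_addl.
pose H1 := mv s1 H.
have [n1v _] := s1A v vA; have [n1v' a1v'] := s1A v' v'A.
rewrite -/H1 t1v in n1v; rewrite -/H1 t1v' in n1v' a1v'.
have [t [rt pt tw]] := IH v' H1 v'S e' (a1v' (leq_addl _ _)).
pose H2 := mv t H1.
have [n2v _] := pt v vS; have [n2v' a2v'] := pt v' v'S.
rewrite -/H2 in n2v n2v' a2v'.
have [|||s3 [f3 s3A]] := redistribute U (aA H2 _ v'A (a2v' (a1v' (leq_addl _ _)))) (t := nholes H).
- by move=> u _; apply: small.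
- by rewrite -sum_nholes !sum2 n2v n2v' n1v n1v' move2.
- by exists v.
have [_ a3v] := s3A v vA; have [_ a3v'] := s3A v' v'A.
exists (s1 * (t * s3))%g; rewrite -!mvM -/H1 -/H2; split.
- have := realize_cat (pair_realize vS v'S f1) (realize_cat rt (pair_realize vS v'S f3)).
  apply: realize_leq.
  by rewrite mulnS mulnDl (mul2n pair_cost) -addnn -addnA leq_add2l addnC.
- move=> u uS; case: (boolP (u \in [set v; v'])) => uA.
    by have [-> h] := s3A u uA; split => // /active_block_nholes /h.
  have [n1 a1] := off _ _ _ f1 uA; have [n2 a2] := pt u uS; have [n3 a3] := off _ _ _ f3 uA.
  by rewrite -/H1 -/H2 in n1 a1 n2 a2 n3 a3 *; rewrite n3 n2 n1; split => // /a1 /a2 /a3.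
move=> richw; case: (boolP (w \in [set v; v'])) => wA.
  by have [_ h] := s3A w wA; apply: h.
have [n1 a1] := off _ _ _ f1 wA; have [_ a3] := off _ _ _ f3 wA.
by apply: a3; apply: tw; rewrite n1.
Qed.

Lemma tours (u0 u1 v0 v1 : nat) (S := box u0 u1 v0 v1) D v H (ws : seq index) :
  v \in S -> (forall w, w \in S -> gdist_index v w <= D) -> {subset ws <= S} ->
  active adj (block v) H ->
  exists s, [/\ realize adj (blocks S) (size ws * (2 * D * pair_cost)) H s,
    preserves S H (mv s H) &
    forall w, w \in ws -> 1 < nholes H w -> active adj (block w) (mv s H)].
Proof.
move=> vS vD; elim: ws H => [|w ws IH] H wsS av.
  by exists 1%g; rewrite mv1; split => //; apply: realize1.
have wS : w \in S by apply: wsS; rewrite inE eqxx.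
have [s [rs ps ws_]] := tour vS wS (vD w wS) av.
have [|t [rt pt wt]] := IH (mv s H) _ (proj2 (ps v vS) av).
  by move=> z zw; apply: wsS; rewrite inE zw orbT.
exists (s * t)%g; rewrite -mvM mulSn; split.
- exact: realize_cat rs rt.
- exact: preserves_trans ps pt.
move=> z; rewrite inE => /orP [/eqP ->|zw] rich.
  by have [_] := pt w wS; apply; apply: ws_.
by apply: wt => //; rewrite (proj1 (ps z (wsS z _))) // inE zw orbT.
Qed.

(* The freeze-tag strategy: the active pair visits one block of each quadrant *)
(* in time proportional to the side, and the quadrants then work in parallel. *)
Lemma wake_up k : forall (u0 v0 : nat) (S := box u0 (u0 + 2 ^ k) v0 (v0 + 2 ^ k)) H,
  u0 + 2 ^ k <= l -> v0 + 2 ^ k <= l -> (exists2 v, v \in S & active adj (block v) H) ->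
  exists s, realize adj (blocks S) (32 * pair_cost * 2 ^ k) H s /\
    forall v, v \in S -> nholes (mv s H) v = nholes H v /\
      (1 < nholes H v -> active adj (block v) (mv s H)).
Proof.
elim: k => [|k IH] u0 v0 S H ul vl [v vS av].
  exists 1%g; rewrite mv1; split; first exact: realize1.
  move=> w wS; split => // _; suff <- : v = w by [].
  by apply/eqP; move: vS wS; rewrite index_eq /S expn0 !inE; lia.
(* [D] exceeds all distances in a square of side [2 * 2 ^ k]. Four tours cost
   [4 * (2 * D) = 32 * 2 ^ k] pair costs, and the parallel recursion costs as much again, which
   gives the constant 32. *)
pose D := 4 * 2 ^ k.
have two : 2 ^ k.+1 = 2 ^ k + 2 ^ k by rewrite expnS mul2n addnn.
pose Q (q : bool * bool) := box (u0 + q.1 * 2 ^ k) (u0 + q.1 * 2 ^ k + 2 ^ k)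
                               (v0 + q.2 * 2 ^ k) (v0 + q.2 * 2 ^ k + 2 ^ k).
have QS (q : bool * bool) : Q q \subset S.
  apply/subsetP => z; rewrite !inE two; move: q => [[] []] /=; lia.
(* A block to be woken in each quadrant; in a quadrant where no block has two holes the default [v]
   makes the tour trivial and nothing needs activation. *)
pose rep (q : bool * bool) := odflt v [pick w | (w \in Q q) && (1 < nholes H w)].
have repP (q : bool * bool) w : w \in Q q -> 1 < nholes H w -> rep q \in Q q /\ 1 < nholes H (rep q).
  move=> wQ rw; rewrite /rep; case: pickP => [z /andP [] //|/(_ w)].
  by rewrite wQ rw.
have repS (q : bool * bool) : rep q \in S.
  by rewrite /rep; case: pickP => [z /andP [/(subsetP (QS q))] //|_].
have vD w : w \in S -> gdist_index v w <= D.
  move: vS; rewrite /D /gdist_index /S !inE two; lia.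
have [|s [rs ps ws]] := tours (ws := map rep (enum {: bool * bool})) vS vD _ av.
  by move=> z /mapP [q _ ->].
pose H1 := mv s H.
have /fin_all_exists [f Pf] : forall q : bool * bool, exists t,
    realize adj (blocks (Q q)) (32 * pair_cost * 2 ^ k) H1 t /\
    forall w, w \in Q q -> nholes (mv t H1) w = nholes H1 w /\
      (1 < nholes H1 w -> active adj (block w) (mv t H1)).
  move=> q; case: (pickP [pred w | (w \in Q q) && (1 < nholes H w)]) => [w|none].
    case/andP => wQ rw; apply: IH.
    - by case: q wQ => [[] []] _ /=; lia.
    - by case: q wQ => [[] []] _ /=; lia.
    have [rQ rr] := repP q w wQ rw; exists (rep q) => //.
    by apply: ws => //; apply: map_f; rewrite mem_enum.
  exists 1%g; rewrite mv1; split; first exact: realize1.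
  move=> w wQ; split => //; have := none w; rewrite /= wQ /= => n.
  by rewrite (proj1 (ps w (subsetP (QS q) _ wQ))) n.
pose g p := (u0 + 2 ^ k <= (block_of p).1, v0 + 2 ^ k <= (block_of p).2).
have gQ (q : bool * bool) p : p \in blocks (Q q) -> g p = q.
  by rewrite !inE /g; case: q => [[] []] /= h; congr pair; lia.
have [t [rt _ tQ]] := realize_glue gQ (fun c => blocks_subset (QS c)) (fun c => (Pf c).1).
exists (s * t)%g; rewrite -mvM -/H1; split.
  have := realize_cat rs rt; apply: realize_leq.
  rewrite size_map -cardE card_prod card_bool /D expnS; lia.
move=> w wS; have [q wQ] : exists q : bool * bool, w \in Q q.
  exists (u0 + 2 ^ k <= w.1, v0 + 2 ^ k <= w.2).
  move: wS; rewrite /S /Q !inE two /=; case: leqP; case: leqP => /=; lia.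
have e : mv t H1 :&: block w = mv (f q) H1 :&: block w.
  have bw : block w = blocks (Q q) :&: block w by apply/esym/setIidPr/block_sub.
  by rewrite bw !setIA tQ.
have [_ fQ] := Pf q; have [n1 a1] := fQ w wQ; have [n2 _] := ps w wS.
rewrite -/H1 in n2; split; first by rewrite /nholes e -/(nholes _ _) n1 n2.
by move=> rw; apply: active_ext (esym e) (a1 _); rewrite n2.
Qed.

(** Two adjacent hexagons have two common neighbours in the tiling, one on each side, and a
    rectangle with both sides at least 2 contains one of them. *)
Lemma rect_active (a b c d : nat) p q H : a.+1 < b -> b <= m -> c.+1 < d -> d <= m ->
  p \in rect m a b c d -> q \in rect m a b c d -> adj p q -> p \in H -> q \in H ->
  active adj (rect m a b c d) H.
Proof.
move=> ab bm cd dm.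
suff dir (x y : cell m) : x \in rect m a b c d -> y \in rect m a b c d -> x \in H -> y \in H ->
   (x.1 == y.1 :> nat) && (y.2 == x.2.+1 :> nat)
   || (x.1.+1 == y.1 :> nat) && ((y.2 == x.2 :> nat) || (y.2.+1 == x.2 :> nat)) ->
   active adj (rect m a b c d) H.
  move=> pR qR pq pH qH.
  have [h|h] := boolP ((p.1 == q.1 :> nat) && (q.2 == p.2.+1 :> nat)
   || (p.1.+1 == q.1 :> nat) && ((q.2 == p.2 :> nat) || (q.2.+1 == p.2 :> nat))).
    exact: dir pR qR pH qH h.
  by apply: (dir _ _ qR pR qH pH); move: pq h; rewrite hexadjE; lia.
move=> xR yR xH yH h.
have [r [rR r1]] : exists r, [/\ r \in rect m a b c d & tri adj x y r].
  have [i [j [il jl hij]]] : exists i j, [/\ a <= i < b, c <= j < d &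
    [\/ [/\ (x.1 == y.1 :> nat) && (y.2 == x.2.+1 :> nat) &
            ((i == x.1.+1) && (j == x.2)) || ((i.+1 == x.1) && (j == x.2.+1))],
        [/\ (x.1.+1 == y.1 :> nat) && (y.2 == x.2 :> nat) &
            ((i == x.1) && (j == x.2.+1)) || ((i == x.1.+1) && (j.+1 == x.2))] |
        [/\ (x.1.+1 == y.1 :> nat) && (y.2.+1 == x.2 :> nat) &
            (i == x.1) && (j.+1 == x.2)]]].
    move: xR yR; rewrite !inE => xR yR.
    case/orP: h => [h|/andP [h1 /orP [h2|h2]]].
    - have [lt|ge] := ltnP x.1.+1 b.
        by exists x.1.+1, x.2; split; [lia|lia|constructor 1; split; lia].
      by exists x.1.-1, x.2.+1; split; [lia|lia|constructor 1; split; lia].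
    - have [lt|ge] := ltnP x.2.+1 d.
        by exists x.1, x.2.+1; split; [lia|lia|constructor 2; split; lia].
      by exists x.1.+1, x.2.-1; split; [lia|lia|constructor 2; split; lia].
    by exists x.1, x.2.-1; split; [lia|lia|constructor 3; split; lia].
  have [r [r1 r2]] := @cell_at m i j ltac:(lia) ltac:(lia).
  exists r; rewrite !inE r1 r2; split; first by lia.
  by rewrite /tri !hexadjE r1 r2; case: hij => [] [h1 h2]; lia.
by apply/activeP; exists x, y, r.
Qed.

Lemma card_box22 (u w : nat) : #|box u u.+2 w w.+2| <= 4.
Proof.
rewrite -(card_ord 4); pose code (v : index) := inord (2 * (v.1 - u) + (v.2 - w)) : 'I_4.
have small a b : u <= a < u.+2 -> w <= b < w.+2 -> 2 * (a - u) + (b - w) < 4.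
  by clear; lia.
have inj a b a' b' : u <= a < u.+2 -> w <= b < w.+2 -> u <= a' < u.+2 -> w <= b' < w.+2 ->
    2 * (a - u) + (b - w) = 2 * (a' - u) + (b' - w) -> (a == a') && (b == b').
  by clear; lia.
rewrite -(card_in_imset (f := code)) ?max_card // => v v'.
rewrite !inE => /andP [v1 v2] /andP [v1' v2'] /(congr1 (@nat_of_ord _)).
rewrite /code !inordK ?small // => e; apply/eqP; rewrite index_eq; exact: inj.
Qed.

Lemma hexadj_near p q : adj p q ->
  [/\ p.1 <= q.1.+1, q.1 <= p.1.+1, p.2 <= q.2.+1 & q.2 <= p.2.+1].
Proof. by clear; rewrite hexadjE => h; split; lia. Qed.

(** Two adjacent cells may belong to different blocks, but a window of 2 by 2 blocks contains both;
    inside it the holes are rearranged so that one block becomes active. *)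
Lemma focus p q H : 1 < l -> adj p q -> p \in H -> q \in H ->
  exists s v, realize adj setT (4 * (B * B))`! H s /\ active adj (block v) (mv s H).
Proof.
move=> l1 pq pH qH.
have near (i j : 'I_m) : i <= j.+1 -> i %/ B <= (j %/ B).+1.
  move=> ij; have : i <= j + B by apply: leq_trans ij _; rewrite -addn1 leq_add2l.
  by move=> /(leq_div2r B); rewrite divnDr ?dvdnn // divnn B0 addn1.
have window (i j : 'I_m) : i <= j.+1 -> j <= i.+1 ->
    exists2 u, u.+2 <= l & (u <= i %/ B < u.+2) && (u <= j %/ B < u.+2).
  move=> /near + /near; move: (block_subproof i) (block_subproof j).
  move: (i %/ B) (j %/ B) l1; clear => a b l1 al bl ab ba.
  by exists (minn (minn a b) (l - 2)); lia.
have [a1 a2 a3 a4] := hexadj_near pq.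
have [u0 ul uw] := window _ _ a1 a2; have [w0 wl ww] := window _ _ a3 a4.
pose A := box u0 u0.+2 w0 w0.+2.
have [pA qA] : p \in blocks A /\ q \in blocks A.
  by rewrite !inE /=; case/andP: uw => -> ->; case/andP: ww => -> ->.
have aA : active adj (blocks A) H.
  move: pA qA; rewrite /A blocks_rect => pA qA.
  by apply: rect_active pA qA pq pH qH; rewrite ?mE; nia.
have U : hole_connected adj (blocks A) by apply: box_connected; lia.
pose v := block_of p.
have vA : v \in A by move: pA; rewrite inE.
have [x [y [z [t xv yv zv]]]] := block_edge v.
have [xy _ _] := tri_neq (@hexadj_irr m) t.
have bA := block_sub vA.
have [|||K [xyK KA cK]] := @subset_between _ [set x; y] (blocks A) #|H :&: blocks A|.
- by apply/subsetP => c; rewrite in_set2 => /orP [] /eqP ->; apply: (subsetP bA).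
- by rewrite cards2 xy; apply: active_card aA; apply: hexadj_irr.
- exact/subset_leq_card/subsetIr.
have [xK yK] : x \in K /\ y \in K by split; apply: (subsetP xyK); rewrite !inE eqxx ?orbT.
have aK : active adj (block v) K by apply/activeP; exists x, y, z.
have [|||s fs sK] := U (H :&: blocks A) K _ KA _ _ (esym cK).
- exact: subsetIr.
- by apply: active_ext aA; rewrite -setIA setIid.
- by apply: active_sub aK => //; apply: subsetIl.
exists s, v; split.
  have fsH : feasible adj setT H s.
    by apply: feasible_sub fs; [exact: subsetT | rewrite -setIA setIid subsetIl].
  apply: (realize_sub (subsetT (blocks A)) (subsetIl H _)).
  apply: feasible_bound; last by apply: feasible_sub fs => //; rewrite -setIA setIid subsetIl.
  rewrite card_blocks leq_mul2r; apply/orP; right.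
  exact: card_box22.
apply: active_sub aK => //; rewrite -sK; apply/subsetP => c; rewrite !inE.
by case/andP => /andP [].
Qed.

End Blocks.

(** * Permutation routing on a mesh *)

Section Hall.
Variables A A' : finType.
Implicit Types (N : A -> {set A'}) (S : {set A}).

Definition nbhd N S := \bigcup_(a in S) N a.

Lemma nbhdU1 N a S : nbhd N (a |: S) = N a :|: nbhd N S.
Proof. by rewrite /nbhd bigcup_setU big_set1. Qed.

Lemma nbhd_sub N S S' : S \subset S' -> nbhd N S \subset nbhd N S'.
Proof.
move=> /subsetP sub; apply/bigcupsP => a aS; apply: (bigcup_max a) => //; exact: sub.
Qed.

(* An inclusion-minimal Hall family consists of singletons: if x and y lie in *)
(* N a, then by submodularity x or y can be deleted from N a.                 *)
Theorem hall_marriage N : (forall S, #|S| <= #|nbhd N S|) ->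
  exists2 f : A -> A', injective f & forall a, f a \in N a.
Proof.
move: {2}_.+1 (ltnSn (\sum_a #|N a|)) => n; elim: n N => // n IH N lt hall.
have [a big|small] := pickP [pred a | 1 < #|N a|]; last first.
  have one a : #|N a| = 1.
    apply/eqP; rewrite eqn_leq; have := small a; rewrite /= ltnNge => /negbFE ->.
    by have := hall [set a]; rewrite /nbhd cards1 big_set1.
  have pk a : exists x, N a == [set x] by have /eqP/cards1P [x ->] := one a; exists x.
  pose f a := xchoose (pk a); have fE a : N a = [set f a] by apply/eqP/(xchooseP (pk a)).
  exists f; last by move=> a; rewrite fE set11.
  move=> a b e; apply/eqP; apply: contraT => ab.
  by have := hall (a |: [set b]); rewrite nbhdU1 /nbhd big_set1 !fE e setUid cards1 cards2 ab.
have {big} /card_gt1P [x [y [xa ya xy]]] := big.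
pose del z b := if b == a then N a :\ z else N b.
have dela z : del z a = N a :\ z by rewrite /del eqxx.
have delN z (S : {set A}) : a \notin S -> nbhd (del z) S = nbhd N S.
  move=> aS; apply: eq_bigr => b bS; rewrite /del.
  by case: eqP => // e; rewrite -e bS in aS.
have use z : z \in N a -> (forall S, #|S| <= #|nbhd (del z) S|) ->
    exists2 f : A -> A', injective f & forall a, f a \in N a.
  move=> za hz; have [|f fI fd] := IH (del z) _ hz.
    rewrite -ltnS; apply: leq_trans lt; rewrite ltnS.
    have -> : \sum_b #|N b| = #|N a| + \sum_(b | b != a) #|N b| by rewrite (bigD1 a).
    rewrite (bigD1 a) //= dela (cardsD1 z (N a)) za -addnA add1n ltnS.
    rewrite leq_add2l leq_eqVlt; apply/orP; left; apply/eqP/eq_bigr => b /negPf ba.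
    by rewrite /del ba.
  exists f => // b; move: (fd b); rewrite /del; case: eqP => // ->.
  by rewrite inE => /andP [].
have violated z : z \in N a -> (exists f : A -> A', injective f /\ forall a, f a \in N a) \/
    exists S, a \notin S /\ #|nbhd (del z) (a |: S)| <= #|S|.
  move=> za; case: (pickP [pred S : {set A} | #|nbhd (del z) S| < #|S|]) => [S /= lS|ok]; last first.
    left; have [|f fI fN] := use z za; last by exists f.
    by move=> S; have := ok S; rewrite /= ltnNge => /negbFE.
  have aS : a \in S.
    by apply: contraLR lS => aS; rewrite -leqNgt delN.
  right; exists (S :\ a); rewrite !inE eqxx setD1K //; split => //.
  by move: lS; rewrite (cardsD1 a S) aS add1n ltnS.
case: (violated x xa) => [[f [fI fN]]|[S1 [aS1 c1]]]; first by exists f.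
case: (violated y ya) => [[f [fI fN]]|[S2 [aS2 c2]]]; first by exists f.
rewrite !nbhdU1 !dela !delN // in c1 c2.
set M1 := _ :|: _ in c1; set M2 := _ :|: _ in c2.
have le1 : #|S1 :|: S2|.+1 <= #|M1 :|: M2|.
  have -> : #|S1 :|: S2|.+1 = #|a |: (S1 :|: S2)| by rewrite cardsU1 inE negb_or aS1 aS2.
  apply: leq_trans (hall _) _; apply: subset_leq_card.
  rewrite nbhdU1 /nbhd bigcup_setU; apply/subsetP => z; rewrite !inE.
  case/or3P => [za|z1|z2]; last by rewrite /nbhd z2 !orbT.
    by rewrite za !andbT; case: (eqVneq z x) => [->|//]; rewrite xy !orbT.
  by rewrite /nbhd z1 !orbT.
have le2 : #|S1 :&: S2| <= #|M1 :&: M2|.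
  apply: leq_trans (hall _) _; apply: subset_leq_card; rewrite subsetI.
  apply/andP; split; apply: subset_trans (subsetUr _ _); apply: nbhd_sub.
    exact: subsetIl.
  exact: subsetIr.
have := cardsUI M1 M2; have := cardsUI S1 S2; lia.
Qed.
End Hall.

(** * Edge colouring of regular bipartite multigraphs *)

Section EdgeColouring.
Variables (A X : finType) (src dst : X -> A).

(** König's theorem: a regular bipartite multigraph has a perfect matching by Hall; give it one
    colour, remove it, and continue with degree one less. *)
Lemma regular_edge_colouring d (E : {set X}) :
  (forall a, #|[set x in E | src x == a]| = d) ->
  (forall a, #|[set x in E | dst x == a]| = d) ->
  exists k : X -> nat, (forall x, x \in E -> k x < d) /\
    (forall x y, x \in E -> y \in E -> k x = k y ->
       (src x = src y -> x = y) /\ (dst x = dst y -> x = y)).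
Proof.
have count (f : X -> A) (S : {set A}) e (F : {set X}) :
    (forall a, #|[set x in F | f x == a]| = e) -> #|[set x in F | f x \in S]| = #|S| * e.
  move=> h; rewrite -sum1_card (partition_big f (mem S)) /=; last first.
    by move=> x; rewrite inE => /andP [].
  rewrite -sum_nat_const; apply: eq_bigr => a aS; rewrite -[RHS](h a) -sum1_card.
  apply: eq_bigl => x; rewrite !inE -andbA; congr (_ && _).
  by case: eqP => [->|]; rewrite ?aS ?andbF.
elim: d E => [|d IH] E sE dE.
  have none x : (x \in E) = false.
    have /eqP := sE (src x); rewrite cards_eq0 => /eqP/setP/(_ x).
    by rewrite !inE eqxx andbT.
  by exists (fun=> 0); split=> [x|x y]; rewrite none.
pose N a := [set dst x | x in [set x in E | src x == a]].
have [S|f fI fN] := @hall_marriage _ _ N.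
  (* Hall's condition by double counting: every edge leaving [S] enters its neighbourhood, and all
     degrees are [d.+1]. *)
  rewrite -(leq_pmul2r (ltn0Sn d)) -(count src _ _ _ sE) -(count dst _ _ _ dE).
  apply/subset_leq_card/subsetP => x; rewrite !inE => /andP [xE xS]; rewrite xE /=.
  apply/bigcupP; exists (src x) => //; apply/imsetP; exists x => //.
  by rewrite inE xE eqxx.
have /fin_all_exists [e eP] : forall a, exists x, [/\ x \in E, src x = a & dst x = f a].
  by move=> a; have /imsetP [x] := fN a; rewrite inE => /andP [xE /eqP sx] ->; exists x.
pose M := e @: [set: A].
have inM x : x \in M -> x = e (src x).
  by case/imsetP => a _ ->; have [_ -> _] := eP a.
have eI : injective e by move=> a b h; have [_ <- _] := eP a; have [_ <- _] := eP b; rewrite h.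
have eM a : e a \in M by apply: imset_f.
have [||k [kd kP]] := IH (E :\: M).
- move=> a; apply: succn_inj; rewrite -(sE a) [in RHS](cardsD1 (e a)).
  have [eE es _] := eP a; rewrite inE eE es eqxx add1n; congr _.+1.
  apply: eq_card => x; rewrite !inE; case: (eqVneq (src x) a) => [e1|]; rewrite ?andbF //.
  rewrite !andbT; congr (~~ _ && _); apply/idP/eqP => [/inM ->|->//]; by rewrite e1.
- move=> a'; have [a ->] : exists a, a' = f a.
    by have /codomP [a ->] := injF_onto fI a'; exists a.
  apply: succn_inj; rewrite -(dE (f a)) [in RHS](cardsD1 (e a)).
  have [eE _ ed] := eP a; rewrite inE eE ed eqxx add1n; congr _.+1.
  apply: eq_card => x; rewrite !inE; case: (eqVneq (dst x) (f a)) => [e1|]; rewrite ?andbF //.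
  rewrite !andbT; congr (~~ _ && _); apply/idP/eqP => [xM|-> //].
  move: (xM) => /imsetP [b _ xe]; rewrite xe in e1 *; congr e; apply: fI.
  by have [_ _ <-] := eP b.
exists (fun x => if x \in M then d else k x); split.
  move=> x xE; case: ifP => // xM; apply: ltnW; apply: kd; by rewrite inE xM xE.
move=> x y xE yE; case: ifP => xM; case: ifP => yM.
- move=> _; split; first by rewrite {2}(inM x xM) {2}(inM y yM) => ->.
  rewrite (inM x xM) (inM y yM); have [_ _ ->] := eP (src x).
  by have [_ _ ->] := eP (src y); move/fI ->.
- by move=> h; have := kd y; rewrite inE yM yE -h ltnn => /(_ isT).
- by move=> h; have := kd x; rewrite inE xM xE h ltnn => /(_ isT).
by apply: kP; rewrite inE ?xM ?yM.
Qed.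
End EdgeColouring.

Lemma perm_of_inj (T : finType) (f : T -> T) : injective f ->
  exists s : {perm T}, forall x, s x = f x.
Proof. by move=> fI; exists (perm fI) => x; rewrite permE. Qed.

(* Colour the multigraph with an edge from the row of x to the row of s x for  *)
(* every x: the colour of x is the column in which x changes its row.         *)
Lemma perm_row_col_row (A B : finType) (s : {perm A * B}) :
  exists u v w : {perm A * B}, [/\ s = (u * v * w)%g,
    forall x, (u x).1 = x.1, forall x, (v x).2 = x.2 & forall x, (w x).1 = x.1].
Proof.
have [||k [kB kP]] := @regular_edge_colouring A _ (fun x => x.1) (fun x => (s x).1) #|B| [set: A * B].
- move=> a; rewrite -[RHS]mul1n -(cards1 a) -cardsT -cardsX.
  by apply: eq_card => x; rewrite !inE andbT.
- move=> a; rewrite -[RHS]mul1n -(cards1 a) -cardsT -cardsX.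
  rewrite -[RHS](card_preimset _ (@perm_inj _ s)).
  by apply: eq_card => x; rewrite !inE andbT.
pose col x : B := enum_val (Ordinal (kB x (in_setT x))).
have colI x y : col x = col y -> k x = k y by move/enum_val_inj/(congr1 val).
have uI : injective (fun x : A * B => (x.1, col x)).
  by move=> x y [e /colI ke]; have [h _] := kP x y (in_setT _) (in_setT _) ke; apply: h.
have tI : injective (fun x : A * B => ((s x).1, col x)).
  by move=> x y [e /colI ke]; have [_ h] := kP x y (in_setT _) (in_setT _) ke; apply: h.
have [u uE] := perm_of_inj uI; have [t tE] := perm_of_inj tI.
exists u, (u^-1 * t)%g, (t^-1 * s)%g; split.
- by rewrite mulKVg mulKVg.
- by move=> x; rewrite uE.
- by move=> x; rewrite permM tE /= -{2}[x](permKV u) uE.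
by move=> x; rewrite permM -{2}[x](permKV t) tE.
Qed.

(** * Sorting on a line *)

Section LineSort.
Variable l : nat.
Implicit Types (i j : 'I_l) (s : {perm 'I_l}).

(* In round r, the positions i with the same (i + odd r)./2 are compared.      *)
Definition matched (r : nat) (s : {perm 'I_l}) :=
  forall i, (s i + odd r)./2 = (i + odd r)./2.

Definition tail_count s v q := #|[set i : 'I_l | (q <= i) && (v <= s i)]|.

Lemma compare_exchange r s : exists m : {perm 'I_l}, matched r m /\
  forall i j, j = i.+1 :> nat -> (i + odd r)./2 = (j + odd r)./2 ->
    maxn (s i) (s j) = (m * s)%g j.
Proof.
pose partner i : nat := if odd (i + odd r) then i.-1 else i.+1.
(* The default value makes an end position whose partner would fall off the line its own partner. *)
pose par i : 'I_l := insubd i (partner i).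
have parE i : par i = (if partner i < l then partner i else i) :> nat.
  by rewrite /par val_insubd.
have parK : involutive par.
  move=> i; apply: val_inj; rewrite /= parE /partner; move: (parE i).
  rewrite /partner; have := ltn_ord i.
  case: (odd r) => /=; do !case: ifP; lia.
have par2 i : (par i + odd r)./2 = (i + odd r)./2.
  rewrite parE /partner; case: (odd r) => /=; do !case: ifP; lia.
pose bad i := (i < par i) && (s (par i) < s i) || (par i < i) && (s i < s (par i)).
have badP i : bad (par i) = bad i by rewrite /bad parK orbC.
pose f i := if bad i then par i else i.
have fK : involutive f.
  by move=> i; rewrite /f; case: (boolP (bad i)) => b; rewrite ?badP ?b ?parK // (negPf b).
exists (perm (inv_inj fK)); split.
  by move=> i; rewrite permE /f; case: ifP => // _; apply: par2.
move=> i j ij e; rewrite permM permE /f.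
have pj : par j = i.
  apply: val_inj; rewrite /= parE /partner; move: e; rewrite ij; have := ltn_ord i.
  by case: (odd r) => /=; do !case: ifP; lia.
have -> : bad j = (s j < s i).
  by rewrite /bad pj; clear -ij; lia.
by rewrite maxnC /maxn pj; case: ifP.
Qed.

Lemma tail_countS s v i : tail_count s v i = (v <= s i) + tail_count s v i.+1.
Proof.
rewrite /tail_count (cardsD1 i) inE leqnn /=; congr (_ + _).
apply: eq_card => j; rewrite !inE -val_eqE /=; lia.
Qed.

Lemma tail_count_perm s v : v <= l -> tail_count s v 0 = l - v.
Proof.
move=> vl; rewrite /tail_count.
have -> : [set i : 'I_l | (0 <= i) && (v <= s i)] = s @^-1: [set i : 'I_l | v <= i].
  by apply/setP => i; rewrite !inE.
rewrite card_preimset; last exact: perm_inj.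
rewrite -(card_ord_interval v (leqnn l)).
by apply: eq_card => i; rewrite !inE ltn_ord andbT.
Qed.

(** When [q + r] is even, no pair compared in round [r] straddles the cut before position [q]. *)
Lemma tail_count_matched r s m v q : matched r m -> ~~ odd (q + r) ->
  tail_count (m * s) v q = tail_count s v q.
Proof.
move=> mm even; rewrite /tail_count.
have -> : [set i : 'I_l | (q <= i) && (v <= (m * s)%g i)] = m @^-1: [set i : 'I_l | (q <= i) && (v <= s i)].
  apply/setP => i; rewrite !inE permM; congr (_ && _).
  have := mm i; move: even; case: (odd r) (oddD q r) => -> /=; lia.
by rewrite card_preimset //; apply: perm_inj.
Qed.

(* Odd-even transposition sort: for every threshold v, the number of entries  *)
(* >= v at positions >= q grows at least as fast as for the worst 0-1 input.  *)
Lemma odd_even_sort s : exists f : nat -> {perm 'I_l},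
  (forall r, matched r (f r)) /\ s = (\prod_(r < l.+1) f r)%g.
Proof.
have [ex exP] : exists ex : nat -> {perm 'I_l} -> {perm 'I_l}, forall r x,
   matched r (ex r x) /\ forall i j, j = i.+1 :> nat ->
    (i + odd r)./2 = (j + odd r)./2 -> maxn (x i) (x j) = (ex r x * x)%g j.
  have /choice [g gP] : forall rx : nat * {perm 'I_l}, exists m, matched rx.1 m /\
    forall i j, j = i.+1 :> nat -> (i + odd rx.1)./2 = (j + odd rx.1)./2 ->
      maxn (rx.2 i) (rx.2 j) = (m * rx.2)%g j.
    by move=> [r x]; apply: compare_exchange.
  by exists (fun r x => g (r, x)) => r x; apply: (gP (r, x)).
pose x := fix x r := if r is r'.+1 then (ex r' (x r') * x r')%g else s.
have matched1 r : matched r (ex r (x r))^-1.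
  by move=> i; have [h _] := exP r (x r); rewrite -{2}[i](permKV (ex r (x r))) h.
exists (fun r => (ex r (x r))^-1)%g; split => //.
have prodE r : s = ((\prod_(i < r) (ex i (x i))^-1) * x r)%g.
  elim: r => [|r IH]; first by rewrite big_ord0 mul1g.
  by rewrite big_ord_recr /= -mulgA mulKg.
rewrite {1}(prodE l.+1); suff -> : x l.+1 = 1%g by rewrite mulg1.
(* The term [odd (l - v)] makes the two sides differ in parity when the cut [q] is idle in the last
   round, so an idle round costs nothing. For [t = l.+1], [q = v] and [k = l - v] the inequality
   reads [odd (l - v) <= 1]. *)
have bound t : forall v q k, v <= l -> q <= l -> k <= l - v -> k <= l - q ->
    2 * k + q + odd (l - v) <= t + (l - v) -> k <= tail_count (x t) v q.
  elim: t => [|t IH] v q k vl ql kv kq h.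
    have low q' : q' <= l -> l - v - q' <= tail_count s v q'.
      elim: q' => [|q' IHq] q'l; first by rewrite subn0 tail_count_perm.
      have := IHq (ltnW q'l); rewrite (tail_countS _ _ (Ordinal q'l)) /=.
      by case: (v <= s _); lia.
    by apply: leq_trans (low q ql); lia.
  have [mt cmp] := exP t (x t).
  have [par|par] := boolP (odd (q + t)); last first.
    rewrite [x t.+1]/(ex t (x t) * x t)%g (tail_count_matched _ _ mt par); apply: IH => //.
    have : odd (l - v) = (l - v) %% 2 :> nat by rewrite modn2.
    move: par; rewrite oddD; lia.
  have [->//|kpos] := posnP k.
  have [q0|qpos] := posnP q.
    by rewrite q0 tail_count_perm.
  have [qe|qlt] : q = l \/ q < l by lia.
    by move: kq; rewrite qe subnn leqn0 => /eqP ->.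
  have ql1 : q.-1 < l by lia.
  have e : (Ordinal ql1 + odd t)./2 = (Ordinal qlt + odd t)./2.
    by move: par; rewrite oddD /=; case: (odd t) => /=; lia.
  have := cmp (Ordinal ql1) (Ordinal qlt) _ e; rewrite /= prednK // => /(_ erefl) mx.
  have Fa : k <= tail_count (x t) v q.-1 by apply: IH => //; lia.
  have Fb : k.-1 <= tail_count (x t) v q.+1 by apply: IH => //; lia.
  rewrite (tail_countS _ _ (Ordinal qlt)) -mx /=.
  rewrite (@tail_count_matched _ _ _ _ q.+1 mt); last by rewrite addSn /= par.
  (* Position [q] receives the larger of two compared entries. If it is [>= v], it adds one to the
     [k.-1] entries beyond; if both are below [v], the [k] entries counted from [q.-1] all lie
     beyond [q]. *)
  move: Fa; rewrite (tail_countS _ _ (Ordinal ql1)) /= prednK // (tail_countS _ _ (Ordinal qlt)) /=.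
  by rewrite leq_max; case: (v <= _); case: (v <= _) => /=; lia.
(* For each threshold the large entries occupy exactly the last positions; over all thresholds this
   forces the identity. *)
have full v : v <= l -> forall i, v <= i = (v <= x l.+1 i).
  move=> vl; pose S1 := [set i : 'I_l | v <= i]; pose S2 := [set i : 'I_l | v <= x l.+1 i].
  have c1 : #|S1| = l - v.
    by rewrite -(tail_count_perm 1 vl); apply: eq_card => i; rewrite !inE perm1.
  have c2 : #|S2| = l - v by rewrite -(tail_count_perm (x l.+1) vl); apply: eq_card => i; rewrite !inE.
  have c3 : l - v <= tail_count (x l.+1) v v.
    by apply: bound => //; case: (odd _) => /=; lia.
  have sub : [set i : 'I_l | (v <= i) && (v <= x l.+1 i)] = S1 :&: S2.
    by apply/setP => i; rewrite !inE.
  have e1 : S1 :&: S2 = S1 by apply/eqP; rewrite eqEcard subsetIl c1 -sub.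
  have e2 : S1 :&: S2 = S2 by apply/eqP; rewrite eqEcard subsetIr c2 -sub.
  by move=> i; have /setP/(_ i) := etrans (esym e1) e2; rewrite !inE.
apply/permP => i; rewrite perm1; apply/val_inj/eqP; rewrite eqn_leq.
have h1 := full i (ltnW (ltn_ord i)) i; have h2 := full (x l.+1 i) (ltnW (ltn_ord _)) i.
by rewrite h2 leqnn -h1 leqnn.
Qed.

End LineSort.

(** * Routing on a mesh whose nodes hold several items *)

Section MeshRouting.
Variables (l c : nat) (T : finType).
Local Notation X := ('I_l * ('I_l * T))%type.
(** The cost relation is left abstract because the scheme is applied twice, to pieces in the slots
    of blocks and to parcels of holes. *)
Variable reach_in : nat -> {perm X} -> Prop.
Hypothesis reach_in0 : reach_in 0 1%g.
Hypothesis reach_inM : forall j k s t,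
  reach_in j s -> reach_in k t -> reach_in (j + k) (s * t)%g.
Hypothesis reach_vertical : forall (r : nat) (s : {perm X}),
  (forall x, (s x).2 = x.2 /\ ((s x).1 + odd r)./2 = (x.1 + odd r)./2) -> reach_in c s.
Hypothesis reach_horizontal : forall (r : nat) (s : {perm X}),
  (forall x, (s x).1 = x.1 /\ ((s x).2.1 + odd r)./2 = (x.2.1 + odd r)./2) -> reach_in c s.

Lemma reach_in_prod n (F : nat -> {perm X}) : (forall r, reach_in c (F r)) ->
  reach_in (n * c) (\prod_(r < n) F r)%g.
Proof.
move=> h; elim: n => [|n IH]; first by rewrite big_ord0.
by rewrite big_ord_recr mulSnr; apply: reach_inM.
Qed.

Lemma fibre_perm (A Y : finType) (g : Y -> {perm A}) :
  exists s : {perm A * Y}, forall x, s x = (g x.2 x.1, x.2).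
Proof.
by apply: perm_of_inj => -[a y] [b z] /= [+ e]; rewrite e => /perm_inj ->.
Qed.

Lemma fibre_perm_of (A Y : finType) (s : {perm A * Y}) : (forall x, (s x).2 = x.2) ->
  exists g : Y -> {perm A}, forall x, s x = (g x.2 x.1, x.2).
Proof.
move=> s2; have /fin_all_exists [g gE] : forall y, exists g : {perm A}, forall a,
    g a = (s (a, y)).1.
  move=> y; apply: perm_of_inj => a b e; have : s (a, y) = s (b, y).
    by rewrite [LHS]surjective_pairing [RHS]surjective_pairing !s2 e.
  by move/perm_inj => [].
by exists g => -[a y]; rewrite gE [LHS]surjective_pairing s2.
Qed.

Lemma reach_columns (s : {perm X}) : (forall x, (s x).2 = x.2) -> reach_in (l.+1 * c) s.
Proof.
move=> /fibre_perm_of [g gE].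
have /fin_all_exists [f fP] : forall y, exists f : nat -> {perm 'I_l},
    (forall r, matched r (f r)) /\ g y = (\prod_(r < l.+1) f r)%g.
  by move=> y; apply: odd_even_sort.
have /choice [F FE] : forall r, exists F : {perm X}, forall x, F x = (f x.2 r x.1, x.2).
  by move=> r; have [F FE] := fibre_perm (fun y => f y r); exists F.
have -> : s = (\prod_(r < l.+1) F r)%g.
  apply/permP => -[i y]; rewrite gE /=; have [_ ->] := fP y.
  elim: l.+1 => [|n IH]; first by rewrite !big_ord0 !perm1.
  by rewrite !big_ord_recr /= !permM -IH FE.
apply: reach_in_prod => r; apply: (reach_vertical (r := r)) => x.
by rewrite FE /=; split => //; have [h _] := fP x.2; apply: h.
Qed.

(** Each row is itself a product of nodes and slots. Its three-phase decomposition consists of a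
    sort along the row for each slot, taking [l.+1] rounds, between two reshufflings inside the
    nodes, taking one round each. *)
Lemma reach_rows (s : {perm X}) : (forall x, (s x).1 = x.1) -> reach_in (l.+3 * c) s.
Proof.
move=> s1; have /fin_all_exists [g gE] : forall i, exists g : {perm 'I_l * T}, forall y,
    s (i, y) = (i, g y).
  move=> i; have [|g gE] := @perm_of_inj _ (fun y => (s (i, y)).2).
    move=> y z e; have : s (i, y) = s (i, z).
      by rewrite [LHS]surjective_pairing [RHS]surjective_pairing !s1 e.
    by move/perm_inj => [].
  by exists g => y; rewrite gE [LHS]surjective_pairing s1.
have /fin_all_exists [d dP] : forall i, exists d : {perm 'I_l * T} * {perm 'I_l * T} * {perm 'I_l * T},
   [/\ g i = (d.1.1 * d.1.2 * d.2)%g, forall x, (d.1.1 x).1 = x.1,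
     forall x, (d.1.2 x).2 = x.2 & forall x, (d.2 x).1 = x.1].
  by move=> i; have [u [v [w h]]] := perm_row_col_row (g i); exists (u, v, w).
have lift (h : 'I_l -> {perm 'I_l * T}) : exists s : {perm X}, forall x, s x = (x.1, h x.1 x.2).
  apply: perm_of_inj => -[i y] [j z] /= [e]; rewrite e => e2; congr pair.
  exact: perm_inj e2.
have [u uE] := lift (fun i => (d i).1.1); have [v vE] := lift (fun i => (d i).1.2).
have [w wE] := lift (fun i => (d i).2).
have -> : s = (u * v * w)%g.
  apply/permP => -[i y]; rewrite gE !permM uE vE wE /=.
  by have [-> _ _ _] := dP i; rewrite !permM.
have local (t : {perm X}) : (forall x, (t x).1 = x.1 /\ (t x).2.1 = x.2.1) -> reach_in c t.
  by move=> h; apply: (reach_horizontal (r := 0)) => x; have [-> ->] := h x.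
have ru : reach_in c u.
  by apply: local => x; rewrite uE /=; have [_ -> _ _] := dP x.1.
have rw : reach_in c w.
  by apply: local => x; rewrite wE /=; have [_ _ _ ->] := dP x.1.
suff rv : reach_in (l.+1 * c) v.
  have := reach_inM (reach_inM ru rv) rw.
  by rewrite -mulSn addnC -mulSn.
have /fin_all_exists [h hP] : forall it : 'I_l * T, exists f : nat -> {perm 'I_l},
    (forall r, matched r (f r)) /\
    forall j, (d it.1).1.2 (j, it.2) = ((\prod_(r < l.+1) f r)%g j, it.2).
  move=> [i t]; have [_ _ /fibre_perm_of [e eE] _] := dP i.
  by have [f [fm fE]] := odd_even_sort (e t); exists f; split => // j; rewrite eE fE.
have /choice [F FE] : forall r, exists F : {perm X}, forall x,
    F x = (x.1, (h (x.1, x.2.2) r x.2.1, x.2.2)).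
  move=> r; apply: perm_of_inj => -[i [j t]] [i' [j' t']] /= [e1 e2 e3].
  by move: e2; rewrite e1 e3 => /perm_inj ->.
have -> : v = (\prod_(r < l.+1) F r)%g.
  apply/permP => -[i [j t]]; rewrite vE /=; have [_ /(_ j) /= ->] := hP (i, t).
  elim: l.+1 => [|n IH]; first by rewrite !big_ord0 !perm1.
  by rewrite !big_ord_recr /= !permM -IH FE.
apply: reach_in_prod => r; apply: (reach_horizontal (r := r)) => x.
by rewrite FE /=; split => //; have [k _] := hP (x.1, x.2.2); apply: k.
Qed.

Theorem mesh_routing (s : {perm X}) : reach_in ((3 * l + 7) * c) s.
Proof.
have [u [v [w [-> u1 v2 w1]]]] := perm_row_col_row s.
have := reach_inM (reach_inM (reach_rows u1) (reach_columns v2)) (reach_rows w1).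
by rewrite -!mulnDl (_ : _ + _ = 3 * l + 7) //; lia.
Qed.

End MeshRouting.

(** * Routing parcels of holes and pieces *)

Section MeshRoutingPlain.
Variables (l c : nat).
Local Notation X := ('I_l * 'I_l)%type.
Variable reach_in : nat -> {perm X} -> Prop.
Hypothesis reach_in0 : reach_in 0 1%g.
Hypothesis reach_inM : forall j k s t,
  reach_in j s -> reach_in k t -> reach_in (j + k) (s * t)%g.
Hypothesis reach_vertical : forall (r : nat) (s : {perm X}),
  (forall x, (s x).2 = x.2 /\ ((s x).1 + odd r)./2 = (x.1 + odd r)./2) -> reach_in c s.
Hypothesis reach_horizontal : forall (r : nat) (s : {perm X}),
  (forall x, (s x).1 = x.1 /\ ((s x).2 + odd r)./2 = (x.2 + odd r)./2) -> reach_in c s.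

Lemma mesh_routing_plain (s : {perm X}) : reach_in ((3 * l + 7) * c) s.
Proof.
pose X' := ('I_l * ('I_l * unit))%type.
pose emb (x : X) : X' := (x.1, (x.2, tt)); pose proj (x : X') : X := (x.1, x.2.1).
have embK x : proj (emb x) = x by case: x.
have projK x : emb (proj x) = x by case: x => ? [? []].
have down (t : {perm X'}) : exists s : {perm X}, forall x, s x = proj (t (emb x)).
  apply: perm_of_inj => x y /(congr1 emb); rewrite !projK => /perm_inj /(congr1 proj).
  by rewrite !embK.
have [t tE] : exists t : {perm X'}, forall x, t x = emb (s (proj x)).
  by apply: perm_of_inj => x y /(congr1 proj); rewrite !embK => /perm_inj /(congr1 emb); rewrite !projK.
pose reach' k (t : {perm X'}) := forall s : {perm X}, (forall x, s x = proj (t (emb x))) -> reach_in k s.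
suff R : reach' ((3 * l + 7) * c) t by apply: R => x; rewrite tE !embK.
apply: (@mesh_routing l c unit reach').
- move=> u uE; suff -> : u = 1%g by [].
  by apply/permP => x; rewrite uE !perm1 embK.
- move=> j k a b ha hb u uE; have [a' aE] := down a; have [b' bE] := down b.
  have -> : u = (a' * b')%g by apply/permP => x; rewrite uE !permM bE aE projK.
  by apply: reach_inM; [apply: ha | apply: hb].
- move=> r a aP u uE; apply: (reach_vertical (r := r)) => x; rewrite uE /=.
  by have [-> e] := aP (emb x).
- move=> r a aP u uE; apply: (reach_horizontal (r := r)) => x; rewrite uE /=.
  by have [e e2] := aP (emb x).
Qed.

End MeshRoutingPlain.

(** * The pairs of blocks compared in one round *)

Section Groups.
Variable l : nat.
Local Notation index := ('I_l * 'I_l)%type.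
Implicit Types (v w : index).

(** Each group is a rectangle of one or two blocks, so the results on rectangles apply to it at cost
    [pair_cost]. *)
Definition small_boxes (G : finType) (grp : index -> G) := forall v,
  exists u0 u1 w0 w1 : nat, [/\ [set w | grp w == grp v] = box l u0 u1 w0 w1,
    (u0 < u1) && (u1 <= l), (w0 < w1) && (w1 <= l) & #|[set w | grp w == grp v]| <= 2].

Definition vgrp r v : 'I_l.+1 * 'I_l := (inord ((v.1 + odd r)./2), v.2).
Definition hgrp r v : 'I_l.+1 * 'I_l := (inord ((v.2 + odd r)./2), v.1).

Lemma half_bound (i : 'I_l) r : (i + odd r)./2 < l.+1.
Proof. by have := ltn_ord i; case: (odd r) => /=; lia. Qed.

Lemma inord_half_eq (i j : 'I_l) r :
  (inord ((i + odd r)./2) == inord ((j + odd r)./2) :> 'I_l.+1) =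
  ((i + odd r)./2 == (j + odd r)./2).
Proof. by rewrite -val_eqE /= !inordK ?half_bound. Qed.

Lemma card_two (A : {set index}) (f : index -> bool) : {in A &, injective f} -> #|A| <= 2.
Proof. by move=> fI; rewrite -(card_in_imset fI) -card_bool max_card. Qed.

Lemma vgrp_small r : small_boxes (vgrp r).
Proof.
move=> v; pose g := (v.1 + odd r)./2; have b1 := ltn_ord v.1; have b2 := ltn_ord v.2.
have e : [set w | vgrp r w == vgrp r v] =
    box l (2 * g - odd r) (minn (2 * g + 2 - odd r) l) v.2 v.2.+1.
  apply/setP => w; rewrite !inE /vgrp xpair_eqE inord_half_eq -val_eqE /= /g.
  by have := ltn_ord w.1; case: (odd r) => /=; lia.
exists (2 * g - odd r), (minn (2 * g + 2 - odd r) l), v.2, v.2.+1; split => //.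
- by rewrite /g; case: (odd r) => /=; lia.
- by lia.
apply: (@card_two _ (fun w => odd w.1)) => w w'.
rewrite !inE /vgrp !xpair_eqE !inord_half_eq => /andP [h1 /eqP h2] /andP [h3 /eqP h4] h5.
apply/eqP; rewrite index_eq h2 h4 eqxx andbT; move: h1 h3 h5.
by case: (odd r) => /=; lia.
Qed.

Lemma hgrp_small r : small_boxes (hgrp r).
Proof.
move=> v; pose g := (v.2 + odd r)./2; have b1 := ltn_ord v.1; have b2 := ltn_ord v.2.
have e : [set w | hgrp r w == hgrp r v] =
    box l v.1 v.1.+1 (2 * g - odd r) (minn (2 * g + 2 - odd r) l).
  apply/setP => w; rewrite !inE /hgrp xpair_eqE inord_half_eq -val_eqE /= /g.
  by have := ltn_ord w.2; case: (odd r) => /=; lia.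
exists v.1, v.1.+1, (2 * g - odd r), (minn (2 * g + 2 - odd r) l); split => //.
- by lia.
- by rewrite /g; case: (odd r) => /=; lia.
apply: (@card_two _ (fun w => odd w.2)) => w w'.
rewrite !inE /hgrp !xpair_eqE !inord_half_eq => /andP [h1 /eqP h2] /andP [h3 /eqP h4] h5.
apply/eqP; rewrite index_eq h2 h4 eqxx; move: h1 h3 h5.
by case: (odd r) => /=; lia.
Qed.

End Groups.

Section GroupSteps.
Variables m l B : nat.
Hypotheses (mE : m = l * B) (B3 : 3 < B).
Local Notation adj := (@hexadj m).
Local Notation index := ('I_l * 'I_l)%type.
Local Notation block := (block mE B3).
Local Notation blocks := (blocks mE B3).
Local Notation block_of := (block_of mE B3).
Local Notation nholes := (nholes mE B3).
Implicit Types (p q : cell m) (H K N : {set cell m}) (v w : index) (A : {set index}).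

Section OneStep.
Variables (G : finType) (grp : index -> G).
Hypothesis small : small_boxes grp.
Let A (c : G) := [set w | grp w == c].
Let reg (c : G) := blocks (A c).
Let g p := grp (block_of p).

Let reg_g c p : p \in reg c -> g p = c. Proof. by rewrite !inE => /eqP. Qed.

Let reg_cost c H s : feasible adj (reg c) H s -> (exists v, grp v = c) ->
  realize adj (reg c) (pair_cost B) H s.
Proof.
move=> fs [v gv]; apply: feasible_bound fs; rewrite card_blocks leq_mul2r.
by have [? [? [? [? [_ _ _]]]]] := small v; rewrite gv => ->; rewrite orbT.
Qed.

Let reg_connected v : hole_connected adj (reg (grp v)).
Proof.
have [u0 [u1 [w0 [w1 [e /andP [a b] /andP [c d] _]]]]] := small v.
by rewrite /reg /A e; apply: box_connected.
Qed.

Let reg_labels v : labels_swap adj 5 (reg (grp v)).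
Proof.
have [u0 [u1 [w0 [w1 [e /andP [a b] /andP [c d] _]]]]] := small v.
rewrite /reg /A e blocks_rect; apply: rect_labels_swap; rewrite ?mE; nia.
Qed.

(* A block v with b v carries a parcel of 5 holes on top of its base v holes,  *)
(* and the parcels are what is routed.                                        *)
Definition bits_ok (base : index -> nat) (b : index -> bool) H := forall v,
  nholes H v = base v + 5 * b v /\ (b v -> active adj (block v) H).

(** A group containing a parcel has an active block, so its holes can be redistributed; a group
    without a parcel stays as it is. The capacity bound leaves room for a parcel in any block. *)
Lemma bits_step (base : index -> nat) (b : index -> bool) H (s : {perm index}) :
  (forall v, base v + 5 <= B * B) -> (forall v, grp (s v) = grp v) -> bits_ok base b H ->
  exists t, realize adj setT (pair_cost B) H t /\
    bits_ok base (fun v => b (s^-1%g v)) (mv t H).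
Proof.
move=> cap gs ok.
have gsV v : grp (s^-1%g v) = grp v by rewrite -{2}[v](permKV s) gs.
have /fin_all_exists [f fP] : forall c, exists t, realize adj (reg c) (pair_cost B) H t /\
    forall v, grp v = c -> nholes (mv t H) v = base v + 5 * b (s^-1%g v) /\
      (b (s^-1%g v) -> active adj (block v) (mv t H)).
  move=> c; case: (pickP [pred v | (grp v == c) && b v]) => [v /andP [/eqP gv bv]|none].
    have vA : v \in A c by rewrite inE gv.
    have [|||||t [ft tP]] := @redistribute _ _ _ mE B3 (A c) H
        (fun v => base v + 5 * b (s^-1%g v)).
    - by rewrite -gv; apply: reg_connected.
    - by apply: active_sub (proj2 (ok v) bv); [apply: block_sub | apply: subsetIl].
    - by move=> w _; apply: leq_trans (cap w); rewrite leq_add2l; case: (b _).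
    - rewrite -sum_nholes big_split /= [RHS](eq_bigr (fun w => base w + 5 * b w)); last first.
        by move=> w _; have [] := ok w.
      rewrite [RHS]big_split /=; congr (_ + _); rewrite [LHS](reindex_inj (@perm_inj _ s)) /=.
      by apply: eq_big => [w|w _]; rewrite ?inE ?gs ?permK.
    - by exists (s v); rewrite ?inE ?gs ?gv // permK bv; lia.
    exists t; split; first by apply: reg_cost ft _; exists v.
    move=> w gw; have [|-> h] := tP w; first by rewrite inE gw.
    by split => // bw; apply: h; rewrite bw; lia.
  exists 1%g; rewrite mv1; split; first exact: realize1.
  move=> v gv; have := none (s^-1%g v); rewrite /= gsV gv eqxx /= => bF.
  have := none v; rewrite /= gv eqxx /= => bF'.
  by have [-> _] := ok v; rewrite bF bF'.
have [t [rt _ tE]] := realize_glue reg_g (fun c => subsetT (reg c)) (fun c => (fP c).1).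
exists t; split => // v.
have e : mv t H :&: block v = mv (f (grp v)) H :&: block v.
  have bw : block v = reg (grp v) :&: block v.
    by apply/esym/setIidPr/block_sub; rewrite inE.
  by rewrite bw !setIA tE.
have [_ /(_ v erefl) [n1 a1]] := fP (grp v).
by split; [rewrite /nholes e | move=> /a1; apply: active_ext].
Qed.

(** Every group has five holes and an active block, so [labels_swap_perm] realizes the part of [s]
    inside it; the groups work in parallel. *)
Lemma tokens_step N (s : {perm cell m}) :
  (forall v, active adj (block v) N) -> (forall v, 5 <= nholes N v) ->
  (forall p, p \in N -> s p = p) -> (forall p, g (s p) = g p) ->
  realize adj setT (pair_cost B) N s.
Proof.
move=> aN cN sN gs.
have /fin_all_exists [f fE] : forall c, exists t : {perm cell m}, forall p,
    t p = if g p == c then s p else p.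
  move=> c; apply: perm_of_inj => p q; case: eqP => pc; case: eqP => qc //.
  - exact: perm_inj.
  - by move=> e; case: qc; rewrite -e gs.
  - by move=> e; case: pc; rewrite e gs.
apply: (realize_parallel (f := f) reg_g (fun c => subsetT (reg c))) => [c|p];
  last by rewrite fE eqxx.
 case: (pickP [pred v | grp v == c]) => [v /= /eqP gv|none]; last first.
  suff -> : f c = 1%g by apply: realize1.
  by apply/permP => p; rewrite fE perm1; have := none (block_of p); rewrite /= /g => ->.
apply: reg_cost; last by exists v.
have vA : v \in A c by rewrite inE gv.
apply: (@labels_swap_perm _ adj 5).
- by rewrite -gv; apply: reg_labels.
- by apply: active_sub (aN v); [apply: block_sub | apply: subsetIl].
- by apply: leq_trans (cN v) _; apply/subset_leq_card/setIS/block_sub.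
apply/subsetP => p; rewrite !inE fE -/(g p); case: (g p =P c) => [gp sp|_]; last by rewrite eqxx.
by rewrite andbT; apply: contra sp => pN; rewrite sN.
Qed.

End OneStep.
End GroupSteps.

Lemma perm_extend (T : finType) (A : {set T}) (f : T -> T) :
  {in A &, injective f} -> exists s : {perm T}, {in A, s =1 f}.
Proof.
move=> fI; pose B := f @: A.
have cAB : #|~: A| = #|~: B|.
  by apply: (@addnI #|A|); rewrite cardsC -(cardsC B) card_in_imset.
pose h x := if x \in A then f x else nth x (enum (~: B)) (index x (enum (~: A))).
have lt x : x \notin A -> index x (enum (~: A)) < size (enum (~: B)).
  by move=> xA; rewrite -cardE -cAB cardE index_mem mem_enum inE.
have hB x : (h x \in B) = (x \in A).
  rewrite /h; case: (boolP (x \in A)) => xA; first by rewrite imset_f.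
  by have := mem_nth x (lt x xA); rewrite mem_enum inE => /negbTE.
have hI : injective h.
  move=> x y e; have eA : (x \in A) = (y \in A) by rewrite -!hB e.
  move: e; rewrite /h eA; case: (boolP (y \in A)) => yA; first by apply: fI; rewrite ?eA.
  have xA : x \notin A by rewrite eA.
  rewrite (set_nth_default y x (lt x xA)) => /eqP.
  rewrite nth_uniq ?lt ?enum_uniq // => /eqP.
  by move=> /(congr1 (nth x (enum (~: A)))); rewrite !nth_index ?mem_enum ?inE.
have [s sE] := perm_of_inj hI; exists s => x xA.
by rewrite sE /h xA.
Qed.

Lemma mv_fix_in (T : finType) (N : {set T}) (s : {perm T}) :
  (forall p, p \in N -> s p = p) -> mv s N = N.
Proof.
move=> sN; apply/setP => p; rewrite inE; apply/idP/idP => [h|pN].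
  by move: (sN _ h); rewrite permKV => e; rewrite e.
by rewrite -{1}(sN p pN) permK.
Qed.

(** * Routing pieces around standard holes *)

Section Routing.
Variables m l B : nat.
Hypotheses (mE : m = l * B) (B3 : 3 < B).
Local Notation adj := (@hexadj m).
Local Notation index := ('I_l * 'I_l)%type.
Local Notation block := (block mE B3).
Local Notation block_of := (block_of mE B3).
Local Notation nholes := (nholes mE B3).
Implicit Types (p q : cell m) (H K N : {set cell m}) (v w : index).

(* Five holes per block, the number needed by rect_labels_swap.                *)
Definition standard N := forall v, nholes N v = 5 /\ active adj (block v) N.

Lemma exists_standard : exists N, standard N.
Proof.
have /fin_all_exists [X XP] : forall v, exists K, [/\ K \subset block v, #|K| = 5 &
    active adj (block v) K].
  move=> v; have [|K [KB cK aK]] := @choose_holes _ _ _ mE B3 v 5; first by nia.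
  by exists K; split => //; apply: aK.
exists [set p | p \in X (block_of p)] => v; have [Xv cX aX] := XP v.
have e : [set p | p \in X (block_of p)] :&: block v = X v.
  apply/setP => p; rewrite !inE; have [->|ne] := eqVneq (block_of p) v; rewrite ?andbT // andbF.
  by apply/esym/negbTE; apply: contra ne => /(subsetP Xv); rewrite inE.
split; first by rewrite /nholes e.
by apply: active_ext aX; rewrite e; apply/setIidPl.
Qed.

Variable N : {set cell m}.
Hypothesis stdN : standard N.
Local Notation T := 'I_(B * B - 5).
Local Notation X := ('I_l * ('I_l * T))%type.

Lemma card_slots v : #|block v :\: N| = B * B - 5.
Proof.
by rewrite cardsD card_block setIC; have [] := stdN v; rewrite /nholes => ->.
Qed.

(** Identifies the cells outside [N] with a mesh of blocks holding [B * B - 5] items each. *)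
Definition slot (x : X) : cell m :=
  enum_val (cast_ord (esym (card_slots (x.1, x.2.1))) x.2.2).

Lemma slotP x : slot x \in block (x.1, x.2.1) :\: N.
Proof. exact: enum_valP. Qed.

Lemma block_of_slot x : block_of (slot x) = (x.1, x.2.1).
Proof. by have := slotP x; rewrite !inE => /andP [_ /eqP]. Qed.

Lemma slot_inj : injective slot.
Proof.
move=> [i [j t]] [i' [j' t']] e; have := congr1 block_of e.
rewrite !block_of_slot /= => -[ei ej]; subst i' j'.
by move: e => /enum_val_inj /cast_ord_inj /= ->.
Qed.

Lemma slot_surj p : p \notin N -> exists x, p = slot x.
Proof.
move=> pN; have pv : p \in block (block_of p) :\: N by rewrite !inE pN eqxx.
exists ((block_of p).1, ((block_of p).2, cast_ord (card_slots _) (enum_rank_in pv p))).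
by rewrite /slot cast_ordK enum_rankK_in.
Qed.

Definition lifts (s : {perm X}) (t : {perm cell m}) :=
  (forall p, p \in N -> t p = p) /\ (forall x, t (slot x) = slot (s x)).

Lemma lift_exists s : exists t, lifts s t.
Proof.
pose h p := if [pick x | slot x == p] is Some x then slot (s x) else p.
have hslot x : h (slot x) = slot (s x).
  rewrite /h; case: pickP => [y /eqP /slot_inj -> //|/(_ x)]; by rewrite eqxx.
have hN p : p \in N -> h p = p.
  move=> pN; rewrite /h; case: pickP => // x /eqP e.
  by have := slotP x; rewrite inE e pN.
have hI : injective h.
  have nN x : slot x \in N -> False by have := slotP x; rewrite inE => /andP [/negP].
  move=> p q; case: (boolP (p \in N)) => pN; case: (boolP (q \in N)) => qN.
  - by rewrite !hN.
  - by have [x ->] := slot_surj qN; rewrite hslot hN // => e; move: pN; rewrite e => /nN.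
  - by have [x ->] := slot_surj pN; rewrite hslot hN // => e; move: qN; rewrite -e => /nN.
  have [x ->] := slot_surj pN; have [y ->] := slot_surj qN.
  by rewrite !hslot => /slot_inj /perm_inj ->.
have [t tE] := perm_of_inj hI; exists t.
by split=> [p pN|x]; rewrite tE ?hslot ?hN.
Qed.

(** Seen through [slot], [t] is a permutation of a mesh, and each round of the mesh routing is a
    [tokens_step], which leaves the holes at [N] for the next round. *)
Lemma realize_route (t : {perm cell m}) : (forall p, p \in N -> t p = p) ->
  realize adj setT ((3 * l + 7) * pair_cost B) N t.
Proof.
move=> tN; pose reach_in k s := exists2 t, lifts s t & realize adj setT k N t.
have [s sE] : exists s : {perm X}, forall x, slot (s x) = t (slot x).
  have /fin_all_exists [h hE] : forall x : X, exists y, slot y = t (slot x).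
    move=> x; have [|y ->] := @slot_surj (t (slot x)); last by exists y.
    have := slotP x; rewrite inE => /andP [sx _]; apply: contra sx => h.
    by move: (tN _ h) => /perm_inj <-.
  have hI : injective h by move=> x y e; apply/slot_inj/(@perm_inj _ t); rewrite -!hE e.
  by have [s sE] := perm_of_inj hI; exists s => x; rewrite sE.
have step (G : finType) (grp : index -> G) (u : {perm X}) : small_boxes grp ->
    (forall x, grp ((u x).1, (u x).2.1) = grp (x.1, x.2.1)) -> reach_in (pair_cost B) u.
  move=> small gu; have [w [wN ws]] := lift_exists u; exists w => //.
  apply: (tokens_step small) => //.
  - by move=> v; have [] := stdN v.
  - by move=> v; have [->] := stdN v.
  move=> p; case: (boolP (p \in N)) => [/wN -> //|/slot_surj [x ->]].
  by rewrite ws !block_of_slot.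
have [t' [t'N t's] rt'] : reach_in ((3 * l + 7) * pair_cost B) s.
  apply: mesh_routing.
  - exists 1%g; last exact: realize1.
    by split=> x; rewrite !perm1.
  - move=> j k a b [ta [aN as_] ra] [tb [bN bs] rb]; exists (ta * tb)%g.
      by split=> [p pN|x]; rewrite permM; [rewrite aN ?bN | rewrite as_ bs permM].
    by apply: realize_cat ra _; rewrite mv_fix_in.
  - move=> r u uP; apply: (step _ _ u (vgrp_small r)) => x.
    by have [e1 e2] := uP x; rewrite /vgrp /= e1 e2.
  move=> r u uP; apply: (step _ _ u (hgrp_small r)) => x.
  by have [e1 e2] := uP x; rewrite /hgrp /= e1 e2.
suff -> : t = t' by [].
apply/permP => p; case: (boolP (p \in N)) => [pN|/slot_surj [x ->]]; first by rewrite tN ?t'N.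
by rewrite t's sE.
Qed.

Lemma gather H : (forall v, active adj (block v) H /\ 5 <= nholes H v) ->
  exists s, realize adj setT (B * B)`! H s /\ N \subset mv s H.
Proof.
move=> aH; have /fin_all_exists [f fP] : forall v, exists s,
    realize adj (block v) (B * B)`! H s /\ N :&: block v \subset mv s H.
  move=> v; have [av cv] := aH v; have [cN aN] := stdN v.
  have U : hole_connected adj (block v).
    by rewrite block_rect; apply: rect_hole_connected; rewrite ?block_bound // mulSn; lia.
  have [|||K [NK KB cK]] := @subset_between _ (N :&: block v) (block v) (nholes H v).
  - exact: subsetIr.
  - by move: cN; rewrite /nholes => ->.
  - exact/subset_leq_card/subsetIr.
  have [|||s fs sK] := U (H :&: block v) K _ KB _ _ (esym cK).
  - exact: subsetIr.
  - by apply: active_ext av; rewrite -setIA setIid.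
  - by apply: active_sub aN.
  exists s; split.
    apply: feasible_bound; first by rewrite card_block.
    by apply: feasible_sub fs => //; rewrite -setIA setIid subsetIl.
  apply: subset_trans NK _; rewrite -sK; apply/subsetP => p; rewrite !inE.
  by case/andP.
have gr v p : p \in block v -> block_of p = v by rewrite inE => /eqP.
have [s [rs _ sE]] := realize_glue gr (fun v => subsetT (block v)) (fun v => (fP v).1).
exists s; split => //; apply/subsetP => p pN; have [_ sub] := fP (block_of p).
have pv : p \in block (block_of p) by rewrite inE eqxx.
have : p \in mv (f (block_of p)) H :&: block (block_of p).
  by rewrite inE pv andbT; apply: (subsetP sub); rewrite inE pN.
by rewrite -sE inE => /andP [].
Qed.

End Routing.

Lemma mvC (T : finType) (s : {perm T}) (H : {set T}) : mv s (~: H) = ~: mv s H.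
Proof. by apply/setP => p; rewrite !inE. Qed.

(** * Reaching standard holes from an arbitrary configuration *)

Section Normalization.
Variables m l1 l2 B k1 : nat.
Hypotheses (mE1 : m = l1 * B) (B3 : 3 < B) (mE2 : m = l2 * (B * B)) (D3 : 3 < B * B).
Hypotheses (l1E : l1 = 2 ^ k1) (l1B : l1 = l2 * B) (l1_gt1 : 1 < l1).
Local Notation adj := (@hexadj m).
Local Notation index := ('I_l1 * 'I_l1)%type.
Local Notation superindex := ('I_l2 * 'I_l2)%type.
Implicit Types (p q : cell m) (H N : {set cell m}).

Lemma top_subproof (i : 'I_l2) : i * B < l1.
Proof. by rewrite l1B ltn_mul2r ltn_ord (leq_trans _ B3). Qed.

Definition top_block (V : superindex) : index :=
  (Ordinal (top_subproof V.1), Ordinal (top_subproof V.2)).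

Lemma top_block_inj : injective top_block.
Proof.
have B0 : 0 < B by apply: leq_trans B3.
move=> [i j] [i' j'] [/eqP + /eqP +]; rewrite !eqn_pmul2r // => /eqP ei /eqP ej.
by congr pair; apply: val_inj.
Qed.

Lemma top_block_sub V : block mE1 B3 (top_block V) \subset block mE2 D3 V.
Proof.
rewrite !block_rect; apply/subsetP => p; rewrite !inE /= !mulSn !mulnA.
have : B <= B * B by rewrite leq_pmulr // (leq_trans _ B3).
lia.
Qed.

Lemma sum_nholes_all H : \sum_v nholes mE1 B3 H v = #|H|.
Proof.
rewrite -(setIT H) -[in RHS](_ : blocks mE1 B3 setT = setT); last first.
  by apply/setP => p; rewrite !inE.
by rewrite -sum_nholes setIT; apply: eq_bigl => v; rewrite inE.
Qed.

(** A block with at most four holes contributes at most 4 and any block at most [B * B], so the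
    blocks with five holes number at least [l1 * l1] divided by [B * B]. *)
Lemma count_rich H : 5 * (l1 * l1) <= #|H| ->
  l2 * l2 <= #|[set v | 4 < nholes mE1 B3 H v]|.
Proof.
move=> cH; set R := [set v | _].
have B0 : 0 < B by apply: leq_trans B3.
rewrite -(leq_pmul2r (m := B * B)) ?muln_gt0 ?B0 // mulnACA -l1B.
rewrite -(leq_add2l (4 * (l1 * l1))) -mulSnr; apply: leq_trans cH _.
rewrite -sum_nholes_all.
have -> : 4 * (l1 * l1) = \sum_(v : index) 4 by rewrite sum_nat_const card_prod !card_ord mulnC.
have -> : #|R| * (B * B) = \sum_v (if v \in R then B * B else 0).
  by rewrite -sum_nat_const big_mkcond.
rewrite -big_split /=; apply: leq_sum => v _.
rewrite inE; case: ltnP => h; last by apply: leq_trans h _; apply: leq_addr.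
apply: leq_trans (leq_addl _ _); rewrite -(card_block mE1 B3 v).
exact/subset_leq_card/subsetIr.
Qed.

Definition normalize_cost :=
  (4 * (B * B))`! + 32 * pair_cost B * l1 + (3 * l1 + 7) * pair_cost B + (B * B * (B * B))`!.

(** Once all blocks with two holes are awake, one rich block per superblock is selected, its parcel
    is routed to the first block of that superblock, and [gather] moves the holes onto [N]. *)
Lemma normalize N p q H : standard mE2 D3 N -> adj p q -> p \in H -> q \in H ->
  5 * (l1 * l1) <= #|H| ->
  exists s, realize adj setT normalize_cost H s /\ N \subset mv s H.
Proof.
move=> stdN pq pH qH cH.
have [s1 [v1 [r1 a1]]] := focus mE1 B3 l1_gt1 pq pH qH.
set H1 := mv s1 H in a1.
have all_box v : v \in box l1 0 (0 + 2 ^ k1) 0 (0 + 2 ^ k1).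
  by rewrite inE !add0n -l1E !ltn_ord.
have [||s2 [r2 s2P]] := @wake_up _ _ _ mE1 B3 k1 0 0 H1 _ _
   (ex_intro2 _ _ v1 (all_box v1) a1); rewrite ?add0n -?l1E //.
set H2 := mv s2 H1 in s2P.
have {}r2 := realize_sub (subsetT _) (subsetIl H1 _) r2.
pose b (v : index) := 4 < nholes mE1 B3 H2 v.
pose base v := nholes mE1 B3 H2 v - 5 * b v.
have ok2 : bits_ok mE1 B3 base b H2.
  move=> v; split; first by rewrite /base subnK // /b; case: ltnP.
  by have [n2 a2] := s2P v (all_box v); move=> bv; apply: a2; rewrite -n2; apply: ltn_trans bv.
have cap v : base v + 5 <= B * B.
  have : nholes mE1 B3 H2 v <= B * B.
    by rewrite -(card_block mE1 B3 v); apply/subset_leq_card/subsetIr.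
  have : 16 <= B * B by rewrite (leq_mul B3 B3).
  by rewrite /base /b; case: ltnP; lia.
have cR : #|{: superindex}| <= #|[set v | b v]|.
  rewrite card_prod card_ord; apply: count_rich.
  by rewrite /H2 /H1 !card_mv.
pose e (V : superindex) := enum_val (widen_ord cR (enum_rank V)).
have eb V : b (e V) by have := enum_valP (widen_ord cR (enum_rank V)); rewrite inE.
have eI : injective e.
  by move=> V W /enum_val_inj /(congr1 val) /= h; apply/enum_rank_inj/val_inj.
pose h (w : index) := if [pick V | top_block V == w] is Some V then e V else w.
have hE V : h (top_block V) = e V.
  by rewrite /h; case: pickP => [W /eqP /top_block_inj -> //|/(_ V)]; rewrite eqxx.
(* Here [s] sends each destination to the origin of its parcel, so the routing performs [s^-1]. *)
have [|s sE] := @perm_extend _ (top_block @: setT) h.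
  by move=> x y /imsetP [V _ ->] /imsetP [W _ ->]; rewrite !hE => /eI ->.
pose reach_in k (u : {perm index}) := forall b H, bits_ok mE1 B3 base b H ->
  exists t, realize adj setT k H t /\ bits_ok mE1 B3 base (fun v => b (u^-1%g v)) (mv t H).
have move_bits : reach_in ((3 * l1 + 7) * pair_cost B) s^-1%g.
  apply: mesh_routing_plain.
  - move=> c K ok; exists 1%g; split; first exact: realize1.
    by rewrite mv1 => v; rewrite invg1 perm1; apply: ok.
  - move=> j k u w hu hw c K ok; have [t [rt okt]] := hu _ _ ok.
    have [t' [rt' okt']] := hw _ _ okt; exists (t * t')%g; split.
      exact: realize_cat rt rt'.
    by move=> v; rewrite -mvM invMg permM; apply: okt'.
  - move=> r u uP c K ok; apply: (bits_step (vgrp_small r)) => // v.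
    by have [e1 e2] := uP v; rewrite /vgrp e1 e2.
  move=> r u uP c K ok; apply: (bits_step (hgrp_small r)) => // v.
  by have [e1 e2] := uP v; rewrite /hgrp e1 e2.
have [s3 [r3 ok3]] := move_bits _ _ ok2.
set H3 := mv s3 H2 in ok3.
have top V : nholes mE1 B3 H3 (top_block V) >= 5 /\ active adj (block mE1 B3 (top_block V)) H3.
  have [-> a] := ok3 (top_block V); move: a; rewrite invgK sE ?imset_f // hE eb.
  by move=> /(_ isT) a; split => //; apply: leq_addl.
have [|s4 [r4 N4]] := @gather _ _ _ mE2 D3 N stdN H3.
  move=> V; have [n5 a5] := top V; have sub := top_block_sub V; split.
    by apply: active_sub a5 => //; apply: subsetIl.
  by apply: leq_trans n5 _; apply/subset_leq_card/setIS.
exists (s1 * (s2 * (s3 * s4)))%g; split; last by rewrite -!mvM.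
have := realize_cat r1 (realize_cat r2 (realize_cat r3 r4)).
by rewrite -l1E !addnA.
Qed.

(** The walk is [u], then a routing that fixes [N], then the reverse of [w], where [u] and [w]
    normalize the two ends. The conclusion fixes [t] on the pieces only, since holes carry no
    labels. *)
Lemma connect_holes p q p' q' H H' (s : {perm cell m}) :
  adj p q -> p \in H -> q \in H -> adj p' q' -> p' \in H' -> q' \in H' ->
  5 * (l1 * l1) <= #|H| -> mv s H = H' ->
  exists t : {perm cell m}, (forall x, x \notin H -> t x = s x) /\
    realize adj setT (normalize_cost + ((3 * l2 + 7) * pair_cost (B * B) + normalize_cost)) H t.
Proof.
move=> pq pH qH pq' pH' qH' cH sH.
have [N stdN] := exists_standard mE2 D3.
have [u [ru Nu]] := normalize stdN pq pH qH cH.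
have cH' : 5 * (l1 * l1) <= #|H'| by rewrite -sH card_mv.
have [w [rw Nw]] := normalize stdN pq' pH' qH' cH'.
pose r := (u^-1 * s * w)%g.
have rH : mv r (mv u H) = mv w H' by rewrite -sH !mvM /r -!mulgA mulKVg.
(* Surplus holes outside [N] act as dummy pieces during the routing, and [perm_extend] assigns them
   arbitrary free destinations. *)
pose h x := if x \in N then x else r x.
have [|t tE] := @perm_extend _ (N :|: ~: mv u H) h.
  have out x : x \notin mv u H -> r x \notin N.
    move=> xu; apply/negP => /(subsetP Nw); rewrite -rH mem_mv; exact/negP.
  move=> x y; rewrite !in_setU !in_setC /h => xx yy.
  case: (boolP (x \in N)) xx => xN /= xx; case: (boolP (y \in N)) yy => yN /= yy //.
  - by move=> e; have := out y yy; rewrite -e xN.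
  - by move=> e; have := out x xx; rewrite e yN.
  exact: perm_inj.
have tN x : x \in N -> t x = x by move=> xN; rewrite tE /h ?inE xN.
have rt := realize_mono Nu (realize_route stdN tN).
exists (u * (t * w^-1))%g; split.
  move=> x xH; rewrite !permM; have ux : u x \notin mv u H by rewrite mem_mv.
  have uxN : u x \notin N by apply: contra ux; apply: (subsetP Nu).
  by rewrite tE /h ?(negPf uxN) ?in_setU ?in_setC ?ux ?orbT // /r !permM !permK.
apply: realize_cat ru (realize_cat rt _).
have -> : mv t (mv u H) = mv w H'.
  apply: (can_inj (@setCK _)); rewrite -rH -(mvC t) -(mvC r) (mv_imset t) (mv_imset r); apply: eq_in_imset => x xu.
  rewrite tE ?in_setU ?xu ?orbT // /h; case: (boolP (x \in N)) => // xN.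
  by move: xu; rewrite in_setC => /negP []; apply: (subsetP Nu).
exact: (realize_inv (@hexadj_sym m) (@hexadj_irr m) rw).
Qed.

End Normalization.

(** * Configurations *)

Section GraphDistance.
Variables (T : finType) (e : rel T).

Lemma walkP k x y :
  reflect (exists p : seq T, [/\ size p = k, path e x p & last x p = y]) (walk e k x y).
Proof.
apply: (iffP existsP) => [[p /andP [pp /eqP lp]]|[p [sp pp lp]]].
  by exists p; rewrite size_tuple.
by exists (Tuple (introT eqP sp)); rewrite /= pp lp eqxx.
Qed.

Lemma gdist_le_card x y : gdist e x y <= #|T|.
Proof. by rewrite -[X in _ <= X](size_iota 0); apply: find_size. Qed.

Lemma gdist_le k x y : walk e k x y -> gdist e x y <= k.
Proof.
move=> w; have [lt|ge] := ltnP k #|T|; last exact: leq_trans (gdist_le_card x y) ge.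
rewrite leqNgt; apply/negP => /(before_find 0).
by rewrite nth_iota // add0n w.
Qed.

Lemma gdist_walk x y : connect e x y -> walk e (gdist e x y) x y.
Proof.
move=> /connectP [p pp ->]; case/shortenP: pp => q pq uq _.
have lt : size q < #|T| by rewrite -[(size q).+1]/(size (x :: q)) -(card_uniqP uq) max_card.
have hw : has (fun k => walk e k x (last x q)) (iota 0 #|T|).
  apply/hasP; exists (size q); first by rewrite mem_iota.
  by apply/walkP; exists q.
have := nth_find 0 hw; rewrite nth_iota // -[X in _ < X](size_iota 0).
by rewrite -has_find.
Qed.

Lemma walk_connect k x y : walk e k x y -> connect e x y.
Proof. by case/walkP=> p [_ pp <-]; apply/connectP; exists p. Qed.

End GraphDistance.

Section Configs.
Variables n m : nat.
Local Notation adj := (@hexadj m).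
Implicit Types (x y : config n m) (p q : cell m).

Definition holes x : {set cell m} := [set p | hole x p].

Lemma config_inj x : injective (val x).
Proof. exact/injectiveP/(valP x). Qed.

Lemma holesP x p : reflect (exists i, p = val x i) (p \notin holes x).
Proof. by rewrite inE negbK; apply: codomP. Qed.

Lemma config_image x (s : {perm cell m}) :
  exists y : config n m, forall i, val y i = s (val x i).
Proof.
have inj : injectiveb [ffun i => s (val x i)].
  by apply/injectiveP => i j; rewrite !ffunE => /perm_inj /config_inj.
by exists (exist (fun f : {ffun 'I_n -> cell m} => injectiveb f) _ inj) => i; rewrite /= ffunE.
Qed.

Lemma holes_image x y (s : {perm cell m}) : (forall i, val y i = s (val x i)) ->
  holes y = mv s (holes x).
Proof.
move=> e; apply/setP => p; rewrite [RHS]inE; apply/idP/idP; apply: contraLR.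
  by move=> /holesP [i h]; apply/holesP; exists i; rewrite e -h permKV.
by move=> /holesP [i ->]; apply/holesP; exists i; rewrite e permK.
Qed.

Lemma card_holes x : #|holes x| = m * m - n.
Proof.
have -> : holes x = ~: [set p in codom (val x)] by apply/setP => p; rewrite !inE.
rewrite cardsCs setCK card_prod !card_ord; congr (_ - _).
by rewrite cardsE card_codom ?card_ord //; apply: config_inj.
Qed.

Lemma step_moves_to x y t : step adj setT (holes x) t ->
  (forall i, val y i = t (val x i)) -> moves_to x y.
Proof.
case=> _ [h [h1 h2]] e; have occ i : val x i \notin holes x by apply/holesP; exists i.
apply/existsP; exists [set i | t (val x i) != val x i].
apply/existsP; exists [ffun i => (t (val x i), h (val x i))]; apply/and3P; split.
- apply/forallP => i; apply/implyP; rewrite inE => ti; rewrite ffunE.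
  have [a /setIP [b _] c d f] := h1 _ (occ i) ti.
  by rewrite /usable_pair /= -!(in_set (hole x)) -/(holes x) a b c d f e /holes_of !inE eqxx.
- apply/forallP => i; apply/implyP; rewrite !inE negbK => /eqP ti.
  by rewrite e ti.
apply/forallP => i; apply/implyP; rewrite inE => ti.
apply/forallP => j; apply/implyP; rewrite inE => tj; apply/implyP => ij; rewrite !ffunE.
have xij : val x i != val x j by rewrite (inj_eq (@config_inj x)).
have [n1 n2] := h2 _ _ (occ i) (occ j) ti tj xij.
have [_ n3] := h2 _ _ (occ j) (occ i) tj ti (contra_neq (@esym _ _ _) xij).
rewrite -setI_eq0; apply/eqP/setP => p; rewrite !inE; apply/negbTE.
apply/negP => /andP [/orP [] /eqP -> /orP [] /eqP] /= E.
- by move/perm_inj: E xij => /eqP ->.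
- by rewrite E eqxx in n3.
- by rewrite E eqxx in n2.
by rewrite E eqxx in n1.
Qed.

Lemma realize_walk k x y t : realize adj setT k (holes x) t ->
  (forall i, val y i = t (val x i)) -> walk (@config_adj n m) k x y.
Proof.
elim: k x t => [|k IH] x t /= => [[_ fx] e|[u st re] e].
  have -> : y = x.
    by apply/val_inj/ffunP => i; rewrite e fx //; apply/holesP; exists i.
  by apply/walkP; exists [::].
have [z ze] := config_image x u.
have /walkP [p [sp pp lp]] : walk (@config_adj n m) k z y.
  apply: (IH z (u^-1 * t)%g); first by rewrite (holes_image ze).
  by move=> i; rewrite ze permM permK e.
apply/walkP; exists (z :: p); split => //=; first by rewrite sp.
by rewrite pp andbT /config_adj (step_moves_to st ze).
Qed.

Lemma config_perm x y : exists s : {perm cell m}, forall i, val y i = s (val x i).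
Proof.
pose f p := if [pick i | val x i == p] is Some i then val y i else p.
have fx i : f (val x i) = val y i.
  by rewrite /f; case: pickP => [j /eqP /config_inj -> //|/(_ i)]; rewrite eqxx.
have [|s sE] := @perm_extend _ [set val x i | i : 'I_n] f.
  by move=> p q /imsetP [i _ ->] /imsetP [j _ ->]; rewrite !fx => /config_inj ->.
by exists s => i; rewrite sE ?imset_f // fx.
Qed.

Lemma not_isolatedP x : ~~ all_holes_isolated x ->
  exists p q, [/\ adj p q, p \in holes x & q \in holes x].
Proof.
case/forallPn => p; rewrite negb_imply => /andP [hp]; rewrite /isolated hp /=.
case/forallPn => q; rewrite negb_imply negbK => /andP [hq pq].
by exists p, q; rewrite !inE.
Qed.

Lemma not_isolated x p q : adj p q -> p \in holes x -> q \in holes x ->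
  ~~ all_holes_isolated x.
Proof.
rewrite !inE => pq hp hq; apply/forallPn; exists p; rewrite negb_imply hp /isolated hp /=.
by apply/forallPn; exists q; rewrite negb_imply hq negbK.
Qed.

Lemma moves_to_not_isolated x y : moves_to x y -> x != y ->
  ~~ all_holes_isolated x /\ ~~ all_holes_isolated y.
Proof.
case/existsP=> A /existsP [h /and3P [/forallP mv /forallP st /forallP dj]] xy.
have [i iA] : exists i, i \in A.
  apply/set0Pn; apply: contra xy => /eqP A0; apply/eqP/val_inj/ffunP => i.
  by have := st i; rewrite A0 !inE => /eqP.
have := mv i; rewrite iA /= => /andP [/and5P [h1 h2 h12 xh1 xh2] yi].
split; first by apply: (not_isolated h12); rewrite inE.
have yj j : j \in A -> val y j \in holes_of (h j).
  by move=> jA; have := mv j; rewrite jA /= => /andP [].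
have occx j : ~~ hole x (val x j) by rewrite negbK; apply/codomP; exists j.
have hx j p : j \in A -> p \in holes_of (h j) -> hole x p.
  move=> jA; have := mv j; rewrite jA /= => /andP [/and5P [a b _ _ _] _].
  by rewrite !inE => /orP [] /eqP ->.
have vacated : hole y (val x i).
  apply/codomP => -[j e]; case: (boolP (j \in A)) => jA.
    by have := hx j _ jA (yj j jA); rewrite -e (negPf (occx i)).
  have := st j; rewrite inE jA /= => /eqP ej; rewrite ej in e.
  by move/config_inj: e jA => <-; rewrite iA.
have other p : p \in holes_of (h i) -> p != val y i -> hole y p.
  move=> pi py; apply/codomP => -[j e]; case: (boolP (j \in A)) => jA; last first.
    have := st j; rewrite inE jA /= => /eqP ej.
    by have := hx i p iA pi; rewrite e ej (negPf (occx j)).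
  have [ij|ij] := eqVneq i j; first by rewrite e ij eqxx in py.
  have := dj i; rewrite iA /= => /forallP /(_ j); rewrite jA ij /= => /pred0P /(_ p) /=.
  by rewrite pi e yj.
have n12 : (h i).1 != (h i).2 by apply: contraTneq h12 => ->; rewrite hexadj_irr.
have [e1|ne1] := eqVneq (h i).1 (val y i).
  apply: (not_isolated xh2); rewrite inE //; apply: other; first by rewrite !inE eqxx orbT.
  by rewrite -e1 eq_sym.
by apply: (not_isolated xh1); rewrite inE //; apply: other; rewrite ?inE ?eqxx.
Qed.

Lemma config_adj_sym : symmetric (@config_adj n m).
Proof. by move=> x y; rewrite /config_adj orbC. Qed.

Lemma connect_not_isolated x y : connect (@config_adj n m) x y ->
  ~~ all_holes_isolated x -> ~~ all_holes_isolated y.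
Proof.
case/connectP=> p pp -> {y}; elim: p x pp => [|z p IH] x //= /andP [xz pp] nx.
apply: IH pp _; have [<- //|ne] := eqVneq x z.
case/orP: xz => /moves_to_not_isolated; first by move/(_ ne) => [].
by rewrite eq_sym => /(_ ne) [].
Qed.

(** Removing the other pieces only creates holes, so the move of piece [i] remains legal. *)
Lemma project_adj x y i : config_adj x y ->
  config_adj (single_piece (val x i)) (single_piece (val y i)).
Proof.
have one (a b : config n m) : moves_to a b -> moves_to (single_piece (val a i)) (single_piece (val b i)).
  move=> {x y} /existsP [A /existsP [h /and3P [/forallP mv /forallP st _]]].
  have val1 (c : config n m) j : val (single_piece (val c i)) j = val c i by rewrite ffunE.
  case: (boolP (i \in A)) => iA.
    have := mv i; rewrite iA /= => /andP [/and5P [h1 h2 h3 h4 h5] bi].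
    have hs p : hole a p -> hole (single_piece (m := m) (val a i)) p.
      by apply: contra => /codomP [j ->]; rewrite val1; apply/codomP; exists i.
    apply/existsP; exists setT; apply/existsP; exists [ffun=> h i]; apply/and3P; split.
    - apply/forallP => j; rewrite /usable_pair !ffunE !hs // h3 h4 h5 bi.
      by rewrite implybT.
    - by apply/forallP => j; rewrite !inE.
    by apply/forallP => j; apply/implyP => _; apply/forallP => k; rewrite !ord1 eqxx implybT.
  apply/existsP; exists set0; apply/existsP; exists [ffun=> h i]; apply/and3P; split.
  - by apply/forallP => j; rewrite inE.
  - apply/forallP => j; rewrite !inE /= !ffunE eq_sym.
    by have := st i; rewrite inE iA /= => /eqP ->.
  by apply/forallP => j; rewrite inE.
by rewrite /config_adj => /orP [] /one ->; rewrite ?orbT.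
Qed.

Lemma project_walk k x y i : walk (@config_adj n m) k x y ->
  walk (@config_adj 1 m) k (single_piece (val x i)) (single_piece (val y i)).
Proof.
case/walkP=> p [<- pp <-]; apply/walkP.
pose f (z : config n m) := single_piece (val z i).
exists (map f p); rewrite size_map -/(f x) (last_map f).
split => //; elim: p x pp => //= z p IH x /andP [xz /IH ->].
by rewrite project_adj.
Qed.

End Configs.

Lemma adj_row n m (x y : config n m) i : config_adj x y ->
  (val y i).1 <= (val x i).1.+1 /\ (val x i).1 <= (val y i).1.+1.
Proof.
have one (a b : config n m) : moves_to a b -> (val b i).1 <= (val a i).1.+1 /\ (val a i).1 <= (val b i).1.+1.
  move=> {x y} /existsP [A /existsP [h /and3P [/forallP mv /forallP st _]]].
  case: (boolP (i \in A)) => iA; last first.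
    by have := st i; rewrite inE iA /= => /eqP ->.
  have := mv i; rewrite iA /= => /andP [/and5P [_ _ _ a1 a2]].
  by rewrite !inE => /orP [] /eqP ->; [have [? ?] := hexadj_near a1 | have [? ?] := hexadj_near a2].
by case/orP => /one [].
Qed.

Lemma walk_row n m k (x y : config n m) i : walk (@config_adj n m) k x y ->
  (val y i).1 <= (val x i).1 + k.
Proof.
case/walkP=> p [<- pp <-] {k y}; elim: p x pp => [|z p IH] x /=; first by rewrite addn0.
case/andP => /(adj_row i) [h _] /IH h2; apply: leq_trans h2 _.
by rewrite addnS -addSn leq_add2r.
Qed.

(** Two normalizations and one routing, with [l <= m], [1 <= m] and hence [3 * l + 7 <= 10 * m]. *)
Definition diameter_constant B :=
  2 * ((4 * (B * B))`! + 32 * pair_cost B + 10 * pair_cost B + (B * B * (B * B))`!)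
  + 10 * pair_cost (B * B).

(** * The large component and its diameters *)

Section LargeComponent.
Variables b k n : nat.
Local Notation B := (2 ^ b).
Local Notation m := (2 ^ k).
Hypotheses (b2 : 1 < b) (bk : b + b <= k) (n_gt0 : 0 < n).
Hypothesis many_holes : 5 * (m * m) <= B * B * (m * m - n).
Implicit Types (x y : config n m).

Let l1 := 2 ^ (k - b).
Let l2 := 2 ^ (k - (b + b)).

Let B3 : 3 < B.
Proof. by rewrite (leq_trans _ (leq_pexp2l _ b2)). Qed.

Let mE1 : m = l1 * B. Proof. by rewrite -expnD subnK // (leq_trans _ bk) ?leq_addr. Qed.

Let mE2 : m = l2 * (B * B). Proof. by rewrite -!expnD subnK. Qed.

Let l1B : l1 = l2 * B.
Proof. by rewrite -expnD; congr (2 ^ _); lia. Qed.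

Let l1_gt1 : 1 < l1.
Proof. by rewrite -{1}(expn0 2) ltn_exp2l //; lia. Qed.

Let few_blocks : 5 * (l1 * l1) <= m * m - n.
Proof.
have BB : 0 < B * B by rewrite muln_gt0 expn_gt0.
rewrite -(leq_pmul2l BB); apply: leq_trans many_holes.
by rewrite mE1 (mulnACA l1) mulnCA (mulnC (B * B)).
Qed.

Lemma config_walk x y : ~~ all_holes_isolated x -> ~~ all_holes_isolated y ->
  intrinsic_dist x y <= diameter_constant B * m.
Proof.
move=> /not_isolatedP [p [q [pq pH qH]]] /not_isolatedP [p' [q' [pq' pH' qH']]].
have [s sE] := config_perm x y.
have D3 : 3 < B * B by rewrite (leq_trans B3) // leq_pmulr // expn_gt0.
have [|t [te rt]] := connect_holes mE1 B3 mE2 D3 (erefl l1) l1B l1_gt1 pq pH qH pq' pH' qH'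
   _ (esym (holes_image sE)).
  by rewrite card_holes few_blocks.
have yt i : val y i = t (val x i) by rewrite sE te //; apply/holesP; exists i.
apply: leq_trans (gdist_le (realize_walk rt yt)) _.
have m0 : 0 < m by rewrite expn_gt0.
have lm1 : l1 <= m by rewrite leq_exp2l // leq_subr.
have lm2 : l2 <= m by rewrite leq_exp2l // leq_subr.
rewrite /normalize_cost /diameter_constant; move: lm1 lm2 m0.
move: (4 * _)`! (pair_cost B) (B * B * _)`! (pair_cost (B * B)) => c1 c2 c3 c4.
by move: l1 l2 m => a1 a2 c5; clear; nia.
Qed.

Lemma two_holes_config : exists x (i : 'I_n) (h h' : cell m),
  [/\ h \in holes x, h' \in holes x & h != h'].
Proof.
have nm : n <= #|{: cell m}|.
  rewrite card_prod card_ord; have := few_blocks.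
  have : 0 < l1 by rewrite expn_gt0.
  move: l1 m => a c; nia.
pose f := [ffun i : 'I_n => enum_val (widen_ord nm i)].
have fI : injectiveb f.
  by apply/injectiveP => i j; rewrite !ffunE => /enum_val_inj /(congr1 val) /= /val_inj.
pose x : config n m := exist (fun f : {ffun 'I_n -> cell m} => injectiveb f) f fI.
have /card_gt1P [h [h' [hx hx' hh]]] : 1 < #|holes x|.
  rewrite card_holes; apply: leq_trans few_blocks.
  have : 0 < l1 by rewrite expn_gt0.
  move: l1 => a; nia.
by exists x, (Ordinal n_gt0), h, h'.
Qed.

(** A piece is placed at a corner of the first row with holes on the next two cells of that row.
    Exchanging the contents of this corner with those of a corner of the last row leaves the two
    holes in place. *)
Lemma far_apart : exists x y (i : 'I_n), [/\ ~~ all_holes_isolated x,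
  ~~ all_holes_isolated y, (val x i).1 = 0 :> nat & (val y i).1 = m.-1 :> nat].
Proof.
have [x0 [i [h [h' [hx hx' hh]]]]] := two_holes_config.
have m4 : 4 <= m.
  by apply: leq_trans (leq_pexp2l _ (leq_trans b2 (leq_trans (leq_addr _ _) bk))).
have [a [a1 a2]] := @cell_at m 0 0 ltac:(lia) ltac:(lia).
have [c [c1 c2]] := @cell_at m 0 1 ltac:(lia) ltac:(lia).
have [d [d1 d2]] := @cell_at m 0 2 ltac:(lia) ltac:(lia).
have [z [z1 z2]] := @cell_at m m.-1 0 ltac:(lia) ltac:(lia).
have [ac ad cd] : [/\ a != c, a != d & c != d] by rewrite !cell_eq; split; lia.
have [zc zd] : z != c /\ z != d by rewrite !cell_eq; split; lia.
pose p := val x0 i.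
have occ : p \notin holes x0 by apply/holesP; exists i.
have [ph ph'] : p != h /\ p != h' by split; apply: contraNneq occ => ->.
pose f u := if u == p then a else if u == h then c else d.
have [|s sE] := @perm_extend _ [set p; h; h'] f.
  have fp : f p = a by rewrite /f eqxx.
  have fh : f h = c by rewrite /f eq_sym (negPf ph) eqxx.
  have fh' : f h' = d by rewrite /f !(eq_sym h') (negPf ph') (negPf hh).
  move=> u v; rewrite !inE -!orbA => /or3P [] /eqP -> /or3P [] /eqP ->;
    rewrite ?fp ?fh ?fh' // => /eqP; rewrite ?(negPf ac) ?(negPf ad) ?(negPf cd) //.
  - by rewrite eq_sym (negPf ac).
  - by rewrite eq_sym (negPf ad).
  by rewrite eq_sym (negPf cd).
have [x xE] := config_image x0 s.
have [y yE] := config_image x (tperm a z).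
have [sp sh sh'] : [/\ s p = a, s h = c & s h' = d].
  by rewrite !sE ?inE ?eqxx ?orbT // /f eqxx !(eq_sym _ p) (negPf ph) (negPf ph') eqxx eq_sym (negPf hh).
have [cx dx] : c \in holes x /\ d \in holes x.
  by rewrite (holes_image xE) -sh -sh' !mem_mv.
have [cy dy] : c \in holes y /\ d \in holes y.
  by rewrite (holes_image yE) -(tpermD ac zc) -(tpermD ad zd) !mem_mv.
have cdadj : hexadj c d by rewrite hexadjE c1 c2 d1 d2.
exists x, y, i; split.
- exact: not_isolated cdadj cx dx.
- exact: not_isolated cdadj cy dy.
- by rewrite xE -/p sp.
by rewrite yE xE -/p sp tpermL.
Qed.

Let L : {set config n m} := [set x | ~~ all_holes_isolated x].

Let connected x y : x \in L -> y \in L -> connect (@config_adj n m) x y.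
Proof.
rewrite !inE => /not_isolatedP [p [q [pq pH qH]]] /not_isolatedP [p' [q' [pq' pH' qH']]].
have [s sE] := config_perm x y.
have D3 : 3 < B * B by rewrite (leq_trans B3) // leq_pmulr // expn_gt0.
have [|t [te rt]] := connect_holes mE1 B3 mE2 D3 (erefl l1) l1B l1_gt1 pq pH qH pq' pH' qH'
   _ (esym (holes_image sE)).
  by rewrite card_holes few_blocks.
apply: (walk_connect (realize_walk rt _)) => i.
by rewrite sE te //; apply/holesP; exists i.
Qed.

Lemma large_component_diameters : exists L : {set config n m},
  [/\ unique (@is_large_component n m) L,
      diameter (@intrinsic_dist n m) L <= diameter_constant B * m,
      diameter (@extrinsic_dist n m) L <= diameter (@intrinsic_dist n m) L &
      m.-1 <= diameter (@extrinsic_dist n m) L].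
Proof.
have [x0 [y0 [i [nx ny rx ry]]]] := far_apart.
have xL : x0 \in L by rewrite inE.
have yL : y0 \in L by rewrite inE.
have LE x : x \in L -> L = [set y | connect (@config_adj n m) x y].
  move=> xL'; apply/setP => y; rewrite [RHS]inE; apply/idP/idP; first exact: connected.
  by move/connect_not_isolated; rewrite inE; apply; move: xL'; rewrite inE.
have ext_le x y : x \in L -> y \in L -> extrinsic_dist x y <= intrinsic_dist x y.
  move=> xL' yL'; apply/bigmax_leqP => j _; apply: gdist_le; apply: project_walk.
  exact/gdist_walk/connected.
have diam_ge (d : config n m -> config n m -> nat) x y : x \in L -> y \in L -> d x y <= diameter d L.
  move=> xL' yL'; apply: leq_trans (leq_bigmax_cond _ xL').
  exact: (leq_bigmax_cond _ yL').
exists L; split.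
- split.
    split; first by exists x0; apply: LE.
    by move=> x nix; rewrite inE.
  move=> L' [[x1 L'E] nix]; have := nix x0 nx; rewrite L'E inE => c10.
  rewrite (LE x0 xL); apply/setP => y; rewrite !inE.
  by rewrite -(same_connect (sym_connect_sym (@config_adj_sym n m)) c10).
- apply/bigmax_leqP => x xL'; apply/bigmax_leqP => y yL'.
  by apply: config_walk; [move: xL' | move: yL']; rewrite inE.
- apply/bigmax_leqP => x xL'; apply/bigmax_leqP => y yL'.
  by apply: leq_trans (ext_le x y xL' yL') _; apply: diam_ge.
apply: leq_trans (diam_ge (@extrinsic_dist n m) _ _ xL yL).
apply: leq_trans (leq_bigmax i).
have w := project_walk i (gdist_walk (connected xL yL)).
have := walk_row ord0 (gdist_walk (walk_connect w)).
by rewrite !ffunE ry rx add0n.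
Qed.

End LargeComponent.

(** * Choice of the constants *)

Local Open Scope ring_scope.

Theorem theorem7 (R : realType) (alpha : R)
    (alpha_gt0 : 0 < alpha) (alpha_lt1 : alpha < 1) :
  exists (c C : R) (m0 : nat), 0 < c /\ 0 < C /\
    forall m n : nat,
      (m0 <= m)%N -> (exists k : nat, m = (2 ^ k)%N) ->
      alpha / 2 * m%:R ^+ 2 < n%:R -> n%:R <= alpha * m%:R ^+ 2 ->
      exists L : {set config n m},
        unique (@is_large_component n m) L /\
        c * m%:R <= (diameter (@intrinsic_dist n m) L)%:R <= C * m%:R /\
        c * m%:R <= (diameter (@extrinsic_dist n m) L)%:R <= C * m%:R.
Proof.
have d0 : 0 < 1 - alpha by rewrite subr_gt0.
(* [B = 2 ^ N.+2] exceeds [5 / (1 - alpha)], and the shift by 2 makes the blocks at least 4 cells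
   wide. *)
pose N := Num.bound (5 / (1 - alpha)).
have NP : 5 / (1 - alpha) < N%:R by apply: archi_boundP; rewrite divr_ge0 // ltW.
pose b := N.+2; pose B := (2 ^ b)%N.
have BP : 5 <= (1 - alpha) * (B * B)%:R.
  rewrite mulrC -ler_pdivrMr //; apply: (le_trans (ltW NP)); rewrite ler_nat.
  apply: leq_trans (_ : B <= _)%N; last by rewrite leq_pmulr // expn_gt0.
  apply: leq_trans (ltnW (ltn_expl N (ltnSn 1))) _.
  by rewrite /B leq_exp2l // /b; do 2!apply: leqW.
(* [1 / 2] suffices since [m.-1] is at least half of [m]; the successor makes [C] positive at sight;
   powers of two from [B * B] on split into superblocks. *)
exists (1 / 2), (diameter_constant B).+1%:R, (B * B)%N; split; first by lra.
split; first by rewrite ltr0n.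
move=> m n Bm [k mE] nlo nhi.
have bk : (b + b <= k)%N by move: Bm; rewrite mE /B -expnD leq_exp2l.
have mpos : (0 < m)%N by rewrite mE expn_gt0.
have n0 : (0 < n)%N.
  rewrite -(ltr_nat R); apply: le_lt_trans nlo; apply: mulr_ge0; last exact: sqr_ge0.
  by apply: divr_ge0; lra.
have mm : (m%:R : R) ^+ 2 = (m * m)%:R by rewrite natrM expr2.
have nm : (n <= m * m)%N.
  rewrite -(ler_nat R) -mm; apply: (le_trans nhi).
  by rewrite ler_piMl ?sqr_ge0 // ltW.
have many : (5 * (m * m) <= B * B * (m * m - n))%N.
  rewrite -(ler_nat R) !natrM natrB // -!natrM.
  have h1 : (1 - alpha) * (m * m)%:R <= (m * m)%:R - n%:R by rewrite -mm; lra.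
  have h2 : 5 * (m * m)%:R <= (1 - alpha) * (B * B)%:R * (m * m)%:R.
    by rewrite ler_wpM2r.
  rewrite [X in X <= _]natrM; apply: (le_trans h2).
  by rewrite mulrAC mulrC ler_wpM2l.
subst m; have [L [uL iL eL lL]] := @large_component_diameters b k n isT bk n0 many.
exists L; split => //.
have up : (diameter (@intrinsic_dist n (2 ^ k)) L)%:R <=
    (diameter_constant B).+1%:R * (2 ^ k)%:R :> R.
  by rewrite -natrM ler_nat (leq_trans iL) // leq_mul2r leqnSn orbT.
have lo : 1 / 2 * (2 ^ k)%:R <= (diameter (@extrinsic_dist n (2 ^ k)) L)%:R :> R.
  apply: le_trans (_ : (2 ^ k).-1%:R <= _); last by rewrite ler_nat.
  have : (2 <= 2 ^ k)%N by rewrite -{1}(expn1 2) leq_exp2l //; lia.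
  move: (2 ^ k)%N => a a2; have : (a%:R : R) <= (a.-1 + a.-1)%:R by rewrite ler_nat; lia.
  rewrite natrD; lra.
have le : (diameter (@extrinsic_dist n (2 ^ k)) L)%:R <=
    (diameter (@intrinsic_dist n (2 ^ k)) L)%:R :> R by rewrite ler_nat.
by split; apply/andP; split => //; [apply: le_trans le | apply: le_trans up].
Qed.
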